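(* Let $\ell$ be a prime and let $k_0$ be an infinite perfect field of characteristic $\neq \ell$. Let $K_0$ be a regular function field over $k_0$ of transcendence degree $\geq 5$, and put $K = K_0\cdot k$ where $k=\bar k_0$. Let $\mathbf{a}$ be an arbitrary (possibly empty) finite tuple of elements of $k_0^\times$. Then the canonical map $$\rho^{\rm M}_{k_0,K_0} : \operatorname{Gal}_{k_0}\rightarrow\underline{\operatorname{Aut}}^{\rm M}_{\mathbf{a}}(\mathrm{k}^{\rm M}_1(K))$$ is an isomorphism (of groups).
   Context: $k$ is the algebraic closure of $k_0$, $\operatorname{Gal}_{k_0} = \operatorname{Gal}(k|k_0)$. A function field $K_0|k_0$ (finitely generated field extension) is regular if it has a separating transcendence base and $k_0$ is relatively algebraically closed in $K_0$. $K = K_0\otimes_{k_0}k = K_0\cdot k$, and $\operatorname{Gal}_{k_0}\cong\operatorname{Gal}(K|K_0)$ acts on $K$. For a field $F$, $\mathrm{K}^{\rm M}_r(F) = (F^\times)^{\otimes r}/\langle x_1\otimes\cdots\otimes x_r : \exists i<j,\ x_i+x_j = 1\rangle$ and $\mathrm{k}^{\rm M}_r(F) = \mathrm{K}^{\rm M}_r(F)/\ell$; $\mathrm{k}^{\rm M}_*(F) = \bigoplus_{r\geq0}\mathrm{k}^{\rm M}_r(F)$ is the mod-$\ell$ Milnor K-ring, so $\mathrm{k}^{\rm M}_1(F) = F^\times/\ell$ (viewed as an additive group, i.e. a $\mathbb{Z}/\ell$-vector space). For $x\in K^\times$, $\{x\}_K$ denotes its image in $\mathrm{k}^{\rm M}_1(K)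 = K^\times/\ell$. $\operatorname{Aut}^{\rm M}(\mathrm{k}^{\rm M}_1(K))$ is the group of automorphisms of the group $\mathrm{k}^{\rm M}_1(K)$ which extend to a (graded ring) automorphism of $\mathrm{k}^{\rm M}_*(K)$. For $\mathbf{a} = (a_1,\ldots,a_r)$, $\operatorname{Aut}^{\rm M}_{\mathbf{a}}(\mathrm{k}^{\rm M}_1(K))$ is the subgroup of those $\phi\in\operatorname{Aut}^{\rm M}(\mathrm{k}^{\rm M}_1(K))$ such that for all non-constant $t\in K_0^\times$ (i.e. $t\in K_0\smallsetminus k_0$), $\phi$ restricts to an automorphism of the subgroup $\langle\{t\}_K,\{t-a_1\}_K,\ldots,\{t-a_r\}_K\rangle$ of $\mathrm{k}^{\rm M}_1(K)$. $(\mathbb{Z}/\ell)^\times$ acts by multiplication, and $\underline{\operatorname{Aut}}^{\rm M}_{\mathbf{a}}(\mathrm{k}^{\rm M}_1(K)) = \operatorname{Aut}^{\rm M}_{\mathbf{a}}(\mathrm{k}^{\rm M}_1(K))/(\mathbb{Z}/\ell)^\times$. The action of $\operatorname{Gal}_{k_0}\cong\operatorname{Gal}(K|K_0)$ on $K$ induces by functoriality an action on $\mathrm{k}^{\rm M}_*(K)$ which lands in $\operatorname{Aut}^{\rm M}_{\mathbf{a}}(\mathrm{k}^{\rm M}_1(K))$; $\rho^{\rm M}_{k_0,K_0}$ is the composite with the projection to $\underline{\operatorname{Aut}}^{\rm M}_{\mathbf{a}}(\mathrm{k}^{\rm M}_1(K))$. *)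

(* Defs.v *)
From HB Require Import structures.
From mathcomp Require Import all_boot all_order all_algebra cyclic separable.
From mathcomp Require Import generic_quotient ring_quotient freeg mpoly.
From mathcomp Require Import boolp.

Set Implicit Arguments.
Unset Strict Implicit.
Unset Printing Implicit Defensive.

Import GRing.Theory.
Local Open Scope ring_scope.
Local Open Scope quotient_scope.

Record normal_subgroup (G : groupType) := NormalSubgroup {
  normal_pred :> {pred G};
  normal_closed : group_closed normal_pred;
  normal_conj : forall x y, x \in normal_pred -> (x ^ y)%g \in normal_pred
}.

Section QuotientGroup.
Variables (G : groupType) (N : normal_subgroup G).

Let N1 : 1%g \in (N : {pred G}) := (normal_closed N).1.
Let NM := group_closedM (normal_closed N).
Let NV := group_closedV (normal_closed N).

Definition coset_rel (x y : G) := (x^-1 * y)%g \in (N : {pred G}).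

Lemma coset_rel_equiv : equiv_class_of coset_rel.
Proof.
split=> [x|x y|y x z]; rewrite /coset_rel.
- by rewrite mulVg.
- by apply/idP/idP => /NV; rewrite invgM invgK.
- by move=> xy yz; rewrite -[z](mulVKg y) mulgA; apply: NM.
Qed.

Canonical coset_equiv := EquivRelPack coset_rel_equiv.
Canonical coset_encModRel := defaultEncModRel coset_rel.

Definition group_quot := {eq_quot coset_rel}.
HB.instance Definition _ : EqQuotient G coset_rel group_quot :=
  EqQuotient.on group_quot.
HB.instance Definition _ := Choice.on group_quot.

Definition gpi (x : G) : group_quot := \pi_group_quot x.

Lemma gpiP x y : reflect (gpi x = gpi y) ((x^-1 * y)%g \in (N : {pred G})).
Proof. by apply: (iffP idP) => [h|/eqmodP //]; apply/eqmodP. Qed.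

Lemma gpi_repr (u : group_quot) : gpi (repr u) = u.
Proof. exact: reprK. Qed.

Lemma repr_gpi x : exists2 n, n \in (N : {pred G}) & repr (gpi x) = (x * n)%g.
Proof.
exists (x^-1 * repr (gpi x))%g; last by rewrite mulVKg.
by apply/gpiP; rewrite gpi_repr.
Qed.

Definition quot_mul (u v : group_quot) : group_quot := gpi (repr u * repr v)%g.
Definition quot_inv (u : group_quot) : group_quot := gpi (repr u)^-1%g.
Definition quot_one : group_quot := gpi 1%g.

Lemma quot_mulE x y : quot_mul (gpi x) (gpi y) = gpi (x * y)%g.
Proof.
have [m mN mE] := repr_gpi x; have [n nN nE] := repr_gpi y.
apply/esym/gpiP; rewrite mE nE (_ : _ * _ = (m ^ y) * n)%g.
  by apply: NM => //; apply: normal_conj.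
by rewrite /conjg invgM -!mulgA mulKg.
Qed.

Lemma quot_invE x : quot_inv (gpi x) = gpi x^-1%g.
Proof.
have [m mN mE] := repr_gpi x.
apply/gpiP; rewrite mE invgK (_ : _ * _ = m ^ x^-1)%g ?normal_conj //.
by rewrite /conjg invgK mulgA.
Qed.

Lemma quot_mulA : associative quot_mul.
Proof.
move=> u v w; rewrite -(gpi_repr u) -(gpi_repr v) -(gpi_repr w).
by rewrite !quot_mulE mulgA.
Qed.
Lemma quot_mul1 : left_id quot_one quot_mul.
Proof. by move=> u; rewrite -(gpi_repr u) quot_mulE mul1g. Qed.
Lemma quot_1mul : right_id quot_one quot_mul.
Proof. by move=> u; rewrite -(gpi_repr u) quot_mulE mulg1. Qed.
Lemma quot_mulV : left_inverse quot_one quot_inv quot_mul.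
Proof. by move=> u; rewrite -(gpi_repr u) quot_invE quot_mulE mulVg. Qed.
Lemma quot_Vmul : right_inverse quot_one quot_inv quot_mul.
Proof. by move=> u; rewrite -(gpi_repr u) quot_invE quot_mulE mulgV. Qed.

HB.instance Definition _ := isGroup.Build group_quot
  quot_mulA quot_mul1 quot_1mul quot_mulV quot_Vmul.

Lemma gpi_is_multiplicative : {morph gpi : x y / (x * y)%g}.
Proof. by move=> x y; rewrite -quot_mulE. Qed.
HB.instance Definition _ := isMultiplicative.Build G group_quot gpi
  gpi_is_multiplicative.
End QuotientGroup.

Section Sym.
Variable X : choiceType.

Record Sym := MkSym { sym_fun :> X -> X; _ : `[< bijective sym_fun >] }.
HB.instance Definition _ := [isSub for sym_fun].
HB.instance Definition _ := [Choice of Sym by <:].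

Lemma sym_bij (s : Sym) : bijective s.
Proof. by case: s => f fb; apply/asboolP. Qed.

Definition to_sym (f : X -> X) (bf : bijective f) : Sym :=
  MkSym (introT (asboolP _) bf).

Lemma symP (s t : Sym) : s =1 t -> s = t.
Proof. by move=> st; apply/val_inj/funext. Qed.

Lemma inv_ex (s : Sym) : exists g : X -> X, cancel s g /\ cancel g s.
Proof. by case: (sym_bij s) => g sg gs; exists g. Qed.

Definition sym_inv_fun (s : Sym) : X -> X := sval (cid (inv_ex s)).

Lemma sym_K (s : Sym) : cancel s (sym_inv_fun s).
Proof. by rewrite /sym_inv_fun; case: cid => g []. Qed.
Lemma sym_VK (s : Sym) : cancel (sym_inv_fun s) s.
Proof. by rewrite /sym_inv_fun; case: cid => g []. Qed.

Definition sym_one : Sym :=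
  to_sym (@Bijective _ _ id id (fun=> erefl) (fun=> erefl)).
(* Composition order: (s * t) x = s (t x). *)
Definition sym_mul (s t : Sym) : Sym := to_sym (bij_comp (sym_bij s) (sym_bij t)).
Definition sym_inv (s : Sym) : Sym := to_sym (Bijective (@sym_VK s) (@sym_K s)).

Lemma sym_mulA : associative sym_mul. Proof. by move=> s t u; apply: symP. Qed.
Lemma sym_1mul : left_id sym_one sym_mul. Proof. by move=> s; apply: symP. Qed.
Lemma sym_mul1 : right_id sym_one sym_mul. Proof. by move=> s; apply: symP. Qed.
Lemma sym_Vmul : left_inverse sym_one sym_inv sym_mul.
Proof. by move=> s; apply: symP => x /=; rewrite sym_K. Qed.
Lemma sym_mulV : right_inverse sym_one sym_inv sym_mul.
Proof. by move=> s; apply: symP => x /=; rewrite sym_VK. Qed.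

HB.instance Definition _ := isGroup.Build Sym
  sym_mulA sym_1mul sym_mul1 sym_Vmul sym_mulV.

Lemma symM (s t : Sym) x : (s * t)%g x = s (t x). Proof. by []. Qed.
Lemma sym1 x : (1%g : Sym) x = x. Proof. by []. Qed.
Lemma symK (s : Sym) : cancel s (s^-1)%g. Proof. exact: sym_K. Qed.
Lemma symVK (s : Sym) : cancel (s^-1)%g s. Proof. exact: sym_VK. Qed.
End Sym.

Section Span.
Variables (V : zmodType) (S : V -> Prop).

Definition span : {pred V} := fun x =>
  `[< forall H : zmodClosed V, (forall y, S y -> y \in H) -> x \in H >].

Lemma spanS y : S y -> y \in span.
Proof. by move=> Sy; apply/asboolP => H; apply. Qed.

Lemma span_zmod_closed : zmod_closed span.
Proof.
split=> [|x y /asboolP xS /asboolP yS]; apply/asboolP => H SH; first exact: rpred0.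
by rewrite rpredB ?xS ?yS.
Qed.
HB.instance Definition _ := GRing.isZmodClosed.Build V span span_zmod_closed.

Lemma span_min (H : zmodClosed V) : (forall y, S y -> y \in H) -> {subset span <= H}.
Proof. by move=> SH x /asboolP; apply. Qed.

Definition quo := {ideal_quot span}.
HB.instance Definition _ := GRing.Zmodule.on quo.
HB.instance Definition _ := Quotient.on quo.

Definition qpi (x : V) : quo := \pi_quo x.

Lemma qpi_is_zmod : zmod_morphism qpi.
Proof. by move=> x y; rewrite /qpi !piE. Qed.
HB.instance Definition _ := GRing.isZmodMorphism.Build V quo qpi qpi_is_zmod.

Lemma qpiP x y : reflect (qpi x = qpi y) (x - y \in span).
Proof. by rewrite (Quotient.idealrBE span); apply: eqP. Qed.

Lemma qpi_repr (u : quo) : qpi (repr u) = u.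
Proof. exact: reprK. Qed.

Lemma qpi0 x : S x -> qpi x = 0.
Proof. by move=> Sx; rewrite -(raddf0 qpi); apply/qpiP; rewrite subr0 spanS. Qed.

Lemma vanish_span (W : zmodType) (f : {additive V -> W}) :
  (forall y, S y -> f y = 0) -> forall x, x \in span -> f x = 0.
Proof.
move=> fS x /asboolP xS; pose K : {pred V} := fun y => f y == 0.
have Kz : zmod_closed K.
  split=> [|y z]; rewrite !unfold_in /K ?raddf0 // => /eqP fy /eqP fz.
  by rewrite raddfB fy fz subr0.
pose Kp := GRing.isZmodClosed.Build V K Kz.
pose KZ : zmodClosed V := HB.pack K Kp.
by apply/eqP; apply: (xS KZ) => y Sy; apply/eqP/fS.
Qed.

Lemma quo_liftE (W : zmodType) (f : {additive V -> W}) :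
  (forall y, S y -> f y = 0) -> forall x, f (repr (qpi x)) = f x.
Proof.
move=> fS x; apply/eqP; rewrite -subr_eq0 -raddfB; apply/eqP/vanish_span => //.
by apply/qpiP; rewrite qpi_repr.
Qed.

Lemma quo_lift_zmod (W : zmodType) (f : {additive V -> W}) :
  (forall y, S y -> f y = 0) -> zmod_morphism (fun u : quo => f (repr u)).
Proof.
move=> fS u v; rewrite -[u]qpi_repr -[v]qpi_repr -(raddfB qpi).
by rewrite !quo_liftE // raddfB.
Qed.
End Span.

Section Quo2.
Variables (V W U : zmodType) (S : V -> Prop) (T : W -> Prop) (f : V -> W -> U).

Definition biadditive :=
  (forall y, zmod_morphism (f^~ y)) /\ (forall x, zmod_morphism (f x)).

Definition quo2 (u : quo S) (v : quo T) : U := f (repr u) (repr v).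

Hypotheses (fD : biadditive).
Hypotheses (fS : forall x y, S x -> f x y = 0) (fT : forall x y, T y -> f x y = 0).

Lemma quo2E x y : quo2 (qpi S x) (qpi T y) = f x y.
Proof.
have fl y' : f (repr (qpi S x)) y' = f x y'.
  pose g : {additive V -> U} := HB.pack (f^~ y')
    (GRing.isZmodMorphism.Build _ _ (f^~ y') (fD.1 y')).
  by apply: (@quo_liftE _ S _ g) => s Ss; apply: fS.
pose g : {additive W -> U} := HB.pack (f x)
  (GRing.isZmodMorphism.Build _ _ (f x) (fD.2 x)).
by rewrite /quo2 fl; apply: (@quo_liftE _ T _ g) => t Tt; apply: fT.
Qed.

Lemma quo2_biadditive : (forall v, zmod_morphism (quo2^~ v)) /\
                        (forall u, zmod_morphism (quo2 u)).
Proof.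
split=> [v u u'|u v v'].
- rewrite -[v]qpi_repr -[u]qpi_repr -[u']qpi_repr -raddfB.
  by rewrite !quo2E fD.1.
- rewrite -[u]qpi_repr -[v]qpi_repr -[v']qpi_repr -raddfB.
  by rewrite !quo2E fD.2.
Qed.
End Quo2.

Lemma biadditive_comp (V W U U' : zmodType) (f : V -> W -> U)
    (g : {additive U -> U'}) :
  biadditive f -> biadditive (fun x y => g (f x y)).
Proof. by move=> [f1 f2]; split=> [y a b|x a b]; rewrite -raddfB ?f1 ?f2. Qed.

Section FreeLift.
Variables (X : choiceType) (W : zmodType).

Definition flift (f : X -> W) (x : {freeg X / int}) : W :=
  fglift (f : X -> zmodule W) x.

Lemma flift_is_zmod f : zmod_morphism (flift f).
Proof. exact: (@lift_is_additive _ _ (zmodule W)). Qed.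
HB.instance Definition _ f :=
  GRing.isZmodMorphism.Build {freeg X / int} W (flift f) (flift_is_zmod f).

Lemma fliftE f t : flift f << t >> = f t.
Proof. by have := liftU (f : X -> zmodule W) 1 t; rewrite scale1r. Qed.

Lemma freeg_ext (f g : {additive {freeg X / int} -> W}) :
  (forall t, f << t >> = g << t >>) -> f =1 g.
Proof.
move=> fg x; rewrite -(freeg_sumE x) !raddf_sum; apply: eq_bigr => t _.
by rewrite -[coeff t x]intz -freegU_mulz !raddfMz fg.
Qed.

Lemma freeg_ext0 (f : {freeg X / int} -> W) : zmod_morphism f ->
  (forall t, f << t >> = 0) -> forall x, f x = 0.
Proof.
move=> fz f0; pose g : {additive {freeg X / int} -> W} :=
  HB.pack f (GRing.isZmodMorphism.Build _ _ f fz).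
have h : g =1 (\0 : {additive _ -> _}) by apply: freeg_ext.
exact: h.
Qed.
End FreeLift.

Section Milnor.
Variable ell : nat.

Section Groups.
Variable F : fieldType.

Definition units := {x : F | x != 0}.
HB.instance Definition _ := SubChoice.on units.

(* Total by convention: to_unit 0 = 1. *)
Definition to_unit (x : F) : units := insubd (exist _ 1 (oner_neq0 F)) x.

Section Degree.
Variable r : nat.

Definition words := {freeg (r.-tuple units) / int}.

Definition multilinear (x : words) : Prop :=
  exists (i : 'I_r) (t t1 t2 : r.-tuple units),
    [/\ val (tnth t i) = val (tnth t1 i) * val (tnth t2 i),
        forall j, j != i -> tnth t1 j = tnth t j /\ tnth t2 j = tnth t j
      & x = << t >> - << t1 >> - << t2 >>].

(* The r-th tensor power over Z of the group F^x of units; for r = 0 there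
   are no relations and this is Z. *)
Definition tensor_power := quo multilinear.
Definition pure (t : r.-tuple units) : tensor_power := qpi multilinear << t >>.

Definition steinberg (x : tensor_power) : Prop :=
  exists (t : r.-tuple units) (i j : 'I_r),
    [/\ (i < j)%N, val (tnth t i) + val (tnth t j) = 1 & x = pure t].

Definition milnorK := quo steinberg.

Definition ell_multiple (x : milnorK) : Prop := exists y, x = y *+ ell.

(* k^M_r(F); in degree 1 this is F^x / ell, written additively. *)
Definition kM := quo ell_multiple.

HB.instance Definition _ := GRing.Zmodule.on tensor_power.
HB.instance Definition _ := GRing.Zmodule.on milnorK.
HB.instance Definition _ := GRing.Zmodule.on kM.

Definition symbol (t : r.-tuple units) : kM :=
  qpi ell_multiple (qpi steinberg (pure t)).

Lemma kM_ext (W : zmodType) (f g : {additive kM -> W}) :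
  (forall t, f (symbol t) = g (symbol t)) -> f =1 g.
Proof.
move=> fg u; rewrite -[u]qpi_repr -[repr u]qpi_repr -[repr (repr u)]qpi_repr.
exact: (@freeg_ext _ _ (f \o (qpi _ \o (qpi _ \o qpi _)))
                       (g \o (qpi _ \o (qpi _ \o qpi _)))).
Qed.

Lemma kM_ext0 (W : zmodType) (f : kM -> W) : zmod_morphism f ->
  (forall t, f (symbol t) = 0) -> forall x, f x = 0.
Proof.
move=> fz f0; pose g : {additive kM -> W} :=
  HB.pack f (GRing.isZmodMorphism.Build _ _ f fz).
have h : g =1 (\0 : {additive _ -> _}) by apply: kM_ext.
exact: h.
Qed.

Lemma kM_torsion (x : kM) : x *+ ell = 0.
Proof.
rewrite -[x]qpi_repr -(raddfMn (qpi ell_multiple)).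
by apply: qpi0; exists (repr x).
Qed.
End Degree.
End Groups.

Section Product.
Variable F : fieldType.
Variables r s : nat.

Definition word_mul (x : words F r) (y : words F s) : words F (r + s) :=
  flift (fun t : r.-tuple (units F) =>
    flift (fun u : s.-tuple (units F) => << cat_tuple t u >> : words F (r + s)) y) x.

Lemma word_mulE t u :
  word_mul << t >> << u >> = << cat_tuple t u >> :> words F (r + s).
Proof. by rewrite /word_mul !fliftE. Qed.

Lemma word_mul_biadditive : biadditive word_mul.
Proof.
have wl y : zmod_morphism (word_mul^~ y) by move=> a b; apply: raddfB.
split=> // x a b.
pose h := flift (fun t : r.-tuple (units F) => flift
  (fun u : s.-tuple (units F) => << cat_tuple t u >> : words F (r + s)) (a - b)).
pose h' x := word_mul x a - word_mul x b.
have h'z : zmod_morphism h'.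
  by move=> c d; rewrite /h' !wl !opprD !opprK addrACA.
pose h'' : {additive words F r -> words F (r + s)} :=
  HB.pack h' (GRing.isZmodMorphism.Build _ _ h' h'z).
apply: (@freeg_ext _ _ h h'') => t.
by rewrite /h /= /h' /word_mul !fliftE raddfB.
Qed.

Definition tensor_mul : tensor_power F r -> tensor_power F s ->
    tensor_power F (r + s) :=
  quo2 (fun x y => qpi _ (word_mul x y)).

Definition milnorK_mul : milnorK F r -> milnorK F s -> milnorK F (r + s) :=
  quo2 (fun x y => qpi _ (tensor_mul x y)).

(* The product of the graded ring k^M_*(F): concatenation of symbols, see
   [kM_mul_symbol]; the representatives hidden in [quo2] do not matter by
   [quo2E]. *)
Definition kM_mul : kM F r -> kM F s -> kM F (r + s) :=
  quo2 (fun x y => qpi _ (milnorK_mul x y)).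

Lemma tensor_vanishl (x : words F r) y : multilinear x ->
  qpi (@multilinear F (r + s)) (word_mul x y) = 0.
Proof.
move=> [i [t [t1 [t2 [ti tj ->]]]]]; have wD := word_mul_biadditive.
pose f := fun y => qpi (@multilinear F (r + s)) (word_mul (<< t >> - << t1 >> - << t2 >>) y).
apply: (@freeg_ext0 _ _ f) => [a b|u]; first by rewrite /f wD.2 raddfB.
apply: qpi0; rewrite !wD.1 !word_mulE.
exists (lshift s i), (cat_tuple t u), (cat_tuple t1 u), (cat_tuple t2 u).
split=> //; first by rewrite !tnth_lshift.
move=> j; rewrite -(splitK j); case: (split j) => k /= kj.
  by rewrite !tnth_lshift; apply: tj; apply: contraNneq kj => ->.
by rewrite !tnth_rshift.
Qed.

Lemma tensor_vanishr (x : words F r) (y : words F s) : multilinear y ->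
  qpi (@multilinear F (r + s)) (word_mul x y) = 0.
Proof.
move=> [i [t [t1 [t2 [ti tj ->]]]]]; have wD := word_mul_biadditive.
pose f := fun x => qpi (@multilinear F (r + s)) (word_mul x (<< t >> - << t1 >> - << t2 >>)).
apply: (@freeg_ext0 _ _ f) => [a b|u]; first by rewrite /f wD.1 raddfB.
apply: qpi0; rewrite !wD.2 !word_mulE.
exists (rshift r i), (cat_tuple u t), (cat_tuple u t1), (cat_tuple u t2).
split=> //; first by rewrite !tnth_rshift.
move=> j; rewrite -(splitK j); case: (split j) => k /= kj.
  by rewrite !tnth_lshift.
by rewrite !tnth_rshift; apply: tj; apply: contraNneq kj => ->.
Qed.

Lemma tensor_mulE x y : tensor_mul (qpi _ x) (qpi _ y) = qpi _ (word_mul x y).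
Proof.
apply: quo2E; [exact: biadditive_comp word_mul_biadditive | exact: tensor_vanishl
  | exact: tensor_vanishr].
Qed.

Lemma tensor_mul_biadditive : biadditive tensor_mul.
Proof.
apply: quo2_biadditive; [exact: biadditive_comp word_mul_biadditive
  | exact: tensor_vanishl | exact: tensor_vanishr].
Qed.

Lemma tensor_mul_pure t u : tensor_mul (pure t) (pure u) = pure (cat_tuple t u).
Proof. by rewrite /pure tensor_mulE word_mulE. Qed.

Lemma milnorK_vanishl x y : @steinberg F r x ->
  qpi (@steinberg F (r + s)) (tensor_mul x y) = 0.
Proof.
move=> [t [i [j [ij tij ->]]]]; have wD := tensor_mul_biadditive.
rewrite -[y]qpi_repr.
pose f := fun y => qpi (@steinberg F (r + s)) (tensor_mul (pure t) (qpi _ y)).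
apply: (@freeg_ext0 _ _ f) => [a b|u]; first by rewrite /f raddfB wD.2 raddfB.
apply: qpi0; rewrite tensor_mul_pure.
by exists (cat_tuple t u), (lshift s i), (lshift s j); rewrite !tnth_lshift.
Qed.

Lemma milnorK_vanishr x y : @steinberg F s y ->
  qpi (@steinberg F (r + s)) (tensor_mul x y) = 0.
Proof.
move=> [t [i [j [ij tij ->]]]]; have wD := tensor_mul_biadditive.
rewrite -[x]qpi_repr.
pose f := fun x => qpi (@steinberg F (r + s)) (tensor_mul (qpi _ x) (pure t)).
apply: (@freeg_ext0 _ _ f) => [a b|u]; first by rewrite /f raddfB wD.1 raddfB.
apply: qpi0; rewrite tensor_mul_pure.
exists (cat_tuple u t), (rshift r i), (rshift r j).
by rewrite !tnth_rshift /= ltn_add2l.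
Qed.

Lemma milnorK_mulE x y : milnorK_mul (qpi _ x) (qpi _ y) = qpi _ (tensor_mul x y).
Proof.
apply: quo2E; [exact: biadditive_comp tensor_mul_biadditive
  | exact: milnorK_vanishl | exact: milnorK_vanishr].
Qed.

Lemma milnorK_mul_biadditive : biadditive milnorK_mul.
Proof.
apply: quo2_biadditive; [exact: biadditive_comp tensor_mul_biadditive
  | exact: milnorK_vanishl | exact: milnorK_vanishr].
Qed.

Lemma kM_vanishl x y : @ell_multiple F r x ->
  qpi (@ell_multiple F (r + s)) (milnorK_mul x y) = 0.
Proof.
move=> [z ->]; apply: qpi0; exists (milnorK_mul z y).
pose f : {additive milnorK F r -> milnorK F (r + s)} := HB.pack (milnorK_mul^~ y)
  (GRing.isZmodMorphism.Build _ _ _ (milnorK_mul_biadditive.1 y)).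
exact: (raddfMn f).
Qed.

Lemma kM_vanishr x y : @ell_multiple F s y ->
  qpi (@ell_multiple F (r + s)) (milnorK_mul x y) = 0.
Proof.
move=> [z ->]; apply: qpi0; exists (milnorK_mul x z).
pose f : {additive milnorK F s -> milnorK F (r + s)} := HB.pack (milnorK_mul x)
  (GRing.isZmodMorphism.Build _ _ _ (milnorK_mul_biadditive.2 x)).
exact: (raddfMn f).
Qed.

Lemma kM_mulE x y : kM_mul (qpi _ x) (qpi _ y) = qpi _ (milnorK_mul x y).
Proof.
apply: quo2E; [exact: biadditive_comp milnorK_mul_biadditive
  | exact: kM_vanishl | exact: kM_vanishr].
Qed.

Lemma kM_mul_biadditive : biadditive kM_mul.
Proof.
apply: quo2_biadditive; [exact: biadditive_comp milnorK_mul_biadditive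
  | exact: kM_vanishl | exact: kM_vanishr].
Qed.

Lemma kM_mul_symbol t u : kM_mul (symbol t) (symbol u) = symbol (cat_tuple t u).
Proof. by rewrite /symbol kM_mulE milnorK_mulE tensor_mul_pure. Qed.
End Product.

Definition kM_one (F : fieldType) : kM F 0 := symbol [tuple].

(* The class {x}; by the convention of [to_unit], {0} = 0. *)
Definition kM_class (F : fieldType) (x : F) : kM F 1 := symbol [tuple to_unit x].

Section Functoriality.
Variables (F F' : fieldType) (f : {rmorphism F -> F'}).

Lemma unit_map_subproof (u : units F) : f (val u) != 0.
Proof. by rewrite fmorph_eq0 (valP u). Qed.
Definition unit_map (u : units F) : units F' :=
  Sub (f (val u)) (unit_map_subproof u).

Section Degree.
Variable r : nat.
Let tmap (t : r.-tuple (units F)) : r.-tuple (units F') := map_tuple unit_map t.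

Definition word_map : words F r -> words F' r := flift (fun t => << tmap t >>).
HB.instance Definition _ := GRing.isZmodMorphism.Build _ _ word_map
  (flift_is_zmod (fun t => << tmap t >>)).

Definition tensor_map (x : tensor_power F r) : tensor_power F' r :=
  qpi _ (word_map (repr x)).

Definition milnorK_map (x : milnorK F r) : milnorK F' r :=
  qpi _ (tensor_map (repr x)).

Definition kM_map (x : kM F r) : kM F' r := qpi _ (milnorK_map (repr x)).

Lemma word_map_vanish x : multilinear x -> qpi (@multilinear F' r) (word_map x) = 0.
Proof.
move=> [i [t [t1 [t2 [ti tj ->]]]]]; apply: qpi0.
rewrite !raddfB /= /word_map !fliftE.
exists i, (tmap t), (tmap t1), (tmap t2); split=> //.
  by rewrite !tnth_map /= ti rmorphM.
by move=> j /tj [e1 e2]; rewrite !tnth_map e1 e2.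
Qed.

Lemma tensor_mapE x : tensor_map (qpi _ x) = qpi _ (word_map x).
Proof. exact: (@quo_liftE _ _ _ (qpi (@multilinear F' r) \o word_map) word_map_vanish). Qed.

Lemma tensor_map_zmod : zmod_morphism tensor_map.
Proof. exact: (@quo_lift_zmod _ _ _ (qpi (@multilinear F' r) \o word_map) word_map_vanish). Qed.
HB.instance Definition _ := GRing.isZmodMorphism.Build _ _ tensor_map tensor_map_zmod.

Lemma tensor_map_vanish x : steinberg x -> qpi (@steinberg F' r) (tensor_map x) = 0.
Proof.
move=> [t [i [j [ij tij ->]]]]; apply: qpi0; exists (tmap t), i, j; split=> //.
  by rewrite !tnth_map /= -rmorphD tij rmorph1.
by rewrite /pure tensor_mapE /word_map fliftE.
Qed.

Lemma milnorK_mapE x : milnorK_map (qpi _ x) = qpi _ (tensor_map x).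
Proof. exact: (@quo_liftE _ _ _ (qpi (@steinberg F' r) \o tensor_map) tensor_map_vanish). Qed.

Lemma milnorK_map_zmod : zmod_morphism milnorK_map.
Proof. exact: (@quo_lift_zmod _ _ _ (qpi (@steinberg F' r) \o tensor_map) tensor_map_vanish). Qed.
HB.instance Definition _ := GRing.isZmodMorphism.Build _ _ milnorK_map milnorK_map_zmod.

Lemma milnorK_map_vanish x : ell_multiple x -> qpi (@ell_multiple F' r) (milnorK_map x) = 0.
Proof. by move=> [y ->]; apply: qpi0; exists (milnorK_map y); rewrite raddfMn. Qed.

Lemma kM_mapE x : kM_map (qpi _ x) = qpi _ (milnorK_map x).
Proof. exact: (@quo_liftE _ _ _ (qpi (@ell_multiple F' r) \o milnorK_map) milnorK_map_vanish). Qed.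

Lemma kM_map_zmod : zmod_morphism kM_map.
Proof. exact: (@quo_lift_zmod _ _ _ (qpi (@ell_multiple F' r) \o milnorK_map) milnorK_map_vanish). Qed.
HB.instance Definition _ := GRing.isZmodMorphism.Build _ _ kM_map kM_map_zmod.

Lemma kM_map_symbol t : kM_map (symbol t) = symbol (tmap t).
Proof. by rewrite /symbol kM_mapE milnorK_mapE tensor_mapE /word_map fliftE. Qed.
End Degree.

Lemma kM_map_one : kM_map (kM_one F) = kM_one F'.
Proof. by rewrite kM_map_symbol; congr symbol; apply: val_inj. Qed.

Lemma kM_map_mul r s (x : kM F r) (y : kM F s) :
  kM_map (kM_mul x y) = kM_mul (kM_map x) (kM_map y).
Proof.
have mD := @kM_mul_biadditive F r s; have mD' := @kM_mul_biadditive F' r s.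
pose h y x := kM_map (@kM_mul F r s x y) - kM_mul (kM_map x) (kM_map y).
apply/eqP; rewrite -subr_eq0; apply/eqP; rewrite -/(h y x).
apply: (@kM_ext0 _ _ _ (h y)) => [a b|t].
  by rewrite /h raddfB mD.1 mD'.1 raddfB !opprD !opprK addrACA.
apply: (@kM_ext0 _ _ _ (fun y => h y (symbol t))) => [a b|u].
  by rewrite /h raddfB mD.2 mD'.2 raddfB !opprD !opprK addrACA.
rewrite /h kM_mul_symbol !kM_map_symbol kM_mul_symbol; apply/eqP; rewrite subr_eq0.
by apply/eqP; congr symbol; apply: val_inj; rewrite /= map_cat.
Qed.

Lemma kM_map_class x : kM_map (kM_class x) = kM_class (f x).
Proof.
rewrite kM_map_symbol; congr symbol; apply: val_inj => /=; congr [:: _].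
apply: val_inj => /=; rewrite !val_insubd fmorph_eq0.
by case: ifP => //= _; rewrite rmorph1.
Qed.
End Functoriality.

Lemma kM_map_comp (F F' F'' : fieldType) (f : {rmorphism F -> F'})
    (g : {rmorphism F' -> F''}) (h : {rmorphism F -> F''}) r :
  g \o f =1 h -> @kM_map _ _ g r \o @kM_map _ _ f r =1 @kM_map _ _ h r.
Proof.
move=> gf; apply: kM_ext => t; rewrite /= !kM_map_symbol; congr symbol.
apply: val_inj; rewrite /= -map_comp; apply: eq_map => u.
by apply: val_inj; rewrite /= -gf.
Qed.

Lemma kM_map_id (F : fieldType) (f : {rmorphism F -> F}) r :
  f =1 id -> @kM_map _ _ f r =1 id.
Proof.
move=> fid; apply: (@kM_ext _ _ _ (kM_map f (r := r)) idfun) => t.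
rewrite /= kM_map_symbol; congr symbol; apply: val_inj => /=.
by rewrite -[RHS]map_id; apply: eq_map => u; apply: val_inj; rewrite /= fid.
Qed.

End Milnor.

Section GaloisGroup.
Variables (F E : fieldType) (i : {rmorphism F -> E}).

Definition is_gal (s : Sym E) : Prop :=
  [/\ zmod_morphism s, GRing.monoid_morphism s & forall c, s (i c) = i c].

Definition gal_pred : {pred Sym E} := fun s => `[< is_gal s >].

Record gal := MkGal { gal_val :> Sym E; _ : gal_val \in gal_pred }.
HB.instance Definition _ := [isSub for gal_val].
HB.instance Definition _ := [Choice of gal by <:].

Lemma galP (s : gal) : is_gal s.
Proof. by case: s => s sP; apply/asboolP. Qed.

Lemma gal_group_closed : group_closed gal_pred.
Proof.
split=> [|s t /asboolP [sB [s1 sM] sF] /asboolP [tB [t1 tM] tF]]; apply/asboolP.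
  by split=> //; split.
have tI := can_inj (symK t); split.
- by move=> x y; rewrite !symM -sB; congr (s _); apply: tI; rewrite tB !symVK.
- split=> [|x y]; rewrite !symM; first by rewrite -[RHS]s1 -[in LHS]t1 symK.
  by rewrite -sM; congr (s _); apply: tI; rewrite tM !symVK.
- by move=> c; rewrite symM -[in LHS](tF c) symK sF.
Qed.
HB.instance Definition _ :=
  SubChoice_isSubGroup.Build (Sym E) gal_pred gal gal_group_closed.

Definition gal_fun (s : gal) : E -> E := s.
HB.instance Definition _ s :=
  GRing.isZmodMorphism.Build E E (gal_fun s) (let: And3 h _ _ := galP s in h).
HB.instance Definition _ s :=
  GRing.isMonoidMorphism.Build E E (gal_fun s) (let: And3 _ h _ := galP s in h).

Lemma gal_fix (s : gal) c : s (i c) = i c.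
Proof. by case: (galP s). Qed.

Definition to_gal (f g : {rmorphism E -> E}) (fg : cancel f g) (gf : cancel g f)
  (fi : forall c, f (i c) = i c) : gal :=
  MkGal (introT (asboolP (is_gal (to_sym (Bijective fg gf))))
    (And3 (raddfB f) (rmorph1 f, rmorphM f) fi)).
End GaloisGroup.

Section FieldExtensions.
Variables (F E : fieldType) (i : {rmorphism F -> E}).

(* The subfield i(F)(s) of E, as the intersection of all subfields of E
   containing i(F) and s. *)
Definition adjoin (s : seq E) : {pred E} := fun x =>
  `[< forall L : divringClosed E,
        (forall c, i c \in L) -> {subset s <= L} -> x \in L >].

Definition finitely_generated : Prop := exists s : seq E, forall x, x \in adjoin s.

Definition algebraically_independent (n : nat) (b : n.-tuple E) : Prop :=
  forall p : {mpoly F[n]}, mmap i (tnth b) p = 0 -> p = 0.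

(* Only finite transcendence bases are considered: they are used for finitely
   generated extensions. *)
Definition transcendence_base (n : nat) (b : n.-tuple E) : Prop :=
  algebraically_independent b /\
  forall x, exists2 p : {poly E}, p \is a polyOver (adjoin b) & p != 0 /\ root p x.

Definition separating_transcendence_base (n : nat) (b : n.-tuple E) : Prop :=
  transcendence_base b /\
  forall x, exists2 p : {poly E}, p \is a polyOver (adjoin b) &
    separable_poly p /\ root p x.

Definition transcendence_degree (n : nat) : Prop :=
  exists b : n.-tuple E, transcendence_base b.

Definition relatively_algebraically_closed : Prop :=
  forall x : E, algebraicOver i x -> exists c, x = i c.

Definition regular_function_field : Prop :=
  [/\ finitely_generated,
      exists n (b : n.-tuple E), separating_transcendence_base b
    & relatively_algebraically_closed].

Definition algebraic_closure : Prop :=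
  GRing.closed_field_axiom E /\ forall x : E, algebraicOver i x.
End FieldExtensions.

Definition perfect_field (F : fieldType) : Prop :=
  forall p : {poly F}, irreducible_poly p -> separable_poly p.

Definition infinite_field (F : fieldType) : Prop :=
  forall s : seq F, exists x, x \notin s.

(* K = K0 (x)_{k0} k, by the universal property of the tensor product as the
   pushout of commutative rings; jK and jk are the two coprojections. *)
Definition is_tensor_product (k0 K0 k K : fieldType)
    (iK : {rmorphism k0 -> K0}) (ik : {rmorphism k0 -> k})
    (jK : {rmorphism K0 -> K}) (jk : {rmorphism k -> K}) : Prop :=
  jK \o iK =1 jk \o ik /\
  forall (A : comPzRingType) (f : {rmorphism K0 -> A}) (g : {rmorphism k -> A}),
    f \o iK =1 g \o ik ->
    exists2 h : {rmorphism K -> A}, h \o jK =1 f /\ h \o jk =1 g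
      & forall h' : {rmorphism K -> A}, h' \o jK =1 f -> h' \o jk =1 g -> h' =1 h.

Section BaseChange.
Variables (k0 K0 k K : fieldType).
Variables (iK : {rmorphism k0 -> K0}) (ik : {rmorphism k0 -> k}).
Variables (jK : {rmorphism K0 -> K}) (jk : {rmorphism k -> K}).
Hypothesis KP : is_tensor_product iK ik jK jk.

Definition extends (s : k -> k) (t : K -> K) : Prop :=
  t \o jK =1 jK /\ forall c, t (jk c) = jk (s c).

Lemma gal_ext_ex (s : gal ik) :
  exists2 h : {rmorphism K -> K}, extends s h
    & forall h' : {rmorphism K -> K}, extends s h' -> h' =1 h.
Proof.
have [e univ] := KP.
have c : jK \o iK =1 (jk \o gal_fun s) \o ik.
  by move=> x; rewrite e /= [gal_fun s _](gal_fix s).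
have [h [h1 h2] hU] := univ K jK (jk \o gal_fun s) c.
by exists h; [split | move=> h' [? ?]; apply: hU].
Qed.

Lemma gal_ext_rmorph_sig (s : gal ik) : {h : {rmorphism K -> K} | extends s h}.
Proof. by apply: cid; have [h] := gal_ext_ex s; exists h. Qed.

Definition gal_ext_rmorph (s : gal ik) := sval (gal_ext_rmorph_sig s).

Lemma gal_ext_rmorphP (s : gal ik) : extends s (gal_ext_rmorph s).
Proof. exact: svalP (gal_ext_rmorph_sig s). Qed.

Lemma extends_uniq (s : gal ik) (h h' : {rmorphism K -> K}) :
  extends s h -> extends s h' -> h =1 h'.
Proof.
have [h0 _ hU] := gal_ext_ex s => e1 e2 x.
by rewrite (hU _ e1) (hU _ e2).
Qed.

Lemma gal_ext_cancel (s t : gal ik) : (s * t)%g = 1%g ->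
  cancel (gal_ext_rmorph t) (gal_ext_rmorph s).
Proof.
move=> st; apply: (@extends_uniq 1%g (gal_ext_rmorph s \o gal_ext_rmorph t) idfun).
  have [s1 s2] := gal_ext_rmorphP s; have [t1 t2] := gal_ext_rmorphP t.
  split=> [x|c] /=; first by rewrite [X in gal_ext_rmorph s X]t1 [LHS]s1.
  by rewrite t2 s2; congr (jk _); apply: (congr1 (fun u : gal ik => u c) st).
by split.
Qed.

(* The element of Gal(K | K0) restricting to a given element of Gal(k | k0);
   this is the inverse of the restriction isomorphism. *)
Definition gal_ext (s : gal ik) : gal jK :=
  to_gal (gal_ext_cancel (mulVg s)) (gal_ext_cancel (mulgV s))
         (gal_ext_rmorphP s).1.

Lemma gal_extE (s : gal ik) (c : k) : gal_ext s (jk c) = jk (s c).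
Proof. exact: (gal_ext_rmorphP s).2. Qed.

Lemma gal_ext_uniq (s : gal ik) (t : gal jK) :
  (forall c, t (jk c) = jk (s c)) -> t = gal_ext s.
Proof.
move=> tE; apply/val_inj/symP; apply: (@extends_uniq s (gal_fun t)).
  by split=> // x; apply: (gal_fix t).
exact: gal_ext_rmorphP.
Qed.
End BaseChange.

Section AutM.
Variables (ell : nat) (k0 K0 K : fieldType).
Variables (iK : {rmorphism k0 -> K0}) (jK : {rmorphism K0 -> K}) (a : seq k0).

Local Notation kM r := (kM ell K r).

(* phi is the degree-1 part of an automorphism of the graded ring k^M_*(K),
   which is given by its restrictions Phi r to the homogeneous components. *)
Definition milnor_automorphism (phi : kM 1 -> kM 1) : Prop :=
  exists Phi : forall r, {additive kM r -> kM r},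
    [/\ forall r, bijective (Phi r),
        Phi 0%N (kM_one ell K) = kM_one ell K,
        forall r s (x : kM r) (y : kM s),
          Phi (r + s)%N (kM_mul x y) = kM_mul (Phi r x) (Phi s y)
      & Phi 1%N =1 phi].

(* For t outside iK(k0) neither t nor t - a_i vanishes, so the convention
   {0} = 0 is not used. *)
Definition line_subgroup (t : K0) : {pred kM 1} :=
  span (fun x => x = kM_class ell (jK t) \/
                 exists2 c, c \in a & x = kM_class ell (jK (t - iK c))).

(* Injectivity on H is not repeated: it is applied to bijections phi only. *)
Definition restricts_to_automorphism (phi : kM 1 -> kM 1) (H : {pred kM 1}) : Prop :=
  (forall x, x \in H -> phi x \in H) /\
  (forall y, y \in H -> exists2 x, x \in H & phi x = y).

Definition is_autM (phi : Sym (kM 1)) : Prop :=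
  milnor_automorphism phi /\
  forall t : K0, (forall c, t != iK c) ->
    restricts_to_automorphism phi (line_subgroup t).

Definition autM_pred : {pred Sym (kM 1)} := fun phi => `[< is_autM phi >].

(* Aut^M_a(k^M_1(K)); additivity is part of [milnor_automorphism], since phi
   agrees with the additive map Phi 1. *)
Record autM := MkAutM { autM_val :> Sym (kM 1); _ : autM_val \in autM_pred }.
HB.instance Definition _ := [isSub for autM_val].
HB.instance Definition _ := [Choice of autM by <:].

Lemma autMP (phi : autM) : is_autM phi.
Proof. by case: phi => s sP; apply/asboolP. Qed.

Lemma autM_group_closed : group_closed autM_pred.
Proof.
split=> [|s t /asboolP [[Phi [Pb P1 PM PE]] sH] /asboolP [[Psi [Qb Q1 QM QE]] tH]].
  apply/asboolP; split; last by move=> t _; split=> // y Hy; exists y.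
  by exists (fun r => idfun); split=> // r; apply: sym_bij 1%g.
apply/asboolP; split; last first.
  move=> u uc; have [s1 s2] := sH u uc; have [t1 t2] := tH u uc; split=> x xH.
    by rewrite symM; apply: s1; have [y yH <-] := t2 x xH; rewrite symK.
  by have [y yH <-] := s2 x xH; exists (t y); [apply: t1 | rewrite symM symK].
pose Q r : Sym (kM r) := to_sym (Qb r).
have QV r : zmod_morphism (Q r)^-1%g.
  have e z : Psi r ((Q r)^-1 z)%g = z := symVK (Q r) z.
  move=> x y; apply: (can_inj (symK (Q r))); rewrite symVK.
  by rewrite -[RHS]/(Psi r _) raddfB !e.
pose Psi' r : {additive kM r -> kM r} := HB.pack (sym_fun (Q r)^-1%g)
  (GRing.isZmodMorphism.Build _ _ (sym_fun (Q r)^-1%g) (QV r)).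
have e r z : Psi r (Psi' r z) = z := symVK (Q r) z.
have e' r z : Psi' r (Psi r z) = z := symK (Q r) z.
exists (fun r => Phi r \o Psi' r); split.
- by move=> r; apply: bij_comp => //; apply: sym_bij.
- by rewrite -[LHS]/(Phi _ (Psi' _ _)) -[in LHS]Q1 e'.
- move=> r u x y; rewrite -[LHS]/(Phi _ (Psi' _ _)) -{1}[x]e -{1}[y]e -QM e'.
  exact: PM.
- move=> x; rewrite symM -PE -[LHS]/(Phi _ (Psi' _ _)); congr (Phi _ _).
  by apply: (can_inj (symK t)); rewrite symVK -QE e.
Qed.
HB.instance Definition _ :=
  SubChoice_isSubGroup.Build (Sym (kM 1)) autM_pred autM autM_group_closed.

Lemma autM_additive (phi : autM) : zmod_morphism phi.
Proof.
by have [[Phi [_ _ _ PE]] _] := autMP phi; move=> x y; rewrite -!PE raddfB.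
Qed.

(* The image of (Z/ell)^x in Aut^M_a; see also [scalars_full]. *)
Definition scalars : {pred autM} := fun phi =>
  `[< exists2 m : nat, coprime m ell & forall x : kM 1, phi x = x *+ m >].

Lemma kM_mulrn_mod r n (x : kM r) : x *+ (n %% ell) = x *+ n.
Proof.
by rewrite [in RHS](divn_eq n ell) mulrnDr mulnC mulrnA kM_torsion mul0rn add0r.
Qed.

Lemma coprime_inv_mod m : coprime m ell -> exists2 n, coprime n ell &
  forall r (x : kM r), x *+ (n * m) = x.
Proof.
move=> cm; exists (m ^ (totient ell).-1)%N; first exact: coprimeXl.
move=> r x; case: (posnP ell) => [e0|e_gt0].
  have -> : m = 1%N by move: cm; rewrite /coprime [X in gcdn m X]e0 gcdn0 => /eqP.
  by rewrite exp1n.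
rewrite -expnSr prednK ?totient_gt0 // -kM_mulrn_mod Euler_exp_totient //.
by rewrite kM_mulrn_mod.
Qed.

Lemma kM_mulMn r s m n (x : kM r) (y : kM s) :
  kM_mul (x *+ m) (y *+ n) = kM_mul x y *+ (m * n).
Proof.
have [D1 D2] := @kM_mul_biadditive ell K r s.
pose f z : {additive kM r -> kM (r + s)} := HB.pack ((@kM_mul ell K r s)^~ z)
  (GRing.isZmodMorphism.Build _ _ _ (D1 z)).
pose g z : {additive kM s -> kM (r + s)} := HB.pack (@kM_mul ell K r s z)
  (GRing.isZmodMorphism.Build _ _ _ (D2 z)).
have e1 z : kM_mul (x *+ m) z = kM_mul x z *+ m := raddfMn (f z) m x.
have e2 : kM_mul x (y *+ n) = kM_mul x y *+ n := raddfMn (g x) n y.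
by rewrite e1 e2 -mulrnA mulnC.
Qed.

Lemma scalars_full m : coprime m ell ->
  exists phi : autM, forall x, phi x = x *+ m.
Proof.
move=> cm; pose Phi r : {additive kM r -> kM r} := HB.pack (fun x : kM r => x *+ (m ^ r))
  (GRing.isZmodMorphism.Build (kM r) (kM r) (fun x : kM r => x *+ (m ^ r))
    (mulrnBl (m ^ r))).
have Phib r : bijective (Phi r).
  have [n _ nE] := coprime_inv_mod (coprimeXl r cm).
  by exists (fun x => x *+ n) => x; rewrite /= -mulrnA 1?mulnC ?nE // mulnC nE.
suff phiP : to_sym (Phib 1%N) \in autM_pred by exists (MkAutM phiP).
apply/asboolP; split.
  exists Phi; split=> //= r s x y; by rewrite kM_mulMn expnD.
move=> t _; have [n _ nE] := coprime_inv_mod cm; split=> x xH.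
  exact: rpredMn.
exists (x *+ n); first exact: rpredMn.
by rewrite /= expn1 -mulrnA nE.
Qed.

Lemma scalars_group_closed : group_closed scalars.
Proof.
split=> [|s t /asboolP [m cm sE] /asboolP [n cn tE]]; apply/asboolP.
  by exists 1%N; rewrite ?coprime1n.
have [n' cn' nE] := coprime_inv_mod cn.
exists (n' * m)%N; first by rewrite coprimeMl cn' cm.
move=> x; rewrite mulrnA -sE [LHS]/= ; congr (s _).
apply: (can_inj (symK (val t))); rewrite [LHS]symVK.
by rewrite [RHS]tE -mulrnA nE.
Qed.
Lemma scalars_conj x y : x \in scalars -> (x ^ y)%g \in scalars.
Proof.
move=> /asboolP [m cm xE]; apply/asboolP; exists m => // z.
pose f : {additive kM 1 -> kM 1} := HB.pack (y : kM 1 -> kM 1)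
  (GRing.isZmodMorphism.Build _ _ (y : kM 1 -> kM 1) (autM_additive y)).
apply: (can_inj (symK (val y))); rewrite [LHS]symVK [LHS]xE.
exact/esym/(raddfMn f).
Qed.
Definition scalar_subgroup := NormalSubgroup scalars_group_closed scalars_conj.

Definition autM_mod_scalars := group_quot scalar_subgroup.
HB.instance Definition _ := Group.on autM_mod_scalars.

Section GaloisAction.
Variable s : gal jK.
Let V : gal jK := (s^-1)%g.

Lemma gal_kM_bij r : bijective (@kM_map ell _ _ (gal_fun s) r).
Proof.
exists (@kM_map ell _ _ (gal_fun V) r) => x.
  rewrite -[LHS]/((_ \o _) x) (@kM_map_comp _ _ _ _ _ _ (idfun : {rmorphism K -> K})).
    by rewrite kM_map_id.
  by move=> y; apply: symK.
rewrite -[LHS]/((_ \o _) x) (@kM_map_comp _ _ _ _ _ _ (idfun : {rmorphism K -> K})).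
  by rewrite kM_map_id.
by move=> y; apply: symVK.
Qed.

Lemma gal_is_autM : to_sym (gal_kM_bij 1) \in autM_pred.
Proof.
apply/asboolP; split.
  exists (fun r => @kM_map ell _ _ (gal_fun s) r); split=> //.
  - exact: gal_kM_bij.
  - exact: kM_map_one.
  - exact: kM_map_mul.
move=> t _; have fixH x : x \in line_subgroup t -> @kM_map ell _ _ (gal_fun s) 1 x = x.
  move=> xH; apply/eqP; rewrite -subr_eq0; apply/eqP.
  pose f := @kM_map ell _ _ (gal_fun s) 1 \- idfun.
  apply: (vanish_span (f := f) _ xH) => {xH}x.
  have fixc (u : K0) : @kM_map ell _ _ (gal_fun s) 1 (kM_class ell (jK u)) = kM_class ell (jK u).
    by rewrite kM_map_class; congr kM_class; apply: (gal_fix s).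
  by case=> [->|[c _ ->]]; rewrite /f /= fixc subrr.
by split=> x xH; [rewrite /= fixH | exists x; rewrite //= fixH].
Qed.

Definition gal_autM : autM := MkAutM gal_is_autM.
End GaloisAction.
End AutM.

Section RhoM.
Variables (ell : nat) (k0 K0 k K : fieldType).
Variables (iK : {rmorphism k0 -> K0}) (ik : {rmorphism k0 -> k}).
Variables (jK : {rmorphism K0 -> K}) (jk : {rmorphism k -> K}).
Variables (KP : is_tensor_product iK ik jK jk) (a : seq k0).

(* Gal(k | k0) = Gal(K | K0) -> Aut^M_a -> Aut^M_a / (Z/ell)^x *)
Definition rhoM (s : gal ik) : autM_mod_scalars ell iK jK a :=
  gpi (scalar_subgroup ell iK jK a) (gal_autM ell iK a (gal_ext KP s)).
End RhoM.

(* Main.v *)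
Require Import Defs.
From HB Require Import structures.
From mathcomp Require Import all_boot all_order all_algebra.
From mathcomp Require Import generic_quotient ring_quotient freeg.
From mathcomp Require Import fraction separable polyXY mpoly.
From mathcomp Require Import boolp ring zify.

(* Fix a separating base x_0, ..., x_n of K0, a generic k0-point p of the base,
   and put s = x_0 - p_0, t_j = (x_j - p_j) / s.  For each j there is a chart: K
   embeds in Frac N[X][[s]], where t_j goes to X and N is the field of rational
   functions over k in the other t_i; the primitive element goes to a root
   supplied by Hensel's lemma.  Every e in k gives the place t_j = e, with
   residues in N((s)).

   If {x,y} = 0 in k_2(K), x has order prime to l at a place and y has order 0,
   the tame symbol makes y an l-th power modulo that place.  An element which is
   an l-th power modulo infinitely many of the places t_j = e has the form
   a(t_j) h^l with a in k[X]; if this holds for two charts, it is an l-th power.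
   An automorphism phi of k_1(K) that preserves Steinberg relations A + B = C is
   thus controlled by the places where A vanishes and B does not.

   The subgroups attached to t and to its multiples by constants of k0 meet in
   <{t}>, so phi is a scalar on {t} whenever, in some chart, t is uX + v modulo s
   with u nonzero.  The scalars agree, and after normalisation phi{f} = {f} for f in K0,
   from (T + 1) t_2 + T f = T (t_2 + f) + t_2 with T = t_1 - e.  The same methods
   give phi{t_1 - c} = {t_1 - sigma c}; the relations
   (t_1 - c) + (t_2 - d) = t_1 + t_2 - (c + d) and
   (t_1 - c) t_2 + c (t_2 - d) = t_1 t_2 - c d make sigma an automorphism of k
   over k0.  Composing with its inverse, phi fixes all {t_j - c}, and then every
   {f_0 + c_1 f_1 + ... + c_r f_r} with f_i in K0, by induction on r: adding
   (c_1 / e) (t_j - e) f_1, for e in c_1 k0, removes a term. *)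

Set Implicit Arguments.
Unset Strict Implicit.
Unset Printing Implicit Defensive.
Import Order.TTheory GRing.Theory Num.Theory.
Local Open Scope ring_scope.

(** * Formal power series *)

(** Dividing by [s] blows up the point p. A series in the x_i - p_i becomes a series in s whose
    coefficients are polynomials in the t_i, so X = e is specialised coefficient by coefficient. A
    polynomial in the x_i and the primitive element restricts to a constant on s = 0, which makes
    comparisons along s = 0 explicit. The obstacle is to pass from the fibres X = e to K: the l-th
    roots in the residue fields N((s)) come from unrelated elements of K. Degrees settle this. After
    normalisation the element has one l-th root z in N[X][[s]]; a generic combination of z with the
    primitive element y has at most the degree of y on each fibre, hence also globally, and this
    forces z into K. One chart leaves a factor a(t_1) undetermined. A second chart removes it
    because, along s = 0 in the first chart, a function of t_2 lies in N and has no zeros in X.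
    Constants of k are l-th powers, so the class {a(t)} amounts to the multiplicities modulo l of
    the roots of a. Every statement on phi is obtained by restricting a relation to a place and to s
    = 0, and then comparing multiplicities in the variable tau, the trace of the other parameter. *)

Record fps (R : Type) := Fps { fcoef : nat -> R }.
HB.instance Definition _ (R : Type) := gen_eqMixin (fps R).
HB.instance Definition _ (R : Type) := gen_choiceMixin (fps R).

Notation "a `[ n ]" := (fcoef a n) (at level 2, format "a `[ n ]").

Lemma fpsP (R : Type) (a b : fps R) : fcoef a =1 fcoef b -> a = b.
Proof. by case: a b => [a] [b] /= /funext ->. Qed.

Section FpsZmod.
Variable R : zmodType.
Implicit Types a b d : fps R.

Definition fps_zero : fps R := Fps (fun=> 0).
Definition fps_opp a : fps R := Fps (fun n => - a`[n]).
Definition fps_add a b : fps R := Fps (fun n => a`[n] + b`[n]).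

Fact fps_addA : associative fps_add.
Proof. by move=> a b c; apply: fpsP => n; rewrite /= addrA. Qed.
Fact fps_addC : commutative fps_add.
Proof. by move=> a b; apply: fpsP => n; rewrite /= addrC. Qed.
Fact fps_add0 : left_id fps_zero fps_add.
Proof. by move=> a; apply: fpsP => n; rewrite /= add0r. Qed.
Fact fps_addN : left_inverse fps_zero fps_opp fps_add.
Proof. by move=> a; apply: fpsP => n; rewrite /= addNr. Qed.
HB.instance Definition _ := GRing.isZmodule.Build (fps R)
  fps_addA fps_addC fps_add0 fps_addN.

Lemma fcoef0 n : (0 : fps R)`[n] = 0. Proof. by []. Qed.
Lemma fcoefD a b n : (a + b)`[n] = a`[n] + b`[n]. Proof. by []. Qed.
Lemma fcoefB a b n : (a - b)`[n] = a`[n] - b`[n]. Proof. by []. Qed.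
Lemma fcoef_sum (I : Type) (r : seq I) (P : pred I) (F : I -> fps R) n :
  (\sum_(i <- r | P i) F i)`[n] = \sum_(i <- r | P i) (F i)`[n].
Proof. by elim/big_rec2: _ => //= i x y _ ->. Qed.
End FpsZmod.

Section FpsRing.
Variable R : comNzRingType.
Implicit Types a b d : fps R.

Definition trunc n a : {poly R} := \poly_(i < n) a`[i].
Definition fps_one : fps R := Fps (fun n => (n == 0%N)%:R).
Definition fps_mul a b : fps R :=
  Fps (fun n => \sum_(i < n.+1) a`[i] * b`[n - i]).

(* Associativity and commutativity are inherited from polynomials through this
   lemma. *)
Lemma fps_mul_poly a b (p q : {poly R}) n :
  (forall i, (i <= n)%N -> a`[i] = p`_i) -> (forall i, (i <= n)%N -> b`[i] = q`_i) ->
  (fps_mul a b)`[n] = (p * q)`_n.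
Proof.
move=> ap bq; rewrite coefM; apply: eq_bigr => i _.
by rewrite ap -1?ltnS // bq // leq_subr.
Qed.

Lemma coef_trunc n a i : (trunc n a)`_i = if (i < n)%N then a`[i] else 0.
Proof. exact: coef_poly. Qed.

Fact fps_mulC : commutative fps_mul.
Proof.
move=> a b; apply: fpsP => n.
have tE c i : (i <= n)%N -> c`[i] = (trunc n.+1 c)`_i.
  by move=> le_in; rewrite coef_trunc ltnS le_in.
by rewrite !(fps_mul_poly (tE _) (tE _)) mulrC.
Qed.

Fact fps_mulA : associative fps_mul.
Proof.
move=> a b c; apply: fpsP => n.
have tE d m i : (m <= n)%N -> (i <= m)%N -> d`[i] = (trunc n.+1 d)`_i.
  by move=> mn im; rewrite coef_trunc ltnS (leq_trans im).
have tM d e i : (i <= n)%N -> (fps_mul d e)`[i] = (trunc n.+1 d * trunc n.+1 e)`_i.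
  by move=> le_in; apply: fps_mul_poly => j; apply: tE.
rewrite (fps_mul_poly (tE a n ^~ (leqnn n)) (tM b c)).
by rewrite (fps_mul_poly (tM a b) (tE c n ^~ (leqnn n))) mulrA.
Qed.

Fact fps_mul1 : left_id fps_one fps_mul.
Proof.
move=> a; apply: fpsP => n; rewrite /= big_ord_recl subn0 mul1r big1 ?addr0 // => i _.
by rewrite mul0r.
Qed.

Fact fps_mulDl : left_distributive fps_mul +%R.
Proof.
move=> a b c; apply: fpsP => n; rewrite fcoefD /= -big_split /=.
by apply: eq_bigr => i _; rewrite mulrDl.
Qed.

Fact fps_one_neq0 : fps_one != 0.
Proof. by apply/eqP => /(congr1 (fun a => a`[0%N])) /eqP; rewrite /= oner_eq0. Qed.

HB.instance Definition _ := GRing.Zmodule_isComNzRing.Build (fps R)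
  fps_mulA fps_mulC fps_mul1 fps_mulDl fps_one_neq0.

Lemma fcoefM a b n : (a * b)`[n] = \sum_(i < n.+1) a`[i] * b`[n - i].
Proof. by []. Qed.

Definition fconst (x : R) : fps R := Fps (fun n => if n is 0 then x else 0).
Lemma fcoefC x n : (fconst x)`[n] = if n is 0 then x else 0. Proof. by []. Qed.

Lemma fcoefCM x a n : (fconst x * a)`[n] = x * a`[n].
Proof.
by rewrite fcoefM big_ord_recl subn0 big1 ?addr0 // => i _; rewrite mul0r.
Qed.

Fact fconst_is_zmod : zmod_morphism fconst.
Proof. by move=> x y; apply: fpsP => -[|n] //=; rewrite subr0. Qed.
HB.instance Definition _ := GRing.isZmodMorphism.Build R (fps R) fconst fconst_is_zmod.
Fact fconst_is_monoid : monoid_morphism fconst.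
Proof.
split=> [|x y]; apply: fpsP => -[|n] //.
  by rewrite fcoefCM.
by rewrite fcoefCM /= mulr0.
Qed.
HB.instance Definition _ := GRing.isMonoidMorphism.Build R (fps R) fconst fconst_is_monoid.

Definition fX : fps R := Fps (fun n => (n == 1)%:R).

Lemma fcoefM0 a b : (a * b)`[0] = a`[0] * b`[0].
Proof. by rewrite fcoefM big_ord1. Qed.

Lemma fcoefXM a n : (fX * a)`[n] = if n is m.+1 then a`[m] else 0.
Proof.
rewrite fcoefM; case: n => [|n]; first by rewrite big_ord1 mul0r.
rewrite big_ord_recl mul0r add0r big_ord_recl mul1r big1 ?addr0 ?subSS ?subn0 //.
by move=> i _; rewrite mul0r.
Qed.

Lemma fcoefXnM m a n : (fX ^+ m * a)`[n] = if (n < m)%N then 0 else a`[n - m].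
Proof.
elim: m n => [|m IHm] n; first by rewrite mul1r subn0.
by rewrite exprS -mulrA fcoefXM; case: n => [|n] //; rewrite IHm ltnS subSS.
Qed.

Definition fcoef_0 a := a`[0%N].
Fact fcoef_0_is_zmod : zmod_morphism fcoef_0. Proof. by []. Qed.
HB.instance Definition _ := GRing.isZmodMorphism.Build (fps R) R fcoef_0 fcoef_0_is_zmod.
Fact fcoef_0_is_monoid : monoid_morphism fcoef_0.
Proof. by split=> // a b; rewrite /fcoef_0 fcoefM big_ord1. Qed.
HB.instance Definition _ := GRing.isMonoidMorphism.Build (fps R) R fcoef_0 fcoef_0_is_monoid.

Definition fdiv n a : fps R := Fps (fun m => a`[m + n]).

Lemma fdivK n a : (forall i, (i < n)%N -> a`[i] = 0) -> a = fX ^+ n * fdiv n a.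
Proof.
move=> a0; apply: fpsP => i; rewrite fcoefXnM; case: ltnP => [/a0 //|le_ni].
by rewrite /= subnK.
Qed.

Lemma fps_order a : a != 0 ->
  exists n b, a = fX ^+ n * b /\ b`[0%N] != 0.
Proof.
move=> a_neq0; have /ex_minnP[n an n_min]: exists n, a`[n] != 0.
  apply: contrapT => a0; case/eqP: a_neq0; apply: fpsP => n.
  by apply/eqP/negP => /negP an; apply: a0; exists n.
exists n, (fdiv n a); split=> //; apply: fdivK => i lt_in.
by apply/eqP/negP => /negP /n_min; rewrite leqNgt lt_in.
Qed.

Definition fps_of_poly (p : {poly R}) : fps R := Fps (fun n => p`_n).
Fact fps_of_poly_is_zmod : zmod_morphism fps_of_poly.
Proof. by move=> p q; apply: fpsP => n; rewrite /= coefB. Qed.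
HB.instance Definition _ := GRing.isZmodMorphism.Build _ _ fps_of_poly fps_of_poly_is_zmod.
Fact fps_of_poly_is_monoid : monoid_morphism fps_of_poly.
Proof.
split=> [|p q]; apply: fpsP => n; first by rewrite /= coef1.
by rewrite /= coefM.
Qed.
HB.instance Definition _ := GRing.isMonoidMorphism.Build _ _ fps_of_poly fps_of_poly_is_monoid.

Lemma fps_of_polyX : fps_of_poly 'X = fX.
Proof. by apply: fpsP => n; rewrite /= coefX. Qed.
Lemma fps_of_polyC x : fps_of_poly x%:P = fconst x.
Proof. by apply: fpsP => n; rewrite /= coefC; case: n. Qed.
Lemma fps_of_poly_inj : injective fps_of_poly.
Proof. by move=> p q pq; apply/polyP => n; have /(congr1 (fun a => a`[n])) := pq. Qed.

Definition rescale_fps (c : R) a : fps R := Fps (fun n => a`[n] * c ^+ n).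
Fact rescale_fps_is_zmod c : zmod_morphism (rescale_fps c).
Proof. by move=> a b; apply: fpsP => n; rewrite /= mulrBl. Qed.
HB.instance Definition _ c := GRing.isZmodMorphism.Build _ _ (rescale_fps c)
  (rescale_fps_is_zmod c).
Fact rescale_fps_is_monoid c : monoid_morphism (rescale_fps c).
Proof.
split=> [|a b]; apply: fpsP => n /=; first by case: n => [|n] /=; rewrite ?mul1r ?mul0r.
rewrite mulr_suml; apply: eq_bigr => i _.
by rewrite mulrACA -exprD subnKC // -ltnS.
Qed.
HB.instance Definition _ c := GRing.isMonoidMorphism.Build _ _ (rescale_fps c)
  (rescale_fps_is_monoid c).
End FpsRing.

Section FpsMap.
Variables (R S : comNzRingType) (f : {rmorphism R -> S}).
Definition map_fps (a : fps R) : fps S := Fps (fun n => f a`[n]).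
Fact map_fps_is_zmod : zmod_morphism map_fps.
Proof. by move=> a b; apply: fpsP => n; rewrite /= rmorphB. Qed.
HB.instance Definition _ := GRing.isZmodMorphism.Build _ _ map_fps map_fps_is_zmod.
Fact map_fps_is_monoid : monoid_morphism map_fps.
Proof.
split=> [|a b]; apply: fpsP => n; first by rewrite /= rmorph_nat.
by rewrite /= rmorph_sum; apply: eq_bigr => i _; rewrite rmorphM.
Qed.
HB.instance Definition _ := GRing.isMonoidMorphism.Build _ _ map_fps map_fps_is_monoid.
Lemma map_fpsX : map_fps (fX R) = fX S.
Proof. by apply: fpsP => n; rewrite /= rmorph_nat. Qed.
Lemma map_fpsC c : map_fps (fconst c) = fconst (f c).
Proof. by apply: fpsP => -[|n] //=; rewrite rmorph0. Qed.
End FpsMap.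

Section FpsDomain.
Variable R : idomainType.
Implicit Types a b d : fps R.

Definition fps_unit : {pred fps R} := fun a => `[< exists b, b * a = 1 >].
Definition fps_inv a : fps R :=
  if pselect (exists b, b * a = 1) is left h then sval (cid h) else a.

Fact fps_mulVr : {in fps_unit, left_inverse 1 fps_inv *%R}.
Proof.
move=> a /asboolP au; rewrite /fps_inv; case: pselect => // h.
exact: svalP (cid h).
Qed.
Fact fps_unitP a b : b * a = 1 -> fps_unit a.
Proof. by move=> ba; apply/asboolP; exists b. Qed.
Fact fps_inv_out : {in [predC fps_unit], fps_inv =1 id}.
Proof.
move=> a; rewrite inE => /negP au; rewrite /fps_inv; case: pselect => // h.
by case: au; apply/asboolP.
Qed.
HB.instance Definition _ := GRing.ComNzRing_hasMulInverse.Build (fps R)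
  fps_mulVr fps_unitP fps_inv_out.

Fact fps_idomain a b : a * b = 0 -> (a == 0) || (b == 0).
Proof.
apply: contra_eqT; rewrite negb_or => /andP[/fps_order[m [c [-> c0]]]].
move=> /fps_order[n [d [-> d0]]]; apply/eqP => /(congr1 (fun e => e`[(m + n)%N])).
rewrite mulrACA -exprD fcoefXnM ltnn subnn.
by rewrite -[LHS]/(fcoef_0 (c * d)) rmorphM => /eqP; rewrite mulf_eq0 (negPf c0) (negPf d0).
Qed.
HB.instance Definition _ := GRing.ComUnitRing_isIntegral.Build (fps R) fps_idomain.

Lemma fX_neq0 : fX R != 0.
Proof. by apply/eqP => /(congr1 (fun a => a`[1%N])) /eqP; rewrite /= oner_eq0. Qed.
Lemma fXn_neq0 n : fX R ^+ n != 0. Proof. by rewrite expf_neq0 ?fX_neq0. Qed.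

Lemma rescale_fps_inj (c : R) : c != 0 -> injective (rescale_fps c).
Proof.
move=> c0 a b ab; apply: fpsP => n; have /(congr1 (fun a => a`[n])) := ab.
by apply: mulIf; rewrite expf_neq0.
Qed.
End FpsDomain.

Section Hensel.
Variable R : comUnitRingType.
Implicit Types a b : fps R.

Lemma horner_eqX (P : {poly fps R}) n a b :
  (forall i, (i < n)%N -> a`[i] = b`[i]) ->
  forall i, (i < n)%N -> (P.[a])`[i] = (P.[b])`[i].
Proof.
move=> ab; elim/poly_ind: P => [|P c IHP] i lt_in; first by rewrite !horner0.
rewrite !hornerMXaddC !fcoefD; congr (_ + _); rewrite !fcoefM; apply: eq_bigr => j _.
by rewrite IHP ?ab // (leq_ltn_trans _ lt_in) ?leq_subr // -ltnS.
Qed.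

Lemma horner_taylor (P : {poly fps R}) (a h : fps R) :
  exists e : fps R, P.[a + h] = P.[a] + P^`().[a] * h + e * (h * h).
Proof.
elim/poly_ind: P => [|P c [d IHP]].
  by exists 0; rewrite derivC !horner0 !mul0r !addr0.
exists (d * (a + h) + P^`().[a]).
rewrite derivMXaddC !hornerMXaddC hornerD hornerMX IHP.
set x := P.[a]; set y := P^`().[a].
by ring.
Qed.

(* Newton's iteration, with the derivative frozen at y0. *)
Lemma hensel (P : {poly fps R}) (y0 : R) :
  (P.[fconst y0])`[0%N] = 0 -> (P^`().[fconst y0])`[0%N] \is a GRing.unit ->
  exists2 y : fps R, y`[0%N] = y0 & P.[y] = 0.
Proof.
move=> Py0 dPu; set u := (P^`().[fconst y0])`[0%N] in dPu.
pose inv (n : nat) (y : fps R) := y`[0%N] = y0 /\ forall i, (i <= n)%N -> (P.[y])`[i] = 0.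
have step n y : inv n y ->
    exists z, inv n.+1 z /\ forall i, (i <= n)%N -> z`[i] = y`[i].
  move=> [yE Py].
  have [e eE] := horner_taylor P y (fX R ^+ n.+1 * fconst (- (P.[y])`[n.+1] / u)).
  exists (y + fX R ^+ n.+1 * fconst (- (P.[y])`[n.+1] / u)); split; last first.
    by move=> i le_in; rewrite fcoefD fcoefXnM ltnS le_in addr0.
  split=> [|i le_i]; first by rewrite fcoefD fcoefXnM addr0.
  rewrite eE !fcoefD; set x := fconst _.
  (* The quadratic Taylor term has order at least 2n+2 in the variable, so it does not touch the
     coefficients up to n+1. *)
  have -> : (e * (fX R ^+ n.+1 * x * (fX R ^+ n.+1 * x)))`[i] = 0.
    rewrite mulrACA -exprD [e * _]mulrCA fcoefXnM ifT //.
    by rewrite (leq_ltn_trans le_i) // addSn ltnS leq_addl.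
  rewrite addr0 mulrCA fcoefXnM.
  move: le_i; rewrite leq_eqVlt => /orP[/eqP->|lt_i]; last by rewrite lt_i Py ?addr0.
  rewrite ltnn subnn fcoefM0 /x fcoefC.
  have -> : (P^`().[y])`[0%N] = u.
    by apply: (@horner_eqX _ 1) => // -[] // _; rewrite yE.
  by rewrite mulrCA divrr // mulr1 subrr.
have inv0 : inv 0%N (fconst y0) by split=> // -[].
(* The approximations carry their invariant along, because [step] needs it to produce the next
   one. *)
pose ys := fix ys n : {y | inv n y} := if n is m.+1 then
  let z := cid (step m _ (svalP (ys m))) in exist _ (sval z) (svalP z).1
  else exist _ _ inv0.
have ysS n i : (i <= n)%N -> (sval (ys n.+1))`[i] = (sval (ys n))`[i].
  by move=> le_in /=; case: (cid _) => z [/= _ ->].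
have ysE m n i : (i <= n)%N -> (n <= m)%N -> (sval (ys m))`[i] = (sval (ys n))`[i].
  move=> le_in; elim: m => [|m IHm]; first by rewrite leqn0 => /eqP->.
  rewrite leq_eqVlt => /orP[/eqP-> //|]; rewrite ltnS => le_nm.
  by rewrite ysS ?IHm // (leq_trans le_in).
(* Diagonal limit: coefficient n no longer changes after the n-th approximation. *)
exists (Fps (fun n => (sval (ys n))`[n])); first by case: (svalP (ys 0%N)).
apply: fpsP => n; rewrite fcoef0.
rewrite -(proj2 (svalP (ys n)) n (leqnn n)).
apply: (@horner_eqX _ n.+1) => // i; rewrite ltnS => le_in /=.
by rewrite (@ysE n i i).
Qed.
End Hensel.

Section Root.
Variable R : idomainType.

Lemma fps_inv1 (a : fps R) : a`[0%N] = 1 -> exists2 b : fps R, b`[0%N] = 1 & a * b = 1.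
Proof.
move=> a0; have [||b b0 Pb] := @hensel R (a *: 'X - 1) 1.
- by rewrite !hornerE rmorph1 mulr1 fcoefB a0 subrr.
- by rewrite derivB derivZ derivX derivC subr0 !hornerE a0 unitr1.
by exists b => //; apply/eqP; move/eqP: Pb; rewrite !hornerE subr_eq0.
Qed.

Lemma fps_root1 (n : nat) (a : fps R) : (n%:R : R) \is a GRing.unit -> a`[0%N] = 1 ->
  exists2 b : fps R, b`[0%N] = 1 & b ^+ n = a.
Proof.
move=> nu a0; have [||b b0 Pb] := @hensel R ('X^n - a%:P) 1.
- by rewrite !hornerE rmorph1 expr1n fcoefB a0 subrr.
- rewrite derivB derivXn derivC subr0 hornerMn hornerXn rmorph1 expr1n.
  by rewrite -[1 *+ n]/(n%:R) -(rmorph_nat (@fconst R)).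
by exists b => //; apply/eqP; move/eqP: Pb; rewrite !hornerE subr_eq0.
Qed.
End Root.

(** * Algebraic power series *)

Definition infinite_set (T : eqType) (E : T -> Prop) :=
  forall s : seq T, exists2 e, E e & e \notin s.

Lemma infinite_set_sub (T : eqType) (E E' : T -> Prop) :
  (forall e, E e -> E' e) -> infinite_set E -> infinite_set E'.
Proof. by move=> sEE' Ei s; have [e /sEE' ? ?] := Ei s; exists e. Qed.

Lemma infinite_set_avoid (T : eqType) (E : T -> Prop) (s : seq T) :
  infinite_set E -> infinite_set (fun e => E e /\ e \notin s).
Proof.
move=> Ei s'; have [e Ee] := Ei (s ++ s').
by rewrite mem_cat negb_or => /andP[es es']; exists e.
Qed.

Lemma finite_roots (R : idomainType) (p : {poly R}) : p != 0 ->
  exists s : seq R, forall x, root p x -> x \in s.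
Proof.
have [n] := ubnP (size p); elim: n p => // n IHn p; rewrite ltnS => le_pn p0.
have [[x px]|no_root] := pselect (exists x, root p x); last first.
  by exists [::] => x px; case: no_root; exists x.
have /factor_theorem[q qE] := px.
have q0 : q != 0 by apply: contraNneq p0 => q0; rewrite qE q0 mul0r.
have [|//|s sP] := IHn q.
  by rewrite (leq_trans _ le_pn) // qE size_Mmonic ?monicXsubC // size_XsubC addn2.
exists (x :: s) => y; rewrite qE rootM root_XsubC in_cons orbC.
by case/orP=> [->|/sP->] //; rewrite orbT.
Qed.

Lemma infinite_set_image (T U : eqType) (f : T -> U) (E : T -> Prop) : injective f ->
  infinite_set E -> infinite_set (fun x => exists2 e, E e & x = f e).
Proof.
move=> f_inj Ei s; have [t tP] : exists t : seq T, forall e, f e \in s -> e \in t.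
  elim: s => [|x s [t tP]]; first by exists [::].
  have [[e0 e0x]|nex] := pselect (exists e, f e = x); last first.
    by exists t => e; rewrite inE => /orP[/eqP ex|/tP //]; case: nex; exists e.
  exists (e0 :: t) => e; rewrite !inE => /orP[/eqP|/tP->]; last exact: orbT.
  by rewrite -e0x => /f_inj->; rewrite eqxx.
have [e Ee et] := Ei t; exists (f e); first by exists e.
by apply: contraNN et; apply: tP.
Qed.

Lemma infinite_set_nonroot (k R : idomainType) (f : {rmorphism k -> R}) (p : {poly R})
    (E : k -> Prop) : injective f -> p != 0 ->
  infinite_set E -> infinite_set (fun e => E e /\ p.[f e] != 0).
Proof.
move=> f_inj p0 Ei s'; have [s sP] := finite_roots p0.
have [_ [e Ee ->]] := infinite_set_image f_inj Ei (s ++ map f s').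
rewrite mem_cat negb_or (mem_map f_inj) => /andP[es es']; exists e => //; split=> //.
by apply: contraNN es => /sP.
Qed.

(* An N[X]-independent family of vectors of polynomials remains independent
   after specialising X at almost every point of N. *)
Section Specialisation.
Variable N : fieldType.
Implicit Types (I : finType).

Definition independent_on (R : comNzRingType) I (A : {set I}) (g : I -> nat -> R) :=
  forall a : I -> R, (forall c, \sum_(i in A) a i * g i c = 0) ->
  forall i, i \in A -> a i = 0.

(** Elimination without division: a nonzero entry [g i0 c0] serves as pivot, and [g'] is what
    remains of the other vectors after clearing column [c0]. The polynomial d is the product of the
    pivots, so off its roots the same elimination runs over N. *)
Lemma independent_spec I (A : {set I}) (g : I -> nat -> {poly N}) :
  independent_on A g ->
  exists2 d : {poly N}, d != 0 &
    forall e, d.[e] != 0 -> independent_on A (fun i c => (g i c).[e]).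
Proof.
have [m] := ubnP #|A|; elim: m A g => // m IHm A g; rewrite ltnS => le_Am gi.
have [->|[i0 Ai0]] := set_0Vmem A.
  by exists 1; rewrite ?oner_neq0 // => e _ a _ i; rewrite inE.
have [c0 gc0] : exists c, g i0 c != 0.
  apply: contrapT => g0; suff : (1 : {poly N}) = 0 by apply/eqP; rewrite oner_eq0.
  pose a i := if i == i0 then 1 : {poly N} else 0.
  have -> : 1 = a i0 by rewrite /a eqxx.
  apply: (gi a _ _ Ai0) => c; rewrite (big_setD1 i0) //= big1 ?addr0.
    by rewrite /a eqxx mul1r; apply/eqP/negP => /negP gc; apply: g0; exists c.
  by move=> i; rewrite !inE /a => /andP[/negPf-> _]; rewrite mul0r.
pose d0 := g i0 c0; pose g' i c : {poly N} := d0 * g i c - g i c0 * g i0 c.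
have [||d d_neq0 dP] := IHm (A :\ i0) g'.
- by rewrite (cardsD1 i0 A) Ai0 in le_Am.
- move=> a aE i iA; pose b i := if i == i0 then - \sum_(j in A :\ i0) a j * g j c0
    else a i * d0.
  have /eqP : b i = 0.
    apply: gi; last by move: iA; rewrite inE => /andP[].
    move=> c; rewrite (big_setD1 i0) //= {1}/b eqxx -[RHS](aE c) mulNr mulr_suml.
    rewrite addrC -sumrB; apply: eq_bigr => j; rewrite !inE /b /g' => /andP[/negPf-> _].
    by rewrite /d0; move: (a j) (g i0 c0) (g j c) (g j c0) (g i0 c) => *; ring.
  move: iA; rewrite /b !inE => /andP[/negPf-> _].
  by rewrite mulf_eq0 (negPf gc0) orbF => /eqP.
exists (d0 * d) => [|e]; first by rewrite mulf_neq0.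
rewrite hornerM mulf_eq0 negb_or => /andP[d0e de] a aE.
have a0 i : i \in A :\ i0 -> a i = 0.
  have ec c : \sum_(j in A :\ i0) a j * (g j c).[e] = - (a i0 * (g i0 c).[e]).
    by have := aE c; rewrite (big_setD1 i0) //= => /eqP; rewrite addrC addr_eq0 => /eqP.
  apply: (dP e de) => c.
  transitivity (\sum_(j in A :\ i0) (d0.[e] * (a j * (g j c).[e]) -
                                     (g i0 c).[e] * (a j * (g j c0).[e]))).
    apply: eq_bigr => j _; rewrite /g' hornerD hornerN !hornerM.
    by move: d0.[e] (g j c).[e] (g j c0).[e] (g i0 c).[e] (a j) => *; ring.
  rewrite sumrB -!mulr_sumr !ec /d0.
  by move: (g i0 c0).[e] (g i0 c).[e] (a i0) => *; ring.
move=> i iA; have [->|ne] := eqVneq i i0; last by apply: a0; rewrite !inE ne.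
move/eqP: (aE c0); rewrite (big_setD1 i0) //= big1 ?addr0 => [|j /a0 ->]; last exact: mul0r.
by rewrite mulf_eq0 (negPf d0e) orbF => /eqP.
Qed.
End Specialisation.

(* Gauss's lemma, in the form of a bound on the coefficients of an annihilator
   of small degree. *)
Section Gauss.
Variables (N : fieldType) (L : idomainType) (ev : {rmorphism {poly {poly N}} -> L}).
Hypothesis evC : forall c, ev c%:P = 0 -> c = 0.
Implicit Types (u v R S P : {poly {poly N}}) (c q : {poly N}).

Lemma irreducible_divisor c : (1 < size c)%N ->
  exists2 q, irreducible_poly q & q %| c.
Proof.
have [n] := ubnP (size c); elim: n c => // n IHn c; rewrite ltnS => le_cn c1.
have [c_irr|] := pselect (irreducible_poly c); first by exists c; rewrite ?dvdpp.
move=> c_red; have [q [q1 qc nqc]] : exists q, [/\ size q != 1, q %| c & ~~ (q %= c)].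
  apply: contrapT => nq; apply: c_red; split=> // q q1 qc.
  by apply/negPn/negP => nqc; apply: nq; exists q.
have c0 : c != 0 by rewrite -size_poly_gt0 ltnW.
have q0 : q != 0 by apply: contraNneq c0 => q0; rewrite q0 dvd0p in qc.
have [||r r_irr rq] := IHn q; last by exists r; rewrite ?(dvdp_trans rq).
- rewrite (leq_trans _ le_cn) // ltn_neqAle dvdp_leq // andbT.
  by rewrite dvdp_size_eqp.
- by rewrite ltn_neqAle eq_sym q1 size_poly_gt0.
Qed.

Lemma irreducible_prime q a b : irreducible_poly q -> q %| a * b -> (q %| a) || (q %| b).
Proof.
move=> [q1 q_irr] qab; have := dvdp_gcdl q a; set g := gcdp q a => gq.
have [g1|gn1] := eqVneq (size g) 1; last first.
  by rewrite -(eqp_dvdl _ (q_irr g gn1 gq)) dvdp_gcdr.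
by rewrite -(Gauss_dvdpr b (_ : coprimep q a)) ?qab ?orbT // /coprimep g1.
Qed.

(** Gauss's lemma: in the product of the first coefficients of u and v that q does not divide, all
    other contributions to the same coefficient of u * v are divisible by q. *)
Lemma irreducible_coefs q u v : irreducible_poly q ->
  (forall i, q %| (u * v)`_i) -> (forall i, q %| u`_i) \/ (forall i, q %| v`_i).
Proof.
move=> q_irr quv; apply: contrapT => /not_orP[nu nv].
have /ex_minnP[i ui i_min] : exists i, ~~ (q %| u`_i) by apply: contrapT => h; apply: nu => i; apply/negPn/negP => ui; apply: h; exists i.
have /ex_minnP[j vj j_min] : exists j, ~~ (q %| v`_j) by apply: contrapT => h; apply: nv => j; apply/negPn/negP => vj; apply: h; exists j.
have /negP[] : ~~ (q %| u`_i * v`_j).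
  by apply/negP => /(irreducible_prime q_irr); rewrite (negPf ui) (negPf vj).
have lt_i : (i < (i + j).+1)%N by rewrite ltnS leq_addr.
have := quv (i + j)%N; rewrite coefM (bigD1 (Ordinal lt_i)) //= addKn dvdp_addl //.
apply: (big_ind (fun x => q %| x)) => [|x y|k nk]; rewrite ?dvdp0 //; first exact: dvdp_add.
have {}nk : k != i :> nat by [].
case: (ltngtP k i) => [lt_ki|lt_ik|/eqP]; last by rewrite (negPf nk).
  by apply: dvdp_mulr; apply/negPn/negP => /i_min; rewrite leqNgt lt_ki.
apply: dvdp_mull; apply/negPn/negP => /j_min; apply/negP; rewrite -ltnNge.
by rewrite ltn_subLR ?ltn_add2r // -ltnS.
Qed.

Lemma divp_coefs q u : q != 0 -> (forall i, q %| u`_i) -> exists u', u = q *: u'.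
Proof.
move=> q0 qu; exists (\poly_(i < size u) (u`_i %/ q)); apply/polyP => i.
rewrite coefZ coef_poly; case: ltnP => [_|le_i]; first by rewrite mulrC divpK.
by rewrite mulr0 nth_default.
Qed.

Lemma sizeY_mul u v : u != 0 -> v != 0 -> (sizeY u <= sizeY (u * v))%N.
Proof.
move=> u0 v0; rewrite !sizeYE rmorphM /= size_mul ?swapXY_eq0 //.
by rewrite -ltnS prednK ?addn_gt0 ?size_poly_gt0 ?swapXY_eq0 ?u0 // -[X in (X < _)%N]addn0 ltn_add2l size_poly_gt0 swapXY_eq0.
Qed.

(** An annihilator of least degree divides P up to a factor c from {poly N}. Take such a
    factorisation [c *: P = R' * S] with c of least degree: an irreducible factor of c would divide
    R' or S and could be cancelled, so c is constant. Then R' divides P, and its inner degree is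
    bounded by that of P. *)
Lemma bounded_annihilator P R n : P != 0 -> ev P = 0 ->
  R != 0 -> ev R = 0 -> (size R <= n)%N ->
  exists R', [/\ R' != 0, ev R' = 0, (size R' <= n)%N & (sizeY R' <= sizeY P)%N].
Proof.
move=> P0 evP R0 evR Rn.
pose ann m := `[< exists R', [/\ R' != 0, ev R' = 0 & size R' = m] >].
have /ex_minnP[m /asboolP[R1 [R10 evR1 R1m]] m_min] : exists m, ann m.
  by exists (size R); apply/asboolP; exists R.
have R1n : (size R1 <= n)%N.
  by rewrite R1m (leq_trans _ Rn) // m_min //; apply/asboolP; exists R.
pose T l := `[< exists c R' S, [/\ c != 0, c *: P = R' * S, ev R' = 0, (size R' <= n)%N & size c = l] >].
have /ex_minnP[l /asboolP[c [R' [S [c0 cE evR' R'n cl]]]] l_min] : exists l, T l.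
  exists (size (lead_coef R1 ^+ scalp P R1)%R); apply/asboolP.
  exists (lead_coef R1 ^+ scalp P R1), R1, (P %/ R1); split=> //.
    by rewrite expf_neq0 // lead_coef_eq0.
  have dE := Pdiv.Idomain.divp_eq P R1.
  rewrite dE (_ : P %% R1 = 0) ?addr0 1?mulrC //; apply: contrapT => /eqP r0.
  have := ltn_modp P R1; rewrite R10 => lt_r.
  have := m_min (size (P %% R1)%R); rewrite -R1m leqNgt lt_r => /(_ _)/negP[]//.
  apply/asboolP; exists (P %% R1); split=> //.
  have := congr1 ev dE; rewrite rmorphD rmorphM evR1 mulr0 add0r => <-.
  by rewrite -mul_polyC rmorphM evP mulr0.
have cP0 : c *: P != 0 by rewrite -mul_polyC mulf_neq0 ?polyC_eq0.
have [R'0 S0] : R' != 0 /\ S != 0.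
  by split; apply: contraNneq cP0 => z; rewrite cE z ?mul0r ?mulr0.
exists R'; split=> //.
have [c1|] := leqP (size c) 1.
  rewrite (leq_trans (sizeY_mul R'0 S0)) // -cE; apply/bigmax_leqP => -[i lt_i] _ /=; clear lt_i.
  have [d cd] : exists d, c = d%:P by exists c`_0; rewrite -size1_polyC.
  rewrite coefZ cd mul_polyC (leq_trans (size_scale_leq _ _)) //.
  exact: max_size_coefXY.
move=> /irreducible_divisor[q q_irr qc]; exfalso.
have q0 : q != 0 by have [] := q_irr; case: eqP => // ->; rewrite size_poly0.
have cq : (size (c %/ q)%R < l)%N.
  rewrite -cl size_divp // ltn_subrL size_poly_gt0 c0 andbT.
  by have [q1 _] := q_irr; rewrite -ltnS prednK // ltnW.
have smaller R2 S2 : (c %/ q) *: P = R2 * S2 -> ev R2 = 0 -> (size R2 <= n)%N -> False.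
  move=> E evR2 R2n; have := l_min (size (c %/ q)%R); rewrite leqNgt cq => /(_ _)/negP[]//.
  by apply/asboolP; exists (c %/ q), R2, S2; split=> //; rewrite dvdp_div_eq0.
have cE' : q *: ((c %/ q) *: P) = R' * S by rewrite scalerA mulrC divpK.
have qinj : injective (fun u => q *: u).
  move=> u v /eqP; rewrite -subr_eq0 -scalerBr -mul_polyC mulf_eq0 polyC_eq0.
  by rewrite (negPf q0) subr_eq0 => /eqP.
have [|/(divp_coefs q0)[R2 R2E]|/(divp_coefs q0)[S2 S2E]] := @irreducible_coefs q R' S q_irr.
- by move=> i; rewrite -cE' coefZ dvdp_mulr.
- apply: (smaller R2 S); first by apply: qinj; rewrite cE' R2E scalerAl.
    move/eqP: evR'; rewrite R2E -mul_polyC rmorphM mulf_eq0 => /orP[/eqP/evC|/eqP //].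
    by move/eqP; rewrite (negPf q0).
  by rewrite (leq_trans _ R'n) // R2E size_scale.
- apply: (smaller R' S2) => //; apply: qinj; rewrite cE' S2E.
  by rewrite -scalerAr.
Qed.
End Gauss.

(* The degree of an algebraic power series over N(X, s) is at most the degree
   of its specialisations at infinitely many points X = e. *)
Section AlgebraicSeries.
Variable N : fieldType.
Local Notation B := (fps {poly N}).
Local Notation A := {poly {poly N}}.

Definition spec (e : N) : {rmorphism {poly N} -> N} := horner_eval e.
Definition spec_fps (e : N) : {rmorphism B -> fps N} := map_fps (spec e).
Definition spec_poly (e : N) : {rmorphism A -> {poly N}} := map_poly (spec e).
Definition series (R : comNzRingType) : {rmorphism {poly R} -> fps R} := @fps_of_poly R.

Lemma spec_series e (p : A) : spec_fps e (series _ p) = series _ (spec_poly e p).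
Proof. by apply: fpsP => n /=; rewrite coef_map. Qed.

Definition seval (R : comNzRingType) (b : fps R) : {rmorphism {poly {poly R}} -> fps R} :=
  horner_eval b \o map_poly (series R).

Lemma sevalE (R : comNzRingType) (b : fps R) P : seval b P = (map_poly (series R) P).[b].
Proof. by []. Qed.

Lemma sevalC (R : comNzRingType) (b : fps R) c : seval b c%:P = series R c.
Proof. by rewrite sevalE map_polyC hornerC. Qed.

Lemma spec_seval e (b : B) (P : {poly A}) :
  spec_fps e (seval b P) = seval (spec_fps e b) (map_poly (spec_poly e) P).
Proof.
rewrite !sevalE -(horner_map (spec_fps e)) /= -!map_poly_comp; congr (_.[_]).
by apply: eq_map_poly => p; apply: spec_series.
Qed.

Section Grid.
Variables (R : idomainType) (D n : nat).

Definition grid_poly (a : 'I_D * 'I_n -> R) : {poly {poly R}} :=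
  \sum_ij ((a ij)%:P * 'X^(ij.1))%:P * 'X^(ij.2).

Lemma coef_grid a (ij : 'I_D * 'I_n) : (grid_poly a)`_ij.2`_ij.1 = a ij.
Proof.
rewrite /grid_poly !coef_sum (bigD1 ij) //= big1 ?addr0 => [|[i' j'] ne].
  by rewrite coefCM coefXn eqxx mulr1 coefCM coefXn eqxx mulr1.
rewrite coefCM coefXn /=; have [jj|_] := eqVneq; last by rewrite mulr0 coef0.
rewrite mulr1 coefCM coefXn; have [ii|_] := eqVneq; last by rewrite mulr0.
by case/eqP: ne; case: ij ii jj => i j /= /val_inj-> /val_inj->.
Qed.

Lemma size_grid a : (size (grid_poly a) <= n)%N.
Proof.
apply: (leq_trans (size_sum _ _ _)); apply/bigmax_leqP => -[i j] _ /=.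
by rewrite (leq_trans (size_mul_leq _ _)) // size_polyXn addnS /=
  (leq_trans (leq_add (size_polyC_leq1 _) (leqnn _))) ?add1n.
Qed.

Lemma grid_polyE (P : {poly {poly R}}) : (size P <= n)%N -> (sizeY P <= D)%N ->
  P = grid_poly (fun ij => P`_ij.2`_ij.1).
Proof.
move=> Pn PD; apply/polyP => j; apply/polyP => i.
have [lt_j|le_j] := ltnP j n; last first.
  by rewrite [P`_j]nth_default ?(leq_trans Pn) // [(grid_poly _)`_j]nth_default // (leq_trans (size_grid _)).
have [lt_i|le_i] := ltnP i D.
  by have /= -> := coef_grid (fun ij => P`_ij.2`_ij.1) (Ordinal lt_i, Ordinal lt_j).
rewrite nth_default ?(leq_trans (max_size_coefXY _ _) (leq_trans PD _)) //.
rewrite /grid_poly !coef_sum big1 // => -[i' j'] _ /=.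
rewrite coefCM coefXn; case: eqP => _; rewrite ?mulr0 ?coef0 //.
by rewrite mulr1 coefCM coefXn gtn_eqF ?mulr0 // (leq_trans (ltn_ord i')).
Qed.

Lemma coef_seval_grid a (d : fps R) c : (seval d (grid_poly a))`[c] =
  \sum_ij a ij * (fX R ^+ ij.1 * d ^+ ij.2)`[c].
Proof.
rewrite /grid_poly rmorph_sum fcoef_sum; apply: eq_bigr => -[i j] _.
pose p := (a (i, j))%:P * 'X^i; rewrite -[_ * 'X^_]/(p%:P * 'X^j); have -> : seval d (p%:P * 'X^j) = series R p * d ^+ j.
  by rewrite sevalE rmorphM /= map_polyC map_polyXn hornerM hornerC hornerXn.
have -> : series R p = fconst (a (i, j)) * fX R ^+ i.
  by rewrite rmorphM rmorphXn /= fps_of_polyC fps_of_polyX.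
by rewrite -mulrA fcoefCM.
Qed.
End Grid.

(** If no R exists, the products s^i b^j with i < D and j < n are independent over N[X], hence
    remain so at almost all X = e. But at such e there is an annihilator of size at most n, and
    [bounded_annihilator] brings its degree in s below D. The point is that D comes from P alone and
    does not depend on e. *)
Lemma algebraic_series (E : N -> Prop) (b : B) (P : {poly A}) n :
  infinite_set E -> P != 0 -> seval b P = 0 ->
  (forall e, E e -> exists R : {poly {poly N}},
     [/\ R != 0, (size R <= n)%N & seval (spec_fps e b) R = 0]) ->
  exists R : {poly A}, [/\ R != 0, (size R <= n)%N & seval b R = 0].
Proof.
move=> Ei P0 Pb sR; apply: contrapT => nR.
pose D := sizeY P.
pose g (ij : 'I_D * 'I_n) c := (fX _ ^+ ij.1 * b ^+ ij.2 : B)`[c].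
have gi : independent_on setT g.
  move=> a aE ij _; rewrite -(coef_grid a); suff -> : grid_poly a = 0 by rewrite !coef0.
  apply: contrapT => /eqP a0; apply: nR; exists (grid_poly a); split=> //.
    exact: size_grid.
  apply: fpsP => c; rewrite coef_seval_grid -[RHS](aE c).
  by apply: eq_bigl => ij'; rewrite inE.
have [d d0 dP] := independent_spec gi.
have [l l0 lP] : exists2 l : {poly N}, l != 0 &
    forall e, l.[e] != 0 -> map_poly (spec_poly e) P != 0.
  exists (lead_coef (lead_coef P)); rewrite ?lead_coef_eq0 // => e.
  apply: contraNneq => /(congr1 (fun Q : {poly {poly N}} => Q`_(size P).-1`_(size (lead_coef P)).-1)).
  by rewrite !coef_map !coef0 => <-.
have idN : injective (idfun : {rmorphism N -> N}) by [].
have [e [[Ee de] le] _] :=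
  infinite_set_nonroot idN l0 (infinite_set_nonroot idN d0 Ei) [::].
have [R [R0 Rn Rb]] := sR e Ee.
have Pe0 := lP e le.
have Peb : seval (spec_fps e b) (map_poly (spec_poly e) P) = 0.
  by rewrite -spec_seval Pb rmorph0.
have sC c : seval (spec_fps e b) c%:P = 0 -> c = 0.
  by rewrite sevalC -(rmorph0 (series N)) => /fps_of_poly_inj.
have [R' [R'0 R'b R'n R'D]] := bounded_annihilator sC Pe0 Peb R0 Rb Rn.
case/eqP: R'0; rewrite (@grid_polyE _ D n R') //; last first.
  rewrite (leq_trans R'D) //; apply/bigmax_leqP => -[j lt_j] _ /=; clear lt_j.
  by rewrite coef_map (leq_trans (size_poly _ _)) // max_size_coefXY.
rewrite -[RHS](_ : @grid_poly N D n (fun=> 0) = 0); last first.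
  by rewrite /grid_poly big1 // => ij _; rewrite mul0r polyC0 mul0r.
congr grid_poly; apply: funext => ij; apply: (dP e de (fun ij => R'`_ij.2`_ij.1) _ ij (in_setT ij)) => c.
transitivity (seval (spec_fps e b) R')`[c]; last by rewrite R'b.
rewrite [X in seval _ X](@grid_polyE _ D n R') // ?coef_seval_grid; last first.
  rewrite (leq_trans R'D) //; apply/bigmax_leqP => -[j lt_j] _ /=; clear lt_j.
  by rewrite coef_map (leq_trans (size_poly _ _)) // max_size_coefXY.
apply: eq_big => [ij'|ij' _]; first by rewrite inE.
congr (_ * _); rewrite /g -[RHS]/((fX N ^+ ij'.1 * spec_fps e b ^+ ij'.2)`[c]).
by rewrite -(map_fpsX (spec e)) -!rmorphXn -rmorphM.
Qed.
End AlgebraicSeries.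

(** * Powers in specialisations of rational functions *)

(** Kernels are compared, rather than assumed zero, because K0 will be presented as a quotient of
    the polynomials in a primitive element, where every element is a value of [ev]. *)
Lemma frac_lift (R : nzRingType) (E L : fieldType) (ev : {rmorphism R -> E})
    (ev' : {rmorphism R -> L}) :
  (forall a, ev a = 0 <-> ev' a = 0) ->
  (forall x, exists a b, ev b != 0 /\ x = ev a / ev b) ->
  exists f : {rmorphism E -> L}, forall a, f (ev a) = ev' a.
Proof.
move=> ker surj.
have rep x : exists ab : R * R, ev ab.2 != 0 /\ x = ev ab.1 / ev ab.2.
  by have [a [b ?]] := surj x; exists (a, b).
pose num x := (sval (cid (rep x))).1; pose den x := (sval (cid (rep x))).2.
have repP x : ev (den x) != 0 /\ x = ev (num x) / ev (den x) := svalP (cid (rep x)).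
pose f x := ev' (num x) / ev' (den x).
have nz b : ev b != 0 -> ev' b != 0 by apply: contraNneq => /ker->.
have fE x a b : ev b != 0 -> x * ev b = ev a -> f x * ev' b = ev' a.
  move=> b0 xE; have [d0 _] := repP x; apply: (mulIf (nz _ d0)).
  have : ev (num x * b - a * den x) = 0.
    rewrite rmorphB !rmorphM -xE {2}(repP x).2; apply/eqP; rewrite subr_eq0; apply/eqP.
    by rewrite mulrAC mulfVK //.
  move/ker; rewrite rmorphB !rmorphM => /eqP; rewrite subr_eq0 => /eqP <-.
  by rewrite /f mulrAC mulfVK ?nz.
have fev a : f (ev a) = ev' a.
  by rewrite -(fE (ev a) a 1) ?rmorph1 ?mulr1 ?oner_neq0.
have cross x : x * ev (den x) = ev (num x) by have [? {1}->] := repP x; rewrite mulfVK.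
have fcross x : f x * ev' (den x) = ev' (num x) by apply: fE; have [] := repP x.
have fB : zmod_morphism f.
  move=> x y; have d0 : ev (den x * den y) != 0.
    by rewrite rmorphM mulf_neq0 //; [have [] := repP x|have [] := repP y].
  apply: (mulIf (nz _ d0)).
  rewrite (fE _ (num x * den y - num y * den x)) //; last first.
    by rewrite rmorphB !rmorphM -!cross; ring.
  by rewrite rmorphB !rmorphM -!fcross; ring.
have fM : monoid_morphism f.
  split=> [|x y]; first by rewrite -(rmorph1 ev) fev rmorph1.
  have d0 : ev (den x * den y) != 0.
    by rewrite rmorphM mulf_neq0 //; [have [] := repP x|have [] := repP y].
  apply: (mulIf (nz _ d0)).
  rewrite (fE _ (num x * num y)) //; last by rewrite !rmorphM -!cross; ring.
  by rewrite !rmorphM -!fcross; ring.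
pose F : {rmorphism E -> L} := HB.pack f (GRing.isZmodMorphism.Build _ _ f fB)
  (GRing.isMonoidMorphism.Build _ _ f fM).
by exists F.
Qed.

Notation tofrac := (@FracField.tofrac _).
Notation "x %:F" := (tofrac x) : ring_scope.

Section Fraction.
Variable R : idomainType.

Lemma fractionP (x : {fraction R}) : exists a b : R, b != 0 /\ x = a%:F / b%:F.
Proof.
elim/quotW: x => r; exists \n_r, \d_r; rewrite denom_ratioP; split=> //.
apply/(canRL (mulfK _)); first by rewrite tofrac_eq0 denom_ratioP.
unlock tofrac; rewrite -[LHS]FracField.pi_mul; apply/eqmodP.
rewrite /= FracField.equivfE /FracField.mulf !numden_Ratio ?oner_eq0 ?mulr1 ?denom_ratioP //.
by rewrite mulrC.
Qed.

Lemma frac_ext (L : fieldType) (f : {rmorphism R -> L}) : injective f ->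
  exists F : {rmorphism {fraction R} -> L}, forall a, F a%:F = f a.
Proof.
move=> f_inj; apply: frac_lift => [a|x].
  split=> [/eqP|]; first by rewrite tofrac_eq0 => /eqP->; apply: rmorph0.
  by rewrite -(rmorph0 f) => /f_inj ->; apply: rmorph0.
by have [a [b [b0 ->]]] := fractionP x; exists a, b; rewrite tofrac_eq0.
Qed.

End Fraction.

(** Characterises a fraction field by its embedding, so that the arguments below do not depend on
    the construction of [{fraction R}]. *)
Definition is_frac (R : idomainType) (L : fieldType) (f : {rmorphism R -> L}) :=
  injective f /\ forall x, exists a b, b != 0 /\ x = f a / f b.

Lemma is_frac_eq (R : idomainType) (L : fieldType) (f : {rmorphism R -> L}) :
  is_frac f -> forall a b, (f a == f b) = (a == b).
Proof. by move=> [fI _] a b; apply: inj_eq. Qed.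

Lemma is_frac_eq0 (R : idomainType) (L : fieldType) (f : {rmorphism R -> L}) :
  is_frac f -> forall a, (f a == 0) = (a == 0).
Proof. by move=> fP a; rewrite -(rmorph0 f) (is_frac_eq fP). Qed.

Lemma tofrac_is_frac (R : idomainType) :
  is_frac (tofrac : {rmorphism R -> {fraction R}}).
Proof.
split=> [a b /eqP|x]; first by rewrite tofrac_eq => /eqP.
exact: fractionP.
Qed.

Lemma frac_clear (R : idomainType) (L : fieldType) (f : {rmorphism R -> L}) :
  is_frac f -> forall p : {poly L},
  exists (d : R) (q : {poly R}), d != 0 /\ f d *: p = map_poly f q.
Proof.
move=> fP; elim/poly_ind => [|p c [d [q [d0 qE]]]].
  by exists 1, 0; rewrite oner_neq0 scaler0 rmorph0.
have [a [b [b0 ->]]] := fP.2 c.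
exists (d * b), (b *: q * 'X + (d * a)%:P); rewrite mulf_neq0 //; split=> //.
have -> : map_poly f (b *: q * 'X + (d * a)%:P) =
    f b *: map_poly f q * 'X + (f (d * a))%:P.
  by rewrite rmorphD /= map_polyC; congr (_ + _); rewrite rmorphM /= map_polyX map_polyZ.
rewrite -qE scalerDr; congr (_ + _).
  by rewrite scalerAl scalerA -rmorphM [(b * d)%R]mulrC.
rewrite -mul_polyC -polyCM; congr _%:P.
by rewrite !rmorphM mulrA mulrAC mulfK // (is_frac_eq0 fP).
Qed.

Section SeriesFacts.
Variable R : idomainType.

Lemma poly_order (p : {poly R}) : p != 0 -> exists j q, p = 'X^j * q /\ q`_0 != 0.
Proof.
move=> p0; have [m [q]] := multiplicity_XsubC p 0; rewrite p0 subr0 /= => q0 ->.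
by exists m, q; rewrite mulrC; split=> //; rewrite -horner_coef0.
Qed.

Lemma fconst_eq0 (x : R) : (fconst x == 0) = (x == 0).
Proof.
apply/eqP/eqP => [/(congr1 (fun a => a`[0])) //|->]; exact: rmorph0.
Qed.

Lemma series_eq0 (p : {poly R}) : (series R p == 0) = (p == 0).
Proof.
by apply/eqP/eqP => [|->]; rewrite ?rmorph0 // -(rmorph0 (series R)) => /fps_of_poly_inj.
Qed.

Lemma fcoefXn0 (f : fps R) n : (f ^+ n)`[0] = f`[0] ^+ n.
Proof. exact: (rmorphXn (@fcoef_0 R)). Qed.

(** In f^n - g^n = (f - g) * S the constant coefficient of S is n g_0^(n-1), which is nonzero. *)
Lemma fps_root_uniq n (f g : fps R) : n%:R != 0 :> R -> f`[0%N] = g`[0%N] ->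
  g`[0%N] != 0 -> f ^+ n = g ^+ n -> f = g.
Proof.
move=> n0 fg0 g0 fgn; apply/eqP; rewrite -subr_eq0.
have := subrXX f g n; rewrite fgn subrr => /esym/eqP; rewrite mulf_eq0 => /orP[//|/eqP].
move=> /(congr1 (fun a => a`[0])); rewrite fcoef_sum => /eqP; apply: contraTT => _.
rewrite (eq_bigr (fun=> g`[0%N] ^+ n.-1)) => [|i _].
  by rewrite sumr_const card_ord -mulr_natr mulf_neq0 ?expf_neq0.
rewrite fcoefM0 !fcoefXn0 fg0 -exprD subnK // -ltnS prednK //.
by rewrite (leq_trans _ (ltn_ord i)).
Qed.

Lemma power_order l (p : {poly R}) j (p0 a b : {poly R}) : (0 < l)%N ->
  p = 'X^j * p0 -> p0`_0 != 0 -> b != 0 -> p * b ^+ l = a ^+ l ->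
  exists i (a0 b0 : {poly R}), [/\ j = (l * i)%N, b0`_0 != 0 & p0 * b0 ^+ l = a0 ^+ l].
Proof.
move=> l0 -> p00 b0 E.
have p0n : p0 != 0 by apply: contraNneq p00 => ->; rewrite coef0.
have : a ^+ l != 0 by rewrite -E !mulf_neq0 ?expf_neq0 ?polyX_eq0.
rewrite expf_eq0 l0 /= => a0.
have [m [a' [aE a'0]]] := poly_order a0; have [n [b' [bE b'0]]] := poly_order b0.
have E2 : 'X^(j + n * l) * (p0 * b' ^+ l) = 'X^(m * l) * a' ^+ l.
  have := E; rewrite aE bE !exprMn -!exprM exprD => <-.
  by rewrite -!mulrA; congr (_ * _); rewrite mulrCA.
have c0 (q : {poly R}) i : ('X^i * q)`_i = q`_0 by rewrite coefXnM ltnn subnn.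
have cl (q : {poly R}) i i' : (i' < i)%N -> ('X^i * q)`_i' = 0 by rewrite coefXnM => ->.
have n1 : (p0 * b' ^+ l)`_0 != 0.
  by rewrite -horner_coef0 hornerM horner_exp !horner_coef0 mulf_neq0 ?expf_neq0.
have n2 : (a' ^+ l)`_0 != 0.
  by rewrite -horner_coef0 horner_exp horner_coef0 expf_neq0.
have jE : (j + n * l = m * l)%N.
  case: (ltngtP (j + n * l)%N (m * l)%N) => // lt.
    by case/eqP: n1; rewrite -(c0 _ (j + n * l)%N) E2 cl.
  by case/eqP: n2; rewrite -(c0 _ (m * l)%N) -E2 cl.
exists (m - n)%N, a', b'; split=> //.
  by rewrite mulnC mulnBl -jE addnK.
by apply: (mulfI (_ : 'X^(m * l) != 0)); rewrite ?expf_neq0 ?polyX_eq0 // -E2 jE.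
Qed.
End SeriesFacts.

(** A substitute for Hilbert irreducibility. Over a closed k a polynomial with coefficients in k
    takes l-th power values at all points of k, so being such a polynomial modulo l-th powers is the
    most that can be concluded. It is applied to leading coefficients in s. *)
Definition pure_ext l (k N : fieldType) (c : {rmorphism k -> N}) :=
  forall (w : {poly N}) (E : k -> Prop), w != 0 -> infinite_set E ->
  (forall e, E e -> exists v, w.[c e] = v ^+ l) ->
  exists (a : {poly k}) (u v : {poly N}),
    [/\ a != 0, u != 0, v != 0 & w * v ^+ l = map_poly c a * u ^+ l].

Lemma pure_ext_id l (k : fieldType) : pure_ext l (idfun : {rmorphism k -> k}).
Proof.
move=> w E w0 _ _; exists w, 1, 1; split; rewrite ?oner_neq0 //.
by rewrite map_poly_id.
Qed.

Section PureStep.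
Variables (l : nat) (k N' : fieldType) (c : {rmorphism k -> N'}).
Hypotheses (l_gt0 : (0 < l)%N) (l_neq0 : l%:R != 0 :> N') (cP : pure_ext l c).
Local Notation N := {fraction {poly N'}}.
Local Notation A := {poly {poly N'}}.

Definition ratf_const : {rmorphism k -> N} := tofrac \o (polyC \o c).

(** The substitution of c0 s for s is inverted on polynomials up to a power of c0, by multiplying
    coefficient i by c0^(m-i). *)
Lemma rescale_clear (q : A) (c0 : {poly N'}) m : (size q <= m)%N ->
  exists q' : A, rescale_fps c0 (series _ q') = fconst (c0 ^+ m) * series _ q.
Proof.
move=> qm; exists (\poly_(i < size q) (q`_i * c0 ^+ (m - i))).
apply: fpsP => i; rewrite fcoefCM /= coef_poly; case: ltnP => [lt_i|le_i].
  by rewrite -mulrA -exprD subnK 1?mulrC // ltnW // (leq_trans lt_i).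
by rewrite mul0r nth_default // mulr0.
Qed.

(** The outer variable s is the generator of N over N', the inner one is specialised. The lowest
    coefficient [c0] of V in s is handled by purity of N'. The rest has an l-th root z in
    N'[X][[s]]; on each fibre z is a rational function of s, so [algebraic_series] in degree 1 makes
    z rational. *)
Lemma pure_poly (V : A) (E : k -> Prop) : V != 0 -> infinite_set E ->
  (forall e, E e -> exists a b : {poly N'}, b != 0 /\ spec_poly (c e) V * b ^+ l = a ^+ l) ->
  exists (a : {poly k}) (u v : A),
    [/\ a != 0, u != 0, v != 0 & V * v ^+ l = (map_poly c a)%:P * u ^+ l].
Proof.
move=> V0 Ei VE; have [j [V1 [VV1 V10]]] := poly_order V0.
set c0 := V1`_0 in V10.
have {}Ei := infinite_set_nonroot (fmorph_inj c) V10 Ei.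
have good e : E e /\ c0.[c e] != 0 -> exists i (a0 b0 : {poly N'}), [/\ j = (l * i)%N, b0`_0 != 0 &
    spec_poly (c e) V1 * b0 ^+ l = a0 ^+ l].
  move=> [/VE [a [b [b0 ab]]] ce]; apply: power_order b0 ab => //.
    by rewrite VV1 rmorphM /= map_polyXn.
  by rewrite coef_map.
have [i jE] : exists i, j = (l * i)%N.
  by have [e /good [i [a0 [b0 [-> _ _]]]] _] := Ei [::]; exists i.
have [|a [u [v [a0 u0 v0 c0E]]]] := cP V10 Ei.
  move=> e /good [_ [a0 [b0 [_ b0n /(congr1 (fun p : {poly N'} => p`_0))]]]].
  rewrite -!horner_coef0 hornerM !horner_exp !horner_coef0 coef_map /= -/c0 => E0.
  by exists (a0`_0 / b0`_0); rewrite exprMn exprVn -E0 mulfK ?expf_neq0.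
(* After s is replaced by c0 s, every coefficient of V1 is divisible by c0; W is the quotient, with
   constant term 1 and no denominators. *)
pose W : A := \poly_(i < size V1) (if i is m.+1 then V1`_i * c0 ^+ m else 1).
have V1n : V1 != 0 by apply: contraNneq V10 => V1n; rewrite /c0 V1n coef0.
have WE : rescale_fps c0 (series _ V1) = fconst c0 * series _ W.
  apply: fpsP => n; rewrite fcoefCM /= coef_poly.
  case: ltnP => [_|le_n]; last by rewrite nth_default // mul0r mulr0.
  by case: n => [|n]; rewrite ?expr0 ?mulr1 // exprSr mulrA mulrC.
have W0 : (series _ W)`[0] = 1 by rewrite /= coef_poly size_poly_gt0 V1n.
have lu : (l%:R : {poly N'}) \is a GRing.unit.
  by rewrite -polyC_natr poly_unitE size_polyC l_neq0 coefC eqxx unitfE l_neq0.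
have [z z0 zW] := fps_root1 lu W0.
pose P : {poly A} := 'X^l - W%:P.
have P0 : P != 0 by rewrite -size_poly_gt0 size_XnsubC.
have Pz : seval z P = 0.
  by rewrite rmorphB sevalC sevalE map_polyXn hornerXn zW subrr.
(* Size 2 means degree 1: on the fibre, z is a ratio of the rescaled polynomials [a1] and
   [r *: b1]. *)
have [||R [R0 R2 Rz]] := @algebraic_series N' (fun x => exists2 e, (E e /\ c0.[c e] != 0) & x = c e) z P 2 _ P0 Pz.
- exact: infinite_set_image (fmorph_inj c) Ei.
- move=> x [e Ee ->]; have [_ [ae [be [_ be0 ab]]]] := good e Ee.
  set g := c0.[c e]; have g0 : g != 0 by case: Ee.
  have rp (p : {poly N'}) : exists q, series _ q = rescale_fps g (series _ p).
    exists (\poly_(i < size p) (p`_i * g ^+ i)); apply: fpsP => n /=; rewrite coef_poly.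
    by case: ltnP => // le_n; rewrite nth_default ?mul0r.
  have [b1 b1E] := rp be; have [a1 a1E] := rp ae.
  have gE : g * be`_0 ^+ l = ae`_0 ^+ l.
    move/(congr1 (fun p : {poly N'} => p`_0)): ab.
    by rewrite -!horner_coef0 hornerM !horner_exp !horner_coef0 coef_map.
  have ae0 : ae`_0 != 0.
    have : ae`_0 ^+ l != 0 by rewrite -gE mulf_neq0 ?expf_neq0.
    by rewrite expf_eq0 l_gt0.
  (* This scalar is an l-th root of c0 at e; it matches the constant terms, so that the two l-th
     roots compared below coincide. *)
  pose r := ae`_0 / be`_0.
  have We : fconst g * spec_fps (c e) (series _ W) * rescale_fps g (series _ be) ^+ l =
      rescale_fps g (series _ ae) ^+ l.
    rewrite -!rmorphXn -ab !rmorphM; congr (_ * _).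
    rewrite -spec_series -(map_fpsC (spec (c e))) -rmorphM -WE.
    by apply: fpsP => n /=; rewrite /horner_eval hornerM horner_exp.
  have r0 (p : {poly N'}) : (rescale_fps g (series _ p))`[0] = p`_0.
    by rewrite /= expr0 mulr1.
  have ze0 : (spec_fps (c e) z)`[0] = 1 by rewrite /= z0 /horner_eval hornerC.
  have zE : fconst r * spec_fps (c e) z * series _ b1 = series _ a1.
    apply: (@fps_root_uniq _ l) => //.
    - by rewrite !fcoefM0 b1E a1E !r0 ze0 mulr1 fcoefC mulfVK.
    - by rewrite a1E r0.
    rewrite !exprMn a1E -We b1E -!rmorphXn zW; congr (_ * _ * _).
    by rewrite expr_div_n -gE mulfK ?expf_neq0.
  exists ((r *: b1)%:P * 'X - a1%:P); split.
  - apply: contraNneq ae0 => Rz0; have : r *: b1 = 0.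
      by rewrite -[RHS](coef0 _ 1) -Rz0 coefB coefMX !coefC subr0.
    move=> rb; have : (r *: b1)`_0 = 0 by rewrite rb coef0.
    rewrite coefZ -[b1`_0]/((series _ b1)`[0]) b1E r0 /r mulfVK // => ->.
    by rewrite eqxx.
  - rewrite (leq_trans (size_polyD _ _)) // geq_max size_polyN (leq_trans (size_polyC_leq1 _)) // andbT.
    by rewrite (leq_trans (size_polyMleq _ _)) // size_polyX addn2 /= ltnS size_polyC_leq1.
  rewrite rmorphB rmorphM !sevalC [seval _ 'X]sevalE map_polyX hornerX -mul_polyC rmorphM.
  by rewrite [series _ r%:P]fps_of_polyC mulrAC zE subrr.
have R1z : series _ R`_1 * z = series _ (- R`_0).
  move: Rz; rewrite sevalE (@horner_coef_wide _ 2); last by rewrite (leq_trans (size_poly _ _)).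
  rewrite big_ord_recl big_ord1 !coef_map /= expr0 mulr1 expr1 addrC => /eqP.
  by rewrite addr_eq0 rmorphN => /eqP.
have R10 : R`_1 != 0.
  apply: contraNneq R0 => R10; move: R1z; rewrite R10 rmorph0 mul0r -(rmorph0 (series _)).
  move=> /fps_of_poly_inj/esym/eqP; rewrite oppr_eq0 => /eqP R00; apply/eqP/polyP => -[|[|n]] //.
  - by rewrite coef0.
  - by rewrite coef0.
  by rewrite nth_default ?coef0 // (leq_trans R2).
pose m := maxn (size R`_1) (size (- R`_0)%R).
have [v1 v1E] := rescale_clear c0 (leq_maxl _ _ : (size (R`_1)%R <= m)%N).
have [u1 u1E] := rescale_clear c0 (leq_maxr _ _ : (size (- R`_0)%R <= m)%N).
have E1 : V1 * v1 ^+ l = c0%:P * u1 ^+ l.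
  suff E2 : rescale_fps c0 (series _ (V1 * v1 ^+ l)) =
      rescale_fps c0 (series _ (c0%:P * u1 ^+ l)).
    by apply: fps_of_poly_inj; apply: rescale_fps_inj V10 _ _ E2.
  have rsM (p q : A) : rescale_fps c0 (series _ (p * q ^+ l)) =
      rescale_fps c0 (series _ p) * rescale_fps c0 (series _ q) ^+ l.
    by rewrite !rmorphM !rmorphXn.
  rewrite !rsM v1E u1E WE.
  have -> : rescale_fps c0 (series _ c0%:P) = fconst c0.
    by apply: fpsP => -[|n] /=; rewrite coefC ?mulr1 ?mul0r.
  by rewrite -R1z !exprMn zW; ring.
have v10 : v1 != 0.
  apply: contraNneq R10 => v10; move: v1E; rewrite v10 !rmorph0 => /esym/eqP.
  by rewrite mulf_eq0 fconst_eq0 series_eq0 expf_eq0 (negPf V10) andbF.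
have u10 : u1 != 0.
  apply: contraNneq (mulf_neq0 V1n (expf_neq0 l v10)) => u10.
  by rewrite E1 u10 expr0n eqn0Ngt l_gt0 mulr0.
exists a, (u%:P * 'X^i * u1), (v1 * v%:P); split=> //.
- by rewrite !mulf_neq0 ?polyC_eq0 ?expf_neq0 ?polyX_eq0.
- by rewrite mulf_neq0 ?polyC_eq0.
rewrite VV1 jE mulnC exprM !exprMn.
have -> : ('X^i ^+ l * V1 * (v1 ^+ l * v%:P ^+ l) = 'X^i ^+ l * (V1 * v1 ^+ l) * v%:P ^+ l :> A).
  by rewrite !mulrA.
rewrite E1 -!rmorphXn /=.
have -> : 'X^i ^+ l * (c0%:P * u1 ^+ l) * (v ^+ l)%:P = (c0 * v ^+ l)%:P * 'X^i ^+ l * u1 ^+ l :> A.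
  by rewrite polyCM; ring.
by rewrite c0E polyCM; ring.
Qed.

(** Multiplying w by the l-th power of its denominator does not change its class. [swapXY] then
    moves X inside, so that w becomes a polynomial in the generator of N with coefficients in
    N'[X]. *)
Lemma pure_ext_step : pure_ext l ratf_const.
Proof.
move=> w E w0 Ei wE; have [d [W [d0 dE]]] := frac_clear (@tofrac_is_frac _) w.
pose W1 := d ^+ l.-1 *: W.
have W1E : (d ^+ l)%:F *: w = map_poly tofrac W1.
  by rewrite /W1 map_polyZ /= -dE scalerA -tofracM -exprSr prednK.
have W10 : W1 != 0.
  apply: contraNneq w0 => W10; move: W1E; rewrite W10 rmorph0 => /eqP.
  by rewrite scaler_eq0 tofrac_eq0 expf_eq0 (negPf d0) andbF.
have [||a [u [v [a0 u0 v0 E0]]]] := @pure_poly (swapXY W1) E _ Ei.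
- by rewrite swapXY_eq0.
- move=> e /wE[x wx].
  have [n1 [n2 [n20 xE]]] := fractionP x.
  exists (d * n1), n2; split=> //; apply/eqP; rewrite -tofrac_eq; apply/eqP.
  have -> : spec_poly (c e) (swapXY W1) = W1.[(c e)%:P].
    by rewrite -[in RHS](swapXYK W1) horner_swapXY.
  rewrite tofracM !tofracXn tofracM exprMn.
  have -> : W1.[(c e)%:P]%:F = (d ^+ l)%:F * w.[ratf_const e].
    by rewrite -hornerZ W1E /= horner_map.
  rewrite wx xE tofracXn expr_div_n mulrA mulfVK //.
  by rewrite expf_neq0 // tofrac_eq0.
exists a, (map_poly tofrac (swapXY u)), (d%:F *: map_poly tofrac (swapXY v)); split=> //.
- by rewrite map_poly_eq0_id0 ?swapXY_eq0 // tofrac_eq0 lead_coef_eq0 swapXY_eq0.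
- by rewrite scaler_eq0 tofrac_eq0 negb_or d0 map_poly_eq0_id0 ?swapXY_eq0 // tofrac_eq0 lead_coef_eq0 swapXY_eq0.
have E1 : W1 * swapXY v ^+ l = map_poly polyC (map_poly c a) * swapXY u ^+ l.
  have := congr1 (fun p => swapXY p) E0.
  by rewrite !rmorphM !rmorphXn /= swapXYK swapXY_polyC.
rewrite exprZn -tofracXn -scalerAr scalerAl W1E.
have := congr1 (map_poly tofrac) E1; rewrite !rmorphM !rmorphXn /= => ->.
by congr (_ * _); rewrite -!map_poly_comp.
Qed.
End PureStep.

(** * Milnor K-theory modulo l and the tame symbol *)

Section KMHom.
Variables (ell : nat) (F : fieldType) (r : nat) (W : zmodType).
Variable f : r.-tuple (units F) -> W.
Hypothesis f_multilinear : forall (i : 'I_r) (t t1 t2 : r.-tuple (units F)),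
  val (tnth t i) = val (tnth t1 i) * val (tnth t2 i) ->
  (forall j, j != i -> tnth t1 j = tnth t j /\ tnth t2 j = tnth t j) ->
  f t = f t1 + f t2.
Hypothesis f_steinberg : forall (t : r.-tuple (units F)) (i j : 'I_r),
  (i < j)%N -> val (tnth t i) + val (tnth t j) = 1 -> f t = 0.
Hypothesis W_torsion : forall w : W, w *+ ell = 0.

Lemma kM_hom : exists g : {additive kM ell F r -> W}, forall t, g (symbol ell t) = f t.
Proof.
pose f0 : {additive words F r -> W} := HB.pack (flift f)
  (GRing.isZmodMorphism.Build _ _ (flift f) (flift_is_zmod f)).
have v0 x : multilinear x -> f0 x = 0.
  move=> [i [t [t1 [t2 [ti tj ->]]]]].
  by rewrite !raddfB /= !fliftE (f_multilinear ti tj) addrAC addrK subrr.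
have z1 := quo_lift_zmod v0; have e1 := quo_liftE v0.
pose f1 : {additive tensor_power F r -> W} := HB.pack (fun u : tensor_power F r => f0 (repr u))
  (GRing.isZmodMorphism.Build _ _ _ z1).
have v1 x : steinberg x -> f1 x = 0.
  move=> [t [i [j [ij tij ->]]]].
  by rewrite [LHS](e1 << t >>) /= fliftE (f_steinberg ij).
have z2 := quo_lift_zmod v1; have e2 := quo_liftE v1.
pose f2 : {additive milnorK F r -> W} := HB.pack (fun u : milnorK F r => f1 (repr u))
  (GRing.isZmodMorphism.Build _ _ _ z2).
have v2 x : @ell_multiple ell F r x -> f2 x = 0.
  by move=> [y ->]; rewrite raddfMn W_torsion.
have z3 := quo_lift_zmod v2; have e3 := quo_liftE v2.
pose f3 : {additive kM ell F r -> W} := HB.pack (fun u : kM ell F r => f2 (repr u))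
  (GRing.isZmodMorphism.Build _ _ _ z3).
exists f3 => t; rewrite -[LHS]/(f2 (repr (qpi _ _))) e3.
rewrite -[LHS]/(f1 (repr (qpi _ _))) e2 -[LHS]/(f0 (repr (qpi _ _))) e1.
by rewrite /= fliftE.
Qed.
End KMHom.

Section Units.
Variable F : fieldType.

(** A copy of the units carrying multiplication as an addition, so that quotients by [span] apply to
    the multiplicative group. *)
Definition mul_units := units F.
HB.instance Definition _ := Choice.on mul_units.
Lemma mul_unit_neq0 (u v : mul_units) : val (u : units F) * val (v : units F) != 0.
Proof. by rewrite mulf_neq0 ?(valP (_ : units F)). Qed.
Lemma inv_unit_neq0 (u : mul_units) : (val (u : units F))^-1 != 0.
Proof. by rewrite invr_eq0 (valP (u : units F)). Qed.
Definition units_add (u v : mul_units) : mul_units := exist (fun x : F => x != 0) _ (mul_unit_neq0 u v).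
Definition units_opp (u : mul_units) : mul_units := exist (fun x : F => x != 0) _ (inv_unit_neq0 u).
Definition units_zero : mul_units := exist (fun x : F => x != 0) _ (oner_neq0 F).
Fact units_addA : associative units_add.
Proof. by move=> u v w; apply: val_inj; rewrite /= mulrA. Qed.
Fact units_addC : commutative units_add.
Proof. by move=> u v; apply: val_inj; rewrite /= mulrC. Qed.
Fact units_add0 : left_id units_zero units_add.
Proof. by move=> u; apply: val_inj; rewrite /= mul1r. Qed.
Fact units_addN : left_inverse units_zero units_opp units_add.
Proof. by move=> u; apply: val_inj; rewrite /= mulVf //; apply: (valP (u : units F)). Qed.
HB.instance Definition _ := GRing.isZmodule.Build mul_units
  units_addA units_addC units_add0 units_addN.

Lemma val_unitsM (u : mul_units) n : val (u *+ n : units F) = val (u : units F) ^+ n.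
Proof.
elim: n => [|n IHn]; first by rewrite mulr0n expr0.
by rewrite mulrS exprS -IHn.
Qed.
End Units.

Section Class.
Variables (ell : nat) (F : fieldType).
Local Notation cl := (@kM_class ell F).
Local Notation V := (kM ell F 1).

Lemma val_to_unit (x : F) : x != 0 -> val (to_unit x) = x.
Proof. by move=> x0; rewrite val_insubd x0. Qed.

Lemma to_unit_val (u : units F) : to_unit (val u) = u.
Proof. by apply: val_inj; rewrite val_to_unit // (valP u). Qed.

Lemma symbol1 (t : 1.-tuple (units F)) : symbol ell t = cl (val (tnth t ord0)).
Proof.
rewrite /kM_class to_unit_val; congr symbol; apply: val_inj => /=.
by case: t => -[|u []] //= st; rewrite (tnth_nth u).
Qed.

Lemma classM x y : x != 0 -> y != 0 -> cl (x * y) = cl x + cl y.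
Proof.
move=> x0 y0; apply/eqP; rewrite -subr_eq0 opprD addrA; apply/eqP.
rewrite /kM_class /symbol -!raddfB; apply: (etrans _ (raddf0 _)); congr qpi.
apply: (etrans _ (raddf0 _)); congr qpi.
apply: qpi0; exists ord0, [tuple to_unit (x * y)], [tuple to_unit x], [tuple to_unit y].
split=> // [|j]; first by rewrite /= !val_to_unit ?mulf_neq0.
by rewrite (ord1 j).
Qed.

Lemma class1 : cl 1 = 0.
Proof.
have := classM (oner_neq0 _) (oner_neq0 _); rewrite mulr1 => /eqP.
by rewrite eq_sym -subr_eq0 addrK => /eqP.
Qed.

Lemma classX x n : x != 0 -> cl (x ^+ n) = cl x *+ n.
Proof.
move=> x0; elim: n => [|n IHn]; first by rewrite mulr0n class1.
by rewrite exprS classM ?expf_neq0 // IHn mulrS.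
Qed.

Lemma classV x : x != 0 -> cl x^-1 = - cl x.
Proof.
move=> x0; apply/eqP; rewrite -addr_eq0 -classM ?invr_eq0 // mulVf //.
by rewrite class1.
Qed.

Lemma class_div x y : x != 0 -> y != 0 -> cl (x / y) = cl x - cl y.
Proof. by move=> x0 y0; rewrite classM ?invr_eq0 // classV. Qed.

Lemma class_power x : x != 0 -> cl (x ^+ ell) = 0.
Proof. by move=> x0; rewrite classX // kM_torsion. Qed.

Lemma class_surj (v : V) : exists2 x, x != 0 & v = cl x.
Proof.
rewrite -[v]qpi_repr -[repr v]qpi_repr -[repr (repr v)]qpi_repr.
set w := repr _; rewrite -(freeg_sumE w) !raddf_sum.
elim/big_ind: _ => [|u1 u2 [x x0 ->] [y y0 ->]|t _].
- by exists 1; rewrite ?class1 ?oner_neq0.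
- by exists (x * y); rewrite ?classM ?mulf_neq0.
rewrite -[coeff t w]intz -freegU_mulz !raddfMz -[X in X *~ _]/(symbol ell t) symbol1.
set x := val _; have x0 : x != 0 by apply: (valP (tnth t ord0)).
case: (coeff t w) => n; first by exists (x ^+ n); rewrite ?expf_neq0 ?classX.
by exists (x ^- n.+1); rewrite ?invr_eq0 ?expf_neq0 // NegzE mulrNz classV ?expf_neq0 ?classX.
Qed.

(** The projection from the units to their quotient by l-th powers factors through k_1 by [kM_hom];
    in degree 1 there are no two indices i < j, hence no Steinberg relation to check. *)
Lemma class_eq0 x : x != 0 -> cl x = 0 -> exists2 h, h != 0 & x = h ^+ ell.
Proof.
move=> x0 cx; pose mult (u : mul_units F) := exists y, u = y *+ ell.
pose f (t : 1.-tuple (units F)) : quo mult := qpi mult (tnth t ord0 : mul_units F).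
have [i t t1 t2|t i j||g gE] := @kM_hom ell F 1 (quo mult) f.
- rewrite (ord1 i) => tE _; rewrite /f -raddfD; congr qpi; exact: val_inj.
- by rewrite (ord1 i) (ord1 j).
- move=> w; rewrite -[w]qpi_repr -raddfMn; apply: qpi0; by exists (repr w).
have : f [tuple to_unit x] = 0 by rewrite -gE -[symbol _ _]/(cl x) cx raddf0.
rewrite -(raddf0 (qpi mult)) => /qpiP; rewrite subr0 => /asboolP.
pose H : {pred mul_units F} := fun u => `[< mult u >].
have Hz : zmod_closed H.
  split=> [|u v /asboolP[y ->] /asboolP[z ->]]; apply/asboolP.
    by exists 0; rewrite mul0rn.
  by exists (y - z); rewrite mulrnBl.
pose Hp := GRing.isZmodClosed.Build _ H Hz.
pose HZ : zmodClosed (mul_units F) := HB.pack H Hp.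
move=> /(_ HZ) h; have /asboolP[y /(congr1 val)] : tnth [tuple to_unit x] ord0 \in HZ.
  by apply: h => y ym; apply/asboolP.
rewrite val_unitsM val_to_unit // => ->; exists (val (y : units F)) => //.
exact: (valP (y : units F)).
Qed.

Lemma class_eq x y : x != 0 -> y != 0 -> cl x = cl y ->
  exists2 h, h != 0 & x = y * h ^+ ell.
Proof.
move=> x0 y0 E; have [||h h0 hE] := @class_eq0 (x / y).
- by rewrite mulf_neq0 ?invr_eq0.
- by rewrite class_div // E subrr.
by exists h => //; rewrite -hE mulrC divfK.
Qed.

Lemma kM_mul_steinberg x y : x != 0 -> y != 0 -> x + y = 1 ->
  kM_mul (cl x) (cl y) = 0.
Proof.
move=> x0 y0 xy; rewrite /kM_class kM_mul_symbol /symbol.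
apply: (etrans _ (raddf0 _)); congr qpi; apply: qpi0.
exists (cat_tuple [tuple to_unit x] [tuple to_unit y]), ord0, ord_max; split=> //.
by rewrite !(tnth_nth (to_unit x)) /= !val_to_unit.
Qed.
End Class.

Lemma coprime_torsion (W : zmodType) (w : W) l (z : int) :
  w *+ l = 0 -> coprime `|z|%N l -> w *~ z = 0 -> w = 0.
Proof.
move=> wl cz wz; have {}wz : w *+ `|z|%N = 0.
  by case: z wz {cz} => n //; rewrite NegzE mulrNz => /eqP; rewrite oppr_eq0 => /eqP.
move: `|z|%N cz wz => n cz wn; have [n0|n0] := posnP n.
  by move: cz; rewrite n0 /coprime gcd0n => /eqP l1; rewrite -[w]mulr1n -l1.
have [[u v] /= uv] := coprimeP _ n0 cz.
have E : (n * u = l * v + 1)%N by move: uv; lia.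
have : w *+ (n * u)%N = w *+ (l * v + 1)%N by rewrite E.
by rewrite mulrnDr mulr1n !mulrnA wn wl !mul0rn add0r.
Qed.

(* A valuation ring of K, given by its maximal ideal, together with an
   integer-valued homomorphism that is trivial on its units. *)
Record place (K : fieldType) := Place {
  pm : K -> Prop;
  po : K -> int;
  poM : forall x y, x != 0 -> y != 0 -> po (x * y) = po x + po y;
  pm_unit : forall a, pm a -> 1 + a != 0 /\ po (1 + a) = 0;
  pmN : forall a, pm a -> pm (- a);
  pm_div : forall a b, pm a -> pm b -> exists2 c, pm c & 1 + a = (1 + b) * (1 + c);
  pm0 : pm 0;
  pmP : forall x y, x != 0 -> y != 0 -> x + y = 1 ->
    [\/ pm x, pm y, po x = 0 /\ po y = 0 | pm y^-1]
}.

Section Tame.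
Variables (ell : nat) (K : fieldType) (p : place K).
Hypothesis N1_power : exists2 h : K, h != 0 & -1 = h ^+ ell.
Local Notation cl := (@kM_class ell K).
Local Notation V := (kM ell K 1).

Definition principal (v : V) := exists2 a, pm p a & v = cl (1 + a).
Local Notation W := (quo principal).

Lemma span_principal v : v \in Defs.span principal -> principal v.
Proof.
pose H : {pred V} := fun u => `[< principal u >].
have Hz : zmod_closed H.
  split=> [|u v' /asboolP[a pa ->] /asboolP[b pb ->]]; apply/asboolP.
    by exists 0; [apply: pm0 | rewrite addr0 class1].
  have [c pc E] := pm_div pa pb; exists c => //.
  have [b0 _] := pm_unit pb; have [c0 _] := pm_unit pc.
  by rewrite E classM // addrAC subrr add0r.
pose Hp := GRing.isZmodClosed.Build _ H Hz.
pose HZ : zmodClosed V := HB.pack H Hp.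
by move=> /asboolP /(_ HZ) h; apply/asboolP/h => y yP; apply/asboolP.
Qed.

Lemma po1 : po p 1 = 0.
Proof. by have [_] := pm_unit (pm0 p); rewrite addr0. Qed.

Lemma poN1 : po p (-1) = 0.
Proof.
have N10 : -1 != 0 :> K by rewrite oppr_eq0 oner_eq0.
have := poM p N10 N10; rewrite mulrNN mulr1 po1; lia.
Qed.

Lemma poV x : x != 0 -> po p x^-1 = - po p x.
Proof.
move=> x0; apply/eqP; rewrite -addr_eq0 -poM ?invr_eq0 // mulVf //.
by rewrite po1.
Qed.

Lemma poX x n : x != 0 -> po p (x ^+ n) = po p x *+ n.
Proof.
move=> x0; elim: n => [|n IHn]; first by rewrite po1.
by rewrite exprS poM ?expf_neq0 // IHn mulrS.
Qed.

(** The tame symbol y^v(x) / x^v(y), read in k_1 modulo the classes of 1 + m, so that neither a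
    residue field nor a uniformiser is chosen. Its usual sign is trivial because -1 is an l-th
    power. *)
Definition tame_fun (t : 2.-tuple (units K)) : W :=
  let x := val (tnth t ord0) in let y := val (tnth t ord_max) in
  qpi principal (cl y) *~ po p x - qpi principal (cl x) *~ po p y.

(** For y of order 0 the symbol is v(x) times the class of y, and v(x) is invertible modulo l. *)
Lemma tame (x y : K) : x != 0 -> y != 0 -> kM_mul (cl x) (cl y) = 0 ->
  po p y = 0 -> coprime `|po p x|%N ell ->
  exists h a, [/\ h != 0, pm p a & y = h ^+ ell * (1 + a)].
Proof.
move=> x0 y0 xy py px.
have Wt (w : W) : w *+ ell = 0.
  by rewrite -[w]qpi_repr -raddfMn kM_torsion raddf0.
have nz (u : units K) : val u != 0 := valP u.
have [i t t1 t2 tE tj|t i j ij tij||g gE] := @kM_hom ell K 2 W tame_fun => //.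
- rewrite /tame_fun; case: (unliftP ord_max i) tE tj => [i'|] -> tE tj; last first.
    have [-> ->] := tj ord0 isT; rewrite tE classM ?nz // poM ?nz // raddfD mulrzDr mulrzDl.
    by rewrite opprD addrACA.
  have i'0 : fintype.lift ord_max i' = ord0 by apply: val_inj; rewrite /= (ord1 i').
  rewrite i'0 in tE tj *; have [-> ->] := tj ord_max isT; rewrite tE classM ?nz // poM ?nz //.
  by rewrite mulrzDr raddfD mulrzDl opprD addrACA.
- have [iE jE] : i = ord0 /\ j = ord_max.
    by case: i j ij {tij} => -[|[|//]] lti [[|[|//]] ltj] // _; split; apply: val_inj.
  move: tij; rewrite iE jE /tame_fun; set a := val (tnth t ord0); set b := val (tnth t ord_max).
  have [a0 b0] : a != 0 /\ b != 0 by split; apply: nz.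
  have pr c : pm p c -> qpi principal (cl (1 + c)) = 0 by move=> pc; apply: qpi0; exists c.
  have pr' (c d : K) : d != 0 -> d = 1 - c -> pm p c -> po p d = 0 /\ qpi principal (cl d) = 0.
    move=> d0 -> /pmN pc; have [_ ->] := pm_unit pc; split=> //; exact: pr.
  move=> ab; have aE : a = 1 - b by rewrite -ab addrK.
  have bE : b = 1 - a by rewrite -ab addrAC subrr add0r.
  case: (pmP p a0 b0 ab) => [pa|pb|[-> ->]|pb].
  - by have [-> ->] := pr' _ _ b0 bE pa; rewrite mul0rz mulr0z subrr.
  - by have [-> ->] := pr' _ _ a0 aE pb; rewrite mul0rz mulr0z subrr.
  - by rewrite !mulr0z subrr.
  have aE' : a = -1 * b * (1 - b^-1) by rewrite mulN1r mulNr mulrBr mulfV // mulr1 opprB.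
  have N10 : -1 != 0 :> K by rewrite oppr_eq0 oner_eq0.
  have [c0 pc] := pm_unit (pmN pb); have [h h0 hE] := N1_power.
  rewrite aE' !classM ?poM ?mulf_neq0 // pc poN1 add0r addr0 hE class_power // add0r.
  by have prb := pr _ (pmN pb); rewrite (raddfD (qpi principal)) /= prb addr0 subrr.
have : g (kM_mul (cl x) (cl y)) = 0 by rewrite xy raddf0.
rewrite /kM_class kM_mul_symbol gE /tame_fun !(tnth_nth (to_unit x)) /= !val_to_unit //.
rewrite py mulr0z subr0 => /(coprime_torsion (Wt _) px).
rewrite -(raddf0 (qpi principal)) => /qpiP; rewrite subr0 => /span_principal[a pa E].
have [a0 _] := pm_unit pa; have [h h0 hE] := class_eq y0 a0 E.
by exists h, a; rewrite mulrC.
Qed.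
End Tame.

Section NearOne.
Variables (ell : nat) (K : fieldType) (p : place K).

(** Membership in the group generated by l-th powers and 1 + m. The order of [h] is arbitrary, so
    the relation is stable under multiplication by any l-th power. *)
Definition near_one (x : K) := exists h a, [/\ h != 0, pm p a & x = h ^+ ell * (1 + a)].

Lemma near_one_div x y : near_one x -> near_one y -> near_one (x / y).
Proof.
move=> [h [a [h0 pa ->]]] [g [b [g0 pb ->]]].
have [c pc abE] := pm_div pa pb; exists (h / g), c; split=> //.
  by rewrite mulf_neq0 ?invr_eq0.
have [b0 _] := pm_unit pb.
rewrite abE expr_div_n -mulf_div; congr (_ * _).
by rewrite mulrAC divff ?mul1r.
Qed.

Lemma near_one_pm a : pm p a -> near_one (1 + a).
Proof. by move=> pa; exists 1, a; rewrite oner_neq0 expr1n mul1r. Qed.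

Lemma near_one1 : near_one 1.
Proof. by rewrite -(addr0 1); apply/near_one_pm/pm0. Qed.

Lemma near_oneV x : near_one x -> near_one x^-1.
Proof. by move=> /(near_one_div near_one1); rewrite div1r. Qed.

Lemma near_oneM x y : near_one x -> near_one y -> near_one (x * y).
Proof. by move=> x1 /near_oneV y1; rewrite -[y]invrK; apply: near_one_div. Qed.

Lemma near_one_power h : h != 0 -> near_one (h ^+ ell).
Proof. by move=> h0; exists h, 0; rewrite addr0 mulr1; split=> //; apply: pm0. Qed.
End NearOne.

Section FieldIdentities.
Variable L : fieldType.
Lemma ratio_sub (d d' n n' s : L) : d != 0 -> d' != 0 -> s != 0 ->
  (n / d - n' / d') / (s / d') = (n * d' - n' * d) / (d * s).
Proof. by move=> d0 d'0 s0; field; rewrite d0 d'0 s0. Qed.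

Lemma ratio_clear (h g b c d : L) : g != 0 -> d != 0 ->
  b * (h / g * (1 + c / d)) * (g * d) = b * (h * (d + c)).
Proof. by move=> g0 d0; field; rewrite g0 d0. Qed.
End FieldIdentities.

(* The valuation of the fraction field of B attached to a principal prime
   (pi) = ker eps, restricted to a subfield. *)
Section DVR.
Variables (B Bb : idomainType) (eps : {rmorphism B -> Bb}) (pi : B).
Variables (Q : fieldType) (fr : {rmorphism B -> Q}) (frP : is_frac fr).
Variables (K : fieldType) (iota : {rmorphism K -> Q}).
Local Notation "x %:F" := (fr x) : ring_scope.
Hypotheses (eps_pi : eps pi = 0) (pi_neq0 : pi != 0).
Hypothesis factor : forall a, a != 0 -> exists n b, a = pi ^+ n * b /\ eps b != 0.

Lemma eps_neq0 a : eps a != 0 -> a != 0.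
Proof. by apply: contraNneq => ->; rewrite rmorph0. Qed.

Lemma pi_power_uniq m n a b : eps a != 0 -> eps b != 0 ->
  pi ^+ m * a = pi ^+ n * b -> m = n.
Proof.
wlog lt_mn : m n a b / (m < n)%N.
  move=> W a0 b0 E; case: (ltngtP m n) => // lt; first exact: W E.
  by apply/esym/(W n m b a) => //; rewrite E.
move=> a0 b0; rewrite -(subnKC (ltnW lt_mn)) exprD -mulrA => /(mulfI (expf_neq0 _ pi_neq0)).
move/(congr1 eps); rewrite rmorphM rmorphXn eps_pi expr0n subn_eq0 leqNgt lt_mn mul0r.
by move/eqP; rewrite (negPf a0).
Qed.

Definition ratio_val (x : K) (m n : nat) (a b : B) :=
  [/\ eps a != 0, eps b != 0 & iota x = (pi ^+ m * a)%:F / (pi ^+ n * b)%:F].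

Lemma ratio_val_ex x : x != 0 -> exists mn : nat * nat, exists a b, ratio_val x mn.1 mn.2 a b.
Proof.
rewrite -(fmorph_eq0 iota) => x0; have [a [b [b0 E]]] := frP.2 (iota x).
have a0 : a != 0 by apply: contraNneq x0 => a0; rewrite E a0 rmorph0 mul0r.
have [m [a' [aE a'0]]] := factor a0; have [n [b' [bE b'0]]] := factor b0.
by exists (m, n), a', b'; split=> //; rewrite E aE bE.
Qed.

Lemma pi_mul_neq0 n a : eps a != 0 -> pi ^+ n * a != 0.
Proof. by move=> a0; rewrite mulf_neq0 ?expf_neq0 ?(eps_neq0 a0). Qed.

Lemma ratio_val_neq0 x m n a b : ratio_val x m n a b -> x != 0.
Proof.
move=> [a0 b0 E]; rewrite -(fmorph_eq0 iota) E.
by rewrite mulf_neq0 ?invr_eq0 ?(is_frac_eq0 frP) ?pi_mul_neq0.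
Qed.

Definition dvr_ord (x : K) : int :=
  if pselect (exists mn : nat * nat, exists a b, ratio_val x mn.1 mn.2 a b) is left h
  then let mn := sval (cid h) in mn.1%:Z - mn.2%:Z else 0.

Lemma dvr_ordE x m n a b : ratio_val x m n a b -> dvr_ord x = m%:Z - n%:Z.
Proof.
rewrite /dvr_ord => xE; case: pselect => [h|[]]; last by exists (m, n), a, b.
case: (cid h) => -[m' n'] /= [a' [b' [a'0 b'0 E']]]; case: xE => a0 b0 E.
have : pi ^+ (m' + n) * (a' * b) = pi ^+ (m + n') * (a * b').
  apply/eqP; rewrite -(is_frac_eq frP); apply/eqP.
  rewrite !exprD mulrACA [in RHS]mulrACA !(rmorphM fr (_ * _) (_ * _)).
  apply/eqP; rewrite -eqr_div ?(is_frac_eq0 frP) ?pi_mul_neq0 //.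
  by rewrite -E -E'.
by move/pi_power_uniq; rewrite !rmorphM !mulf_neq0 // => /(_ isT isT); lia.
Qed.

Definition dvr_max (x : K) := exists a b, [/\ eps a = 0, eps b != 0 & iota x = a%:F / b%:F].

Lemma dvr_ordM x y : x != 0 -> y != 0 -> dvr_ord (x * y) = dvr_ord x + dvr_ord y.
Proof.
move=> /ratio_val_ex[[m n] [a [b xE]]] /ratio_val_ex[[m' n'] [a' [b' yE]]] /=.
rewrite (dvr_ordE xE) (dvr_ordE yE) (@dvr_ordE _ (m + m') (n + n') (a * a') (b * b')) /=.
  by lia.
case: xE yE => /= a0 b0 xE [/= a'0 b'0 yE]; split; rewrite ?rmorphM ?mulf_neq0 //.
by rewrite xE yE mulf_div -!(rmorphM fr) !exprD; congr (_%:F / _%:F); rewrite mulrACA.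
Qed.

Lemma dvr_ord_pos x : x != 0 -> 0 < dvr_ord x -> dvr_max x.
Proof.
move=> /ratio_val_ex[[m n] [a [b xE]]]; rewrite (dvr_ordE xE) /= => lt_nm.
case: xE => /= a0 b0 xE; exists (pi ^+ (m - n) * a), b; split=> //.
  by rewrite rmorphM rmorphXn eps_pi expr0n subn_eq0 leqNgt (_ : (n < m)%N) ?mul0r //; lia.
rewrite xE; apply/eqP; rewrite eqr_div ?(is_frac_eq0 frP) ?pi_mul_neq0 ?eps_neq0 //.
rewrite -!(rmorphM fr) (is_frac_eq frP) [eqbRHS]mulrACA -exprD subnK ?mulrA //.
by rewrite ltnW //; lia.
Qed.

Lemma dvr_unit a : dvr_max a -> 1 + a != 0 /\ dvr_ord (1 + a) = 0.
Proof.
move=> [n [d [n0 d0 aE]]].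
have E : ratio_val (1 + a) 0 0 (d + n) d.
  split; rewrite ?rmorphD ?n0 ?addr0 // rmorph1 aE !expr0 !mul1r (rmorphD fr) mulrDl divff //.
  by rewrite (is_frac_eq0 frP) eps_neq0.
by split; [apply: ratio_val_neq0 E | rewrite (dvr_ordE E)].
Qed.

Lemma dvr_maxN a : dvr_max a -> dvr_max (- a).
Proof.
by move=> [n [d [n0 d0 aE]]]; exists (- n), d; rewrite !rmorphN n0 oppr0 aE mulNr.
Qed.

Lemma dvr_max_div a b : dvr_max a -> dvr_max b ->
  exists2 c, dvr_max c & 1 + a = (1 + b) * (1 + c).
Proof.
move=> am bm; have [b0 _] := dvr_unit bm.
exists ((a - b) / (1 + b)); last by rewrite mulrDr mulr1 [(1 + b) * _]mulrC divfK // -[in RHS]addrA [b + _]addrC subrK.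
move: am bm b0 => [n [d [n0 d0 aE]]] [n' [d' [n'0 d'0 bE]]] b0.
exists (n * d' - n' * d), (d * (d' + n')); split.
- by rewrite rmorphB !rmorphM n0 n'0 !mul0r subrr.
- by rewrite rmorphM rmorphD n'0 addr0 mulf_neq0.
have dF : d%:F != 0 by rewrite (is_frac_eq0 frP) eps_neq0.
have d'F : d'%:F != 0 by rewrite (is_frac_eq0 frP) eps_neq0.
have s0 : (d' + n')%:F != 0 by rewrite (is_frac_eq0 frP) eps_neq0 // rmorphD n'0 addr0.
rewrite rmorphM fmorphV rmorphB rmorphD rmorph1 aE bE.
have -> : 1 + n'%:F / d'%:F = (d' + n')%:F / d'%:F.
  by rewrite (rmorphD fr) mulrDl divff.
by rewrite (rmorphB fr) !(rmorphM fr); apply: ratio_sub.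
Qed.

Lemma dvr_max0 : dvr_max 0.
Proof. by exists 0, 1; rewrite !rmorph0 rmorph1 oner_neq0 mul0r. Qed.

Lemma dvr_ordV x : x != 0 -> dvr_ord x^-1 = - dvr_ord x.
Proof.
move=> x0; apply/eqP; rewrite -addr_eq0 -dvr_ordM ?invr_eq0 // mulVf //.
by have [_] := dvr_unit dvr_max0; rewrite addr0 => ->.
Qed.

Lemma dvr_ordN1 : dvr_ord (-1) = 0.
Proof.
have N10 : -1 != 0 :> K by rewrite oppr_eq0 oner_eq0.
have := dvr_ordM N10 N10; have [_] := dvr_unit dvr_max0; rewrite addr0 mulrNN mulr1 => ->.
by lia.
Qed.

Lemma dvr_maxP x y : x != 0 -> y != 0 -> x + y = 1 ->
  [\/ dvr_max x, dvr_max y, dvr_ord x = 0 /\ dvr_ord y = 0 | dvr_max y^-1].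
Proof.
move=> x0 y0 xy; case: (ltgtP 0 (dvr_ord y)) => [yp|yn|y_0].
- by constructor 2; apply: dvr_ord_pos.
- by constructor 4; apply: dvr_ord_pos; rewrite ?invr_eq0 // dvr_ordV // oppr_gt0.
case: (ltgtP 0 (dvr_ord x)) => [xp|xn|x_0].
- by constructor 1; apply: dvr_ord_pos.
- have /dvr_maxN /dvr_unit[u0 u1] : dvr_max x^-1.
    by apply: dvr_ord_pos; rewrite ?invr_eq0 // dvr_ordV // oppr_gt0.
  have N10 : -1 != 0 :> K by rewrite oppr_eq0 oner_eq0.
  have yE : y = -1 * x * (1 - x^-1).
    by rewrite mulN1r mulNr mulrBr mulfV // mulr1 opprB -xy addrAC subrr add0r.
  by move: xn; rewrite y_0 yE !dvr_ordM ?mulf_neq0 // u1 dvr_ordN1 add0r addr0 ltxx.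
by constructor 3.
Qed.

Definition dvr_place : place K :=
  Place dvr_ordM dvr_unit dvr_maxN dvr_max_div dvr_max0 dvr_maxP.

(** Since x has order 0, so has h, because l times its order vanishes; hence h has a residue f/g.
    The equation of residues is multiplied out, because only Bb and not its fraction field is at
    hand. *)
Lemma near_one_residue ell x a b : (0 < ell)%N -> near_one ell dvr_place x ->
  iota x = a%:F / b%:F -> eps a != 0 -> eps b != 0 ->
  exists h f g, [/\ iota h = f%:F / g%:F, eps f != 0, eps g != 0 &
    eps a * eps g ^+ ell = eps b * eps f ^+ ell].
Proof.
move=> l0 [h [c [h0 pc xE]]] iE a0 b0.
have [c0 cord] := dvr_unit pc.
have xord : dvr_ord x = 0 by rewrite (@dvr_ordE _ 0 0 a b) //; split; rewrite ?expr0 ?mul1r.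
have hord : dvr_ord h = 0.
  move: xord; rewrite xE dvr_ordM ?expf_neq0 // cord addr0 -[dvr_ord _]/(po dvr_place _).
  by rewrite poX // => /eqP; rewrite mulrn_eq0 eqn0Ngt l0 => /eqP.
have [[m n] [h1 [h2 hE]]] := ratio_val_ex h0.
have mn : m = n by move: hord; rewrite (dvr_ordE hE) /=; lia.
case: hE => /= h10 h20; rewrite mn => hE.
case: pc => [d [d' [d0 d'0 cE]]].
exists h, h1, h2; split=> //.
  rewrite hE !rmorphM -mulf_div divff ?mul1r //.
  by rewrite (is_frac_eq0 frP) expf_neq0.
have : a * (h2 ^+ ell * d') = b * (h1 ^+ ell * (d' + d)).
  apply/eqP; rewrite -(is_frac_eq frP); apply/eqP.
  have piF : pi%:F ^+ n != 0 by rewrite -(rmorphXn fr) (is_frac_eq0 frP) expf_neq0.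
  have bF : b%:F != 0 by rewrite (is_frac_eq0 frP) eps_neq0.
  have h2F : h2%:F != 0 by rewrite (is_frac_eq0 frP) eps_neq0.
  have d'F : d'%:F != 0 by rewrite (is_frac_eq0 frP) eps_neq0.
  have aE : a%:F = b%:F * ((h1%:F / h2%:F) ^+ ell * (1 + d%:F / d'%:F)).
    have := congr1 iota xE; rewrite rmorphM rmorphXn rmorphD rmorph1 iE hE cE.
    rewrite !(rmorphM fr) (rmorphXn fr) -mulf_div divff // mul1r => <-.
    by rewrite mulrC divfK.
  rewrite !rmorphM !rmorphXn aE (rmorphD fr) expr_div_n.
  by apply: ratio_clear; rewrite ?expf_neq0.
move/(congr1 eps); rewrite !rmorphM rmorphD d0 addr0 !rmorphXn !mulrA.
by move/(mulIf d'0).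
Qed.
End DVR.

(** * Degrees of elements in a simple algebraic extension *)

Section Degree.
Variables (F L : fieldType) (emb : {rmorphism F -> L}).
Local Notation "p ^e" := (map_poly emb p) (at level 2, format "p ^e").

Lemma modp_horner (P f : {poly F}) u : P^e.[u] = 0 -> ((f %% P)^e).[u] = f^e.[u].
Proof.
move=> Pu; rewrite [in RHS](divp_eq f P) rmorphD rmorphM hornerD hornerM /= Pu.
by rewrite mulr0 add0r.
Qed.

Lemma horner_rV n (g : {poly F}) u : (size g <= n)%N ->
  g^e.[u] = \sum_(i < n) emb (poly_rV g 0 i : F) * u ^+ i.
Proof.
move=> gn; rewrite (@horner_coef_wide _ n) ?(leq_trans (size_poly _ _)) //.
by apply: eq_bigr => i _; rewrite coef_map mxE.
Qed.

(** The n+1 powers of f modulo P lie in a space of dimension n; a vector in the left kernel of their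
    matrix is the required polynomial. *)
Lemma degree_le_adjoin n (P : {poly F}) (f : {poly F}) u : P != 0 -> (size P <= n.+1)%N ->
  P^e.[u] = 0 -> exists R : {poly F}, [/\ R != 0, (size R <= n.+1)%N & R^e.[f^e.[u]] = 0].
Proof.
move=> P0 Pn Pu.
pose g i := f ^+ i %% P; have gn i : (size (g i) <= n)%N.
  by rewrite -ltnS (leq_trans _ Pn) // ltn_modp.
pose M : 'M[F]_(n.+1, n) := \matrix_(i < n.+1) poly_rV (g i).
have K0 : kermx M != 0.
  rewrite -mxrank_eq0 mxrank_ker subn_eq0 -ltnNge ltnS; exact: rank_leq_col.
pose a := nz_row (kermx M); have a0 : a != 0 by rewrite nz_row_eq0.
have aM : a *m M = 0 by apply/sub_kermxP/nz_row_sub.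
exists (rVpoly a); split; first by rewrite -[a]rVpolyK in a0; apply: contraNneq a0 => ->; rewrite linear0.
  exact: size_poly.
rewrite (@horner_coef_wide _ n.+1) ?(leq_trans (size_poly _ _) (size_poly _ _)) //.
transitivity ((rVpoly (a *m M))^e.[u]); last by rewrite aM linear0 rmorph0 horner0.
rewrite [RHS](horner_rV (n := n)) ?size_poly // rVpolyK.
transitivity (\sum_(i < n.+1) \sum_(j < n) emb (a 0 i * M i j) * u ^+ j).
  apply: eq_bigr => i _; rewrite coef_map coef_rVpoly_ord /=.
  transitivity (emb (a 0 i) * (g i)^e.[u]).
    by rewrite modp_horner // rmorphXn horner_exp.
  rewrite (horner_rV _ (gn i)) mulr_sumr; apply: eq_bigr => j _.
  by rewrite rmorphM mulrA !mxE.
rewrite exchange_big /=; apply: eq_bigr => j _.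
by rewrite mxE rmorph_sum mulr_suml.
Qed.

(** Equality of dimensions: the first n powers of u are independent modulo P, so their coordinate
    matrix is invertible and the variable itself is a combination of them. *)
Lemma degree_adjoin_eq n (P g : {poly F}) u v :
  (forall R : {poly F}, R != 0 -> R^e.[u] = 0 -> (n < size R)%N) ->
  P != 0 -> (size P <= n.+1)%N -> P^e.[v] = 0 -> u = g^e.[v] ->
  exists f : {poly F}, v = f^e.[u].
Proof.
move=> u_min P0 Pn Pv uE.
have hn (h : {poly F}) : (size (h %% P)%R <= n)%N by rewrite -ltnS (leq_trans _ Pn) // ltn_modp.
pose M : 'M[F]_n := \matrix_(i < n) poly_rV (g ^+ i %% P).
have row_comb (b : 'rV[F]_n) : (rVpoly b)^e.[u] = (rVpoly (b *m M))^e.[v].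
  rewrite !(horner_rV (n := n)) ?size_poly // !rVpolyK.
  transitivity (\sum_(i < n) \sum_(j < n) emb (b 0 i * M i j) * v ^+ j).
    apply: eq_bigr => i _; transitivity (emb (b 0 i) * ((g ^+ i %% P)^e).[v]).
      by rewrite modp_horner // rmorphXn horner_exp uE.
    rewrite (horner_rV _ (hn _)) mulr_sumr; apply: eq_bigr => j _.
    by rewrite rmorphM mulrA !mxE.
  rewrite exchange_big /=; apply: eq_bigr => j _.
  by rewrite mxE rmorph_sum mulr_suml.
have Mu : M \in unitmx.
  rewrite -row_free_unit; apply/inj_row_free => b bM.
  have [//|b0] := eqVneq (rVpoly b) 0; first by move/(congr1 (@poly_rV F n)); rewrite rVpolyK linear0.
  have := u_min _ b0; rewrite row_comb bM linear0 rmorph0 horner0 => /(_ erefl).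
  by rewrite ltnNge size_poly.
exists (rVpoly (poly_rV ('X %% P) *m invmx M)).
rewrite row_comb mulmxKV // poly_rV_K ?hn // modp_horner //.
by rewrite map_polyX hornerX.
Qed.
End Degree.

(** Since [eps] is not defined on a/b, the equation is homogenised before it is reduced. *)
Lemma horner_ratio (B Bb : idomainType) (Q : fieldType) (fr : {rmorphism B -> Q})
    (eps : {rmorphism B -> Bb}) (P : {poly B}) a b x : is_frac fr ->
  eps b != 0 -> eps a = x * eps b -> (map_poly fr P).[fr a / fr b] = 0 ->
  (map_poly eps P).[x] = 0.
Proof.
move=> frP b0 ax Pab; pose n := size P.
pose H := \sum_(i < n) P`_i * (a ^+ i * b ^+ (n - i)).
have bF : fr b != 0 by rewrite (is_frac_eq0 frP); apply: contraNneq b0 => ->; rewrite rmorph0.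
have H0 : H = 0.
  apply/eqP; rewrite -(is_frac_eq0 frP); apply/eqP.
  transitivity (fr b ^+ n * (map_poly fr P).[fr a / fr b]); last by rewrite Pab mulr0.
  rewrite (@horner_coef_wide _ n) ?size_poly // mulr_sumr rmorph_sum.
  apply: eq_bigr => i _; rewrite coef_map !rmorphM !rmorphXn expr_div_n /=.
  rewrite [RHS]mulrCA; congr (_ * _); rewrite [RHS]mulrCA; congr (_ * _).
  by apply: (canRL (mulfK _)); rewrite ?expf_neq0 // -exprD subnK // ltnW.
apply: (mulfI (expf_neq0 n b0)); rewrite mulr0.
transitivity (eps H); last by rewrite H0 rmorph0.
rewrite (@horner_coef_wide _ n) ?size_poly // mulr_sumr rmorph_sum.
apply: eq_bigr => i _; rewrite coef_map !rmorphM !rmorphXn ax exprMn /=.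
rewrite [LHS]mulrCA; congr (_ * _); rewrite -mulrA -exprD subnKC 1?mulrC //.
exact: ltnW.
Qed.

Section SpecFactor.
Variable N : fieldType.
Local Notation B := (fps {poly N}).
Local Notation A := {poly {poly N}}.

Definition pi_at (e : N) : B := fconst ('X - e%:P).

Lemma pi_at_neq0 e : pi_at e != 0.
Proof. by rewrite fconst_eq0 polyXsubC_eq0. Qed.

Lemma spec_fpsC (e : N) (p : {poly N}) : spec_fps e (fconst p) = fconst p.[e].
Proof. by rewrite -[LHS]/(map_fps (spec e) (fconst _)) map_fpsC. Qed.

Lemma spec_pi_at e : spec_fps e (pi_at e) = 0.
Proof. by rewrite spec_fpsC hornerXsubC subrr; apply: rmorph0. Qed.

Lemma divp_XsubC (q : {poly N}) e : q.[e] = 0 -> q = ('X - e%:P) * (q %/ ('X - e%:P)).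
Proof. by move=> qe; rewrite mulrC divpK // dvdp_XsubCl; apply/rootP. Qed.

Lemma size_divp_XsubC (q : {poly N}) e : q != 0 -> (size (q %/ ('X - e%:P))%R < size q)%N.
Proof.
move=> q0; rewrite size_divp ?polyXsubC_eq0 // size_XsubC subn1.
by rewrite prednK // size_poly_gt0.
Qed.

(** A series specialises to 0 exactly when all its coefficients are divisible by X - e. One fixed
    nonzero coefficient loses degree at each division, so the division stops. *)
Lemma spec_factor e (a : B) : a != 0 ->
  exists n b, a = pi_at e ^+ n * b /\ spec_fps e b != 0.
Proof.
move=> a0; have [i ai] : exists i, a`[i] != 0.
  apply: contrapT => na; case/eqP: a0; apply: fpsP => i.
  by apply/eqP/negP => /negP ai; apply: na; exists i.
have [m] := ubnP (size a`[i]); elim: m a ai {a0} => // m IHm a ai; rewrite ltnS => sa.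
have [sa0|] := eqVneq (spec_fps e a) 0; last by exists 0%N, a; rewrite mul1r.
pose a' : B := Fps (fun j => a`[j] %/ ('X - e%:P)).
have aE : a = pi_at e * a'.
  apply: fpsP => j; rewrite fcoefCM; apply: divp_XsubC.
  exact: (congr1 (fun f : fps N => f`[j]) sa0).
have a'i : a'`[i] != 0 by apply: contraNneq ai => a'i; rewrite aE fcoefCM a'i mulr0.
have [|n [b [a'E b0]]] := IHm a' a'i.
  by rewrite (leq_trans _ sa) //; apply: size_divp_XsubC.
by exists n.+1, b; rewrite exprS -mulrA -a'E.
Qed.

Lemma spec_primitive e (R : {poly A}) : R != 0 -> exists d R', d != 0 /\ R = d%:P%:P * R' /\
  map_poly (spec_poly e) R' != 0.
Proof.
move=> R0; pose i := (size R).-1; pose j := (size (lead_coef R)).-1.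
have Rij : R`_i`_j != 0 by rewrite -/(lead_coef (lead_coef R)) !lead_coef_eq0.
have [m] := ubnP (size (R`_i`_j)%R); move: (i) (j) Rij => {}i {}j.
elim: m R {R0} => // m IHm R Rij; rewrite ltnS => sR.
have [sR0|] := eqVneq (map_poly (spec_poly e) R) 0; last first.
  by exists 1, R; rewrite oner_neq0 mul1r.
pose R' : {poly A} := \poly_(i < size R) \poly_(j < size R`_i) (R`_i`_j %/ ('X - e%:P)).
have R'E i' j' : R'`_i'`_j' = R`_i'`_j' %/ ('X - e%:P).
  rewrite coef_poly; case: ltnP => [_|le]; last by rewrite coef0 [R`_i']nth_default // coef0 div0p.
  by rewrite coef_poly; case: ltnP => // le; rewrite [R`_i'`_j']nth_default // div0p.
have RE : R = ('X - e%:P)%:P%:P * R'.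
  apply/polyP => i'; apply/polyP => j'; rewrite !coefCM R'E; apply: divp_XsubC.
  have := congr1 (fun P : {poly {poly N}} => P`_i'`_j') sR0.
  by rewrite !coef_map !coef0.
have R'ij : R'`_i`_j != 0 by apply: contraNneq Rij => R'ij; rewrite RE !coefCM R'ij mulr0.
have [|d [R2 [d0 [R2E R20]]]] := IHm R' R'ij.
  by rewrite (leq_trans _ sR) // R'E; apply: size_divp_XsubC.
exists (('X - e%:P) * d), R2; rewrite mulf_neq0 ?polyXsubC_eq0 //; do !split=> //.
by rewrite RE R2E mulrA !polyCM.
Qed.
End SpecFactor.

(** The orders in s agree, and after scaling by the lowest coefficients [fps_root_uniq] applies. *)
Lemma fps_power_eq (N : fieldType) l (f g : fps N) : (0 < l)%N -> l%:R != 0 :> N ->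
  g != 0 -> f ^+ l = g ^+ l -> exists z, f = fconst z * g.
Proof.
move=> l0 lN g0 fg; have f0 : f != 0.
  by have := expf_neq0 l g0; rewrite -fg expf_eq0 l0.
have [i [f' [fE f'0]]] := fps_order f0; have [j [g' [gE g'0]]] := fps_order g0.
have c0 (h : fps N) m : (fX N ^+ m * h)`[m] = h`[0] by rewrite fcoefXnM ltnn subnn.
have cl (h : fps N) m m' : (m' < m)%N -> (fX N ^+ m * h)`[m'] = 0 by rewrite fcoefXnM => ->.
have E : fX N ^+ (i * l) * f' ^+ l = fX N ^+ (j * l) * g' ^+ l.
  by rewrite !exprM -!exprMn -fE -gE.
have ij : i = j.
  have [lt|lt|/eqP] := ltngtP (i * l)%N (j * l)%N; last by rewrite eqn_pmul2r // => /eqP.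
    by have /eqP := cl (g' ^+ l) _ _ lt; rewrite -E c0 fcoefXn0 expf_eq0 (negPf f'0) andbF.
  by have /eqP := cl (f' ^+ l) _ _ lt; rewrite E c0 fcoefXn0 expf_eq0 (negPf g'0) andbF.
exists (f'`[0] / g'`[0]); rewrite fE gE ij mulrCA; congr (_ * _).
have E' : f' ^+ l = g' ^+ l by apply: (mulfI (fXn_neq0 N (j * l))); rewrite -{1}ij E.
apply: (@fps_root_uniq _ l) => //; first by rewrite fcoefCM divfK.
  by rewrite fcoefCM divfK.
rewrite exprMn -E' -rmorphXn expr_div_n.
have -> : f'`[0] ^+ l / g'`[0] ^+ l = 1.
  by rewrite -!fcoefXn0 E' divff // fcoefXn0 expf_neq0.
by rewrite rmorph1 mul1r.
Qed.

(** * Elements that are fibrewise l-th powers *)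

Section NormalizedPower.
Variables (l : nat) (k N K : fieldType) (c : {rmorphism k -> N}) (jN : {rmorphism N -> K}).
Local Notation B := (fps {poly N}).
Local Notation A := {poly {poly N}}.
Variables (Q FA : fieldType) (fr : {rmorphism B -> Q}) (fa : {rmorphism A -> FA}).
Variables (emb : {rmorphism FA -> Q}) (iota : {rmorphism K -> Q}) (t s y0 : K) (y : B).
Hypotheses (l_gt0 : (0 < l)%N) (l_neq0 : l%:R != 0 :> N) (k_inf : infinite_set (fun _ : k => True)).
Hypotheses (frP : is_frac fr) (faP : is_frac fa).
Hypothesis embE : forall a, emb (fa a) = fr (series _ a).
Hypotheses (iota_j : forall v, iota (jN v) = fr (fconst v%:P))
  (iota_t : iota t = fr (fconst 'X)) (iota_s : iota s = fr (fX _))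
  (iota_y : iota y0 = fr y).
Hypothesis gen : forall x, exists f, iota x = (map_poly emb f).[fr y].
Hypothesis sep : exists q, separable_poly q /\ root (map_poly emb q) (fr y).

Definition place_at (e : N) : place K :=
  dvr_place frP iota (spec_pi_at e) (pi_at_neq0 e) (@spec_factor N e).

Lemma image_A (a : A) : exists x, iota x = fr (series _ a).
Proof.
have img_poly (q : {poly N}) : exists x, iota x = fr (fconst q).
  elim/poly_ind: q => [|q v [x xE]]; first by exists 0; rewrite !rmorph0.
  by exists (x * t + jN v); rewrite rmorphD rmorphM xE iota_t iota_j -rmorphM -rmorphD -rmorphM -rmorphD.
elim/poly_ind: a => [|a q [x xE]]; first by exists 0; rewrite !rmorph0.
have [z zE] := img_poly q; exists (x * s + z).
have -> : series _ (a * 'X + q%:P) = series _ a * fX _ + fconst q.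
  by rewrite rmorphD rmorphM; congr (_ * _ + _); [apply: fps_of_polyX | apply: fps_of_polyC].
by rewrite rmorphD rmorphM xE iota_s zE -rmorphM -rmorphD.
Qed.

Lemma image_adjoin (f : {poly FA}) : exists x, iota x = (map_poly emb f).[fr y].
Proof.
elim/poly_ind: f => [|f v [x xE]]; first by exists 0; rewrite !rmorph0 horner0.
have [a [b [b0 ->]]] := faP.2 v.
have [xa aE] := image_A a; have [xb bE] := image_A b.
exists (x * y0 + xa / xb); rewrite rmorphD rmorphM fmorph_div xE iota_y aE bE.
rewrite rmorphD rmorphM /= map_polyC map_polyX hornerMXaddC /=.
by rewrite (fmorph_div emb) !embE.
Qed.

Lemma fr_series (P : {poly A}) b : fr (seval b P) = (map_poly emb (map_poly fa P)).[fr b].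
Proof.
rewrite sevalE -horner_map /= -!map_poly_comp; congr (_.[_]).
by apply: eq_map_poly => a /=; rewrite embE.
Qed.

Lemma clear_annihilator n (R : {poly FA}) b : R != 0 -> (size R <= n)%N ->
  (map_poly emb R).[b] = 0 -> exists R' : {poly A}, [/\ R' != 0, (size R' <= n)%N
     & (map_poly emb (map_poly fa R')).[b] = 0].
Proof.
move=> R0 Rn Rb; have [d [R' [d0 R'E]]] := frac_clear faP R.
have fa0 : fa d != 0 by rewrite (is_frac_eq0 faP).
exists R'; rewrite -R'E; split.
- apply: contraNneq R0 => R'0; move/eqP: R'E; rewrite R'0 rmorph0 scaler_eq0.
  by rewrite (negPf fa0).
- suff <- : size (map_poly fa R') = size R' by rewrite -R'E size_scale.
  exact/size_map_inj_poly/rmorph0/faP.1.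
by rewrite map_polyZ hornerZ Rb mulr0.
Qed.

Definition fibre_power (e : N) (V W : B) := exists h f g,
  [/\ iota h = fr f / fr g, spec_fps e f != 0, spec_fps e g != 0 &
      spec_fps e V * spec_fps e g ^+ l = spec_fps e W * spec_fps e f ^+ l].

(** Let z be the l-th root of W with constant term 1, n the degree of y over FA, and th = lam y - z.
    On each fibre z agrees, up to a constant of N, with the residue of an element of K, so th is
    there the residue of an element of K = FA(y) and has degree at most n. By [algebraic_series] th
    has degree at most n over FA. Since y lies in FA(th), the fields FA(th) and FA(y) coincide, so z
    comes from K. *)
Lemma normalized_power w W (E : k -> Prop) : iota w = fr W -> W`[0] = 1 ->
  infinite_set E -> (forall e, E e -> fibre_power (c e) W 1) ->
  exists h, w = h ^+ l.
Proof.
move=> wW W0 Ei wE.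
have lu : (l%:R : {poly N}) \is a GRing.unit.
  by rewrite -polyC_natr poly_unitE size_polyC l_neq0 coefC eqxx unitfE l_neq0.
have [z z0 zW] := fps_root1 lu W0.
have [q [q_sep qy]] := sep.
pose ann m := `[< exists R : {poly FA}, [/\ R != 0, (map_poly emb R).[fr y] = 0 & size R = m.+1] >].
have q0 := separable_poly_neq0 q_sep.
have /ex_minnP[n /asboolP[P [P0 Py Pn]] n_min] : exists m, ann m.
  exists (size q).-1; apply/asboolP; exists q; split=> //; first exact/rootP.
  by rewrite prednK // size_poly_gt0.
have y_min (R : {poly FA}) : R != 0 -> (map_poly emb R).[fr y] = 0 -> (n < size R)%N.
  move=> R0 Ry; have : (n <= (size R).-1)%N.
    by apply: n_min; apply/asboolP; exists R; rewrite prednK // size_poly_gt0.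
  by rewrite -ltnS prednK // size_poly_gt0.
have y_alg : algebraicOver emb (fr y) by exists q.
have w_alg : algebraicOver emb (fr W).
  have [f fE] := gen w; rewrite -wW fE; apply/integral_algebraic/integral_horner.
    by move=> x /(nthP 0)[i _ <-]; rewrite coef_map; apply: integral_id.
  exact/integral_algebraic.
have z_alg : algebraicOver emb (fr z).
  apply/integral_algebraic; apply: (@integral_root_monic _ _ _ (fr z) ('X^l - (fr W)%:P)).
  - exact: monicXnsubC.
  - by rewrite rootE !hornerE -rmorphXn zW subrr.
  move=> x /(nthP 0)[i _ <-]; rewrite coefB coefXn coefC.
  apply: integral_sub; first by case: eqP => _; [apply: integral1 | apply: integral0].
  by case: eqP => _; [apply/integral_algebraic | apply: integral0].
have [pz pz0 pzz] := z_alg.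
have [r r0 rP] := large_field_PET pz0 pzz qy q_sep.
pose em : {rmorphism k -> Q} := emb \o (fa \o (polyC \o (polyC \o c))).
(* Almost every lam in k makes th a primitive element for y and z together. *)
have [lam [_ lamr] _] := infinite_set_nonroot (fmorph_inj em) r0 k_inf [::].
pose lc : FA := fa (c lam)%:P%:P.
have [g1z g1y] := rP lc lamr.
pose th : B := fconst (c lam)%:P * y - z.
have thE : fr th = emb lc * fr y - fr z.
  by rewrite rmorphB rmorphM embE [series _ _]fps_of_polyC.
rewrite -thE in g1z g1y.
have th_alg : algebraicOver emb (fr th).
  by rewrite thE; apply: algebraic_sub => //; apply: algebraic_mul => //; apply: algebraic_id.
have [P1 P10 P1th] := th_alg.
have [P2 [P20 _ P2th]] := clear_annihilator P10 (leqnn _) (rootP P1th).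
have {P2th} P2th : seval th P2 = 0.
  by apply/eqP; rewrite -(is_frac_eq0 frP) fr_series P2th.
have E'i : infinite_set (fun x : N => exists2 e, E e & x = c e).
  exact: infinite_set_image (fmorph_inj c) Ei.
have [|R [R0 Rn Rth]] := @algebraic_series N _ th P2 n.+1 E'i P20 P2th.
  move=> _ [e Ee ->].
  have [h [f [g [hE f0 g0 fgE]]]] := wE e Ee.
  rewrite [in RHS]rmorph1 mul1r in fgE.
  have [zeta zE] : exists zeta, spec_fps (c e) z * spec_fps (c e) g = fconst zeta * spec_fps (c e) f.
    by apply: (@fps_power_eq _ l) => //; rewrite exprMn -rmorphXn zW.
  (* This element of K has residue th on the fibre; the constant zeta corrects the choice of the
     l-th root. *)
  pose x := jN (c lam) * y0 - jN zeta * h.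
  pose num : B := fconst (c lam)%:P * y * g - fconst zeta%:P * f.
  have g0' : fr g != 0 by rewrite (is_frac_eq0 frP); apply: contraNneq g0 => ->; rewrite rmorph0.
  have xE : iota x = fr num / fr g.
    rewrite rmorphB !rmorphM !iota_j iota_y hE rmorphB !rmorphM mulrBl mulfK //.
    by rewrite mulrA.
  have numE : spec_fps (c e) num = spec_fps (c e) th * spec_fps (c e) g.
    rewrite rmorphB !rmorphM (rmorphB (spec_fps (c e))) !rmorphM mulrBl zE; congr (_ - _ * _).
    by rewrite spec_fpsC hornerC.
  have [fx fxE] := gen x.
  have [S [S0 Sn Sx]] : exists S : {poly FA}, [/\ S != 0, (size S <= n.+1)%N & (map_poly emb S).[(map_poly emb fx).[fr y]] = 0].
    by apply: (degree_le_adjoin fx P0 _ Py); rewrite Pn.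
  rewrite -fxE xE in Sx.
  have [S1 [S10 S1n S1x]] := clear_annihilator S0 Sn Sx.
  (* The annihilator may vanish identically at X = e; its factors X - e are removed before
     specialising. *)
  have [d [S2 [d0 [S2E S20]]]] := spec_primitive (c e) S10.
  exists (map_poly (spec_poly (c e)) S2); split=> //.
    rewrite (leq_trans (size_poly _ _)) // (leq_trans _ S1n) // S2E.
    by rewrite size_Cmul ?polyC_eq0.
  have -> : seval (spec_fps (c e) th) (map_poly (spec_poly (c e)) S2)
          = (map_poly (spec_fps (c e)) (map_poly (series _) S2)).[spec_fps (c e) th].
    rewrite sevalE -!map_poly_comp; congr (_.[_]).
    by apply: eq_map_poly => a /=; rewrite -spec_series.
  apply: (horner_ratio frP g0 numE).
  have fd0 : emb (fa d%:P) != 0 by rewrite fmorph_eq0 (is_frac_eq0 faP) polyC_eq0.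
  apply: (mulfI fd0); rewrite mulr0 -[RHS]S1x S2E !rmorphM /= !map_polyC hornerM hornerC; congr (_ * _).
  by rewrite -!map_poly_comp; congr (_.[_]); apply: eq_map_poly => a /=; rewrite embE.
have RF0 : map_poly fa R != 0.
  by rewrite -size_poly_eq0 size_map_inj_poly ?rmorph0 ?size_poly_eq0 //; apply: faP.1.
have [f fE] : exists f, fr th = (map_poly emb f).[fr y].
  have [g gE] := g1y.
  apply: (@degree_adjoin_eq _ _ emb n (map_poly fa R) g) => //.
    by rewrite size_map_inj_poly ?rmorph0 //; apply: faP.1.
  by rewrite -fr_series Rth rmorph0.
have [h hE] := image_adjoin (lc *: 'X - f).
exists h; apply: (fmorph_inj iota); rewrite wW rmorphXn hE.
rewrite (rmorphB (map_poly emb)) /= map_polyZ /= map_polyX hornerD hornerN hornerZ hornerX -fE thE opprB addrC subrK.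
by rewrite -rmorphXn zW.
Qed.
End NormalizedPower.

Lemma is_frac_ext (R : idomainType) (L L' : fieldType) (f : {rmorphism R -> L})
    (g : {rmorphism R -> L'}) : is_frac f -> injective g ->
  exists F : {rmorphism L -> L'}, forall a, F (f a) = g a.
Proof.
move=> fP gI; apply: frac_lift => [a|x].
  by split=> /eqP; rewrite ?(is_frac_eq0 fP) ?raddf_eq0 // => /eqP ->; rewrite rmorph0.
have [a [b [b0 ->]]] := fP.2 x; exists a, b; split=> //.
by rewrite (is_frac_eq0 fP).
Qed.

Lemma fX_order_uniq (R : idomainType) m n (a b : fps R) : a`[0] != 0 -> b`[0] != 0 ->
  fX R ^+ m * a = fX R ^+ n * b -> m = n /\ a = b.
Proof.
move=> a0 b0 E; have mn : m = n.
  by apply: (pi_power_uniq (eps := @fcoef_0 R) _ (fX_neq0 R) a0 b0 E).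
by split=> //; apply: (mulfI (fXn_neq0 R m)); rewrite E mn.
Qed.

(* Polynomials in the parameter t, with coefficients in N, evaluate to elements
   of K, which the embedding iota reads as constant power series in s. *)
Section Chart.
Variables (k N K : fieldType) (jk : {rmorphism k -> K}) (c : {rmorphism k -> N}).
Local Notation B := (fps {poly N}).
Local Notation A := {poly {poly N}}.
Variables (Q FA : fieldType) (fr : {rmorphism B -> Q}) (fa : {rmorphism A -> FA}).
Variables (emb : {rmorphism FA -> Q}).
Hypotheses (frP : is_frac fr) (faP : is_frac fa).
Hypothesis embE : forall a, emb (fa a) = fr (series _ a).

Record chart := Chart {
  cj : {rmorphism N -> K}; ct : K; cs : K; cy0 : K; cy : B; ci : {rmorphism K -> Q};
  cjc : forall x, cj (c x) = jk x;
  ci_j : forall v, ci (cj v) = fr (fconst v%:P);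
  ci_t : ci ct = fr (fconst 'X);
  ci_s : ci cs = fr (fX _);
  ci_y : ci cy0 = fr cy;
  c_gen : forall x, exists f, ci x = (map_poly emb f).[fr cy];
  c_sep : exists q, separable_poly q /\ root (map_poly emb q) (fr cy) }.

Definition place_of (ch : chart) (e : N) : place K := place_at (ci ch) frP e.
Definition polyt (ch : chart) (p : {poly N}) : K := (map_poly (cj ch) p).[ct ch].

Lemma ci_polyt ch p : ci ch (polyt ch p) = fr (fconst p).
Proof.
rewrite /polyt; elim/poly_ind: p => [|p v IHp]; first by rewrite map_poly0 horner0 !rmorph0.
rewrite (rmorphD (map_poly _)) (rmorphM (map_poly _)) /= map_polyX map_polyC hornerMXaddC.
by rewrite rmorphD rmorphM IHp ci_t ci_j -rmorphM -rmorphD -rmorphM -rmorphD.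
Qed.

Lemma polyt_eq0 ch p : (polyt ch p == 0) = (p == 0).
Proof. by rewrite -(fmorph_eq0 (ci ch)) ci_polyt (is_frac_eq0 frP) fconst_eq0. Qed.

Lemma polyt_map ch (a : {poly k}) : polyt ch (map_poly c a) = (map_poly jk a).[ct ch].
Proof.
rewrite /polyt -map_poly_comp; congr (_.[_]).
by apply: eq_map_poly => x /=; apply: cjc.
Qed.

Lemma polytM ch p q : polyt ch (p * q) = polyt ch p * polyt ch q.
Proof. by rewrite /polyt rmorphM hornerM. Qed.

(** Changes of coordinates in N[X][[s]]. T must respect polynomials in s, through [TA], so that
    generation and separability over FA carry over. It is used to rescale s and to substitute an
    affine form for X. *)
Lemma chart_map (ch : chart) (T : {rmorphism B -> B}) (TA : {rmorphism A -> A}) :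
  injective T -> (forall a, T (series _ a) = series _ (TA a)) ->
  (forall v, T (fconst v%:P) = fconst v%:P) ->
  exists F : {rmorphism Q -> Q}, (forall b, F (fr b) = fr (T b)) /\
    forall t' s', F (ci ch t') = fr (fconst 'X) -> F (ci ch s') = fr (fX _) ->
    exists ch', [/\ cj ch' = cj ch, ct ch' = t' & forall x, ci ch' x = F (ci ch x)].
Proof.
move=> TI TTA TC.
have TAI : injective TA.
  move=> a b /(congr1 (series _)); rewrite -!TTA => /TI; exact: fps_of_poly_inj.
have [F FE] : exists F : {rmorphism Q -> Q}, forall b, F (fr b) = (fr \o T) b.
  by apply: is_frac_ext => // x y /frP.1 /TI.
have [G GE] : exists G : {rmorphism FA -> FA}, forall a, G (fa a) = (fa \o TA) a.
  by apply: is_frac_ext => // x y /faP.1 /TAI.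
have FG x : F (emb x) = emb (G x).
  have [a [b [b0 ->]]] := faP.2 x.
  by rewrite (fmorph_div emb) (fmorph_div F) (fmorph_div G) (fmorph_div emb) !GE /= !embE !FE /= !TTA.
have FG' p : map_poly (F \o emb) p = map_poly emb (map_poly G p).
  by rewrite -map_poly_comp; apply: eq_map_poly => x /=; rewrite FG.
exists F; split=> // t' s' t'E s'E.
have gen x : exists f, (F \o ci ch) x = (map_poly emb f).[fr (T (cy ch))].
  have [f fE] := c_gen ch x; exists (map_poly G f).
  by rewrite /= fE -horner_map -FG' map_poly_comp /= FE.
have sep : exists q, separable_poly q /\ root (map_poly emb q) (fr (T (cy ch))).
  have [q [qs qy]] := c_sep ch; exists (map_poly G q); rewrite separable_map; split=> //.
  rewrite -FG' map_poly_comp /= -[fr _](FE (cy ch)) rootE horner_map fmorph_eq0.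
  exact: qy.
have jE v : (F \o ci ch) (cj ch v) = fr (fconst v%:P) by rewrite /= ci_j FE /= TC.
have yE : (F \o ci ch) (cy0 ch) = fr (T (cy ch)) by rewrite /= ci_y FE.
by exists (Chart (cjc ch) jE t'E s'E yE gen sep).
Qed.
End Chart.

Lemma cross_power (F : fieldType) (D a0 a2 b0 b2 a u v : F) l : (0 < l)%N ->
  D != 0 -> b0 != 0 -> b2 != 0 -> a != 0 -> u != 0 -> v != 0 ->
  a0 * b0 ^+ l.-1 * v ^+ l = a * u ^+ l ->
  (D ^+ l * (a0 * a2)) / (b0 * b2) = a2 / b2 * (a * (D * (u / (v * b0))) ^+ l).
Proof.
case: l => // l _ D0 b00 b20 a_0 u0 v0 E.
rewrite exprMn expr_div_n [a * (_ * _)]mulrCA [a * (_ / _)]mulrA -E !exprMn.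
have := expf_neq0 l.+1 v0; have := expf_neq0 l b00; rewrite [b0 ^+ l.+1]exprS.
move: (D ^+ l.+1) (v ^+ l.+1) (b0 ^+ l) => P V W W0 V0.
by field; rewrite b20 W0 b00 V0.
Qed.

Lemma cross_quot (F : fieldType) (x y X u v b r : F) : y != 0 -> X != 0 -> u != 0 ->
  v != 0 -> b != 0 -> r != 0 ->
  x / y / (X * (u / (v * b)) * r) = x * (v * b) / (y * (u * r) * X).
Proof.
by move=> y0 X0 u0 v0 b0 r0; field; rewrite y0 X0 u0 v0 b0 r0.
Qed.

Lemma cross_fibre (R : idomainType) (D a0 a2 b0 b2 g2 a u v r G f : R) l : (0 < l)%N ->
  b0 != 0 -> b2 * g2 = 1 -> a0 * b0 ^+ l.-1 * v ^+ l = a * u ^+ l -> a = r ^+ l ->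
  (D ^+ l * (a0 * a2)) * G ^+ l = (b0 * b2) * f ^+ l ->
  a2 * g2 * (G * (u * r) * D) ^+ l = (f * (v * b0)) ^+ l.
Proof.
case: l => // l _ b00 bg E aE E2; apply: (mulfI b00).
have b20 : b2 != 0 by apply: contra_eq_neq bg => ->; rewrite mul0r eq_sym oner_eq0.
apply: (mulfI b20); rewrite !exprMn -aE [b0 ^+ l.+1]exprS.
have -> : b2 * (b0 * (a2 * g2 * (G ^+ l.+1 * (u ^+ l.+1 * a) * D ^+ l.+1)))
        = (b2 * g2) * b0 * (a * u ^+ l.+1) * (a2 * G ^+ l.+1 * D ^+ l.+1).
  by move: (G ^+ l.+1) (u ^+ l.+1) (D ^+ l.+1) => *; ring.
rewrite bg -E.
have -> : 1 * b0 * (a0 * b0 ^+ l * v ^+ l.+1) * (a2 * G ^+ l.+1 * D ^+ l.+1)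
        = b0 ^+ l * v ^+ l.+1 * b0 * (D ^+ l.+1 * (a0 * a2) * G ^+ l.+1).
  by move: (G ^+ l.+1) (b0 ^+ l) (D ^+ l.+1) (v ^+ l.+1) => *; ring.
by rewrite E2; move: (f ^+ l.+1) (b0 ^+ l) (v ^+ l.+1) => *; ring.
Qed.

Section RescaleRing.
Variable R : idomainType.
Variable c0 : R.

Lemma series_rescale (p : {poly R}) :
  rescale_fps c0 (series _ p) = series _ (p \Po (c0 *: 'X)).
Proof.
elim/poly_ind: p => [|p v IHp]; first by rewrite comp_poly0 !rmorph0.
rewrite comp_polyD comp_polyM comp_polyX comp_polyC !rmorphD !rmorphM -IHp; congr (_ * _ + _).
  apply: fpsP => n /=; rewrite coefX coefZ coefX.
  by case: n => [|[|n]] /=; rewrite ?mul0r ?mulr0 // mulr1 mul1r expr1.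
by apply: fpsP => -[|n] /=; rewrite !coefC /= ?expr0 ?mulr1 ?mul0r.
Qed.

Lemma rescale_unit (a : fps R) b0 : c0 = a`[0] * b0 ->
  exists a2, a2`[0] = 1 /\ rescale_fps c0 a = fconst a`[0] * a2.
Proof.
move=> c0E; exists (Fps (fun n => if n is m.+1 then a`[n] * b0 * c0 ^+ m else 1)).
split=> //; apply: fpsP => n; rewrite fcoefCM /=.
by case: n => [|n]; rewrite ?expr0 // exprS {1}c0E; move: (c0 ^+ n) => *; ring.
Qed.

Lemma rescale_fpsC q : rescale_fps c0 (fconst q) = fconst q.
Proof. by apply: fpsP => -[|n] /=; rewrite ?mulr1 ?mul0r. Qed.

Lemma rescale_fpsX : rescale_fps c0 (fX R) = fX R * fconst c0.
Proof.
rewrite mulrC; apply: fpsP => n; rewrite fcoefCM /=.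
by case: n => [|[|n]] /=; rewrite ?mulr0 ?mul0r // mulr1 mul1r expr1.
Qed.

Lemma rescale_fpsXnM i (a : fps R) :
  rescale_fps c0 (fX R ^+ i * a) = (fX R * fconst c0) ^+ i * rescale_fps c0 a.
Proof. by rewrite -rescale_fpsX -rmorphXn -rmorphM. Qed.

Lemma rescale_fpsMXn n (a b : fps R) :
  rescale_fps c0 (a * b ^+ n) = rescale_fps c0 a * rescale_fps c0 b ^+ n.
Proof. by rewrite -rmorphXn -rmorphM. Qed.
End RescaleRing.

Section FibrePowers.
Variables (k N K : fieldType) (jk : {rmorphism k -> K}) (c : {rmorphism k -> N}).
Local Notation B := (fps {poly N}).
Local Notation A := {poly {poly N}}.
Variables (Q FA : fieldType) (fr : {rmorphism B -> Q}) (fa : {rmorphism A -> FA}).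
Variables (emb : {rmorphism FA -> Q}).
Hypotheses (frP : is_frac fr) (faP : is_frac fa).
Hypothesis embE : forall a, emb (fa a) = fr (series _ a).
Variable l : nat.
Hypotheses (l_gt0 : (0 < l)%N) (l_neq0 : l%:R != 0 :> N).
Hypotheses (k_root : forall x : k, exists y, x = y ^+ l) (c_pure : pure_ext l c).
Notation chart := (chart jk c fr emb).

Lemma spec_fps_neq0 e (a : B) : a`[0].[e] != 0 -> spec_fps e a != 0.
Proof. by apply: contraNneq => /(congr1 (fun f => f`[0])) /= E; apply/eqP. Qed.

Lemma spec_rescale e c0 (a : B) :
  spec_fps e (rescale_fps c0 a) = rescale_fps c0.[e] (spec_fps e a).
Proof. by apply: fpsP => n /=; rewrite /horner_eval hornerM horner_exp. Qed.

(* The leading coefficient of w is constant modulo l-th powers, so that rescaling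
   s reduces to normalized_power. *)
Lemma fibrewise_power (ch : chart) w (E : k -> Prop) : w != 0 -> infinite_set E ->
  (forall e, E e -> near_one l (place_of frP ch (c e)) w) ->
  exists (a : {poly k}) h, [/\ a != 0, h != 0 & w = (map_poly jk a).[ct ch] * h ^+ l].
Proof.
move=> w0 Ei wE.
have l1 : (l.-1 < l)%N by rewrite prednK.
have fr0 b : (fr b == 0) = (b == 0) := is_frac_eq0 frP b.
have s0 : cs ch != 0 by rewrite -(fmorph_eq0 (ci ch)) ci_s fr0 fX_neq0.
have [al [be [be0 wab]]] := frP.2 (ci ch w).
have al0 : al != 0.
  by apply: contraNneq w0 => al0; rewrite -(fmorph_eq0 (ci ch)) wab al0 rmorph0 mul0r.
have [j [be' [beE be'0]]] := fps_order be0.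
have [i [al' [alE al'0]]] : exists n (b : B), al * fX _ ^+ (l.-1 * j) = fX _ ^+ n * b /\ b`[0] != 0.
  by apply: fps_order; rewrite mulf_neq0 ?fXn_neq0.
(* Multiplying by the l-th power of s^j moves the power of s from the denominator to the
   numerator. *)
pose w2 := w * cs ch ^+ (l * j).
have w2E : ci ch w2 = fr (fX _ ^+ i * al') / fr be'.
  rewrite rmorphM rmorphXn wab ci_s -alE beE !rmorphM -rmorphXn.
  have -> : (l * j = l.-1 * j + j)%N by rewrite -mulSnr prednK.
  rewrite exprD rmorphM; have := fXn_neq0 {poly N} j; have : be' != 0.
    by apply: contraNneq be'0 => ->.
  rewrite -!fr0; move: (fr be') (fr (_ ^+ j)) (fr (_ ^+ _)) (fr al) => x y z u x0 y0.
  by field; rewrite x0 y0.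
set a0 := al'`[0] in al'0; set b0 := be'`[0] in be'0.
(* Rescaling s by the product makes numerator and denominator, by [rescale_unit], divisible by their
   leading coefficients a0 and b0 at the same time. *)
pose c0 := a0 * b0; have c00 : c0 != 0 by rewrite mulf_neq0.
have cI := fmorph_inj c.
have E1i := infinite_set_nonroot cI c00 Ei.
set E1 := (fun e : k => _) in E1i.
have al2_0 e : E1 e -> spec_fps (c e) (fX _ ^+ i * al') != 0.
  case=> _; rewrite hornerM mulf_eq0 => /norP[h _]; rewrite rmorphM rmorphXn mulf_neq0 //.
    by rewrite [spec_fps _ _]map_fpsX fXn_neq0.
  exact: spec_fps_neq0.
have be2_0 e : E1 e -> spec_fps (c e) be' != 0.
  by case=> _; rewrite hornerM mulf_eq0 => /norP[_ h]; apply: spec_fps_neq0.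
have resE e : E1 e -> exists h f g, [/\ ci ch h = fr f / fr g, spec_fps (c e) f != 0,
   spec_fps (c e) g != 0 & spec_fps (c e) (fX _ ^+ i * al') * spec_fps (c e) g ^+ l
     = spec_fps (c e) be' * spec_fps (c e) f ^+ l].
  move=> Ee; have nw2 : near_one l (place_of frP ch (c e)) w2.
    have -> : w2 = w * (cs ch ^+ j) ^+ l by rewrite -exprM mulnC.
    apply: near_oneM; first exact/wE/Ee.1.
    by apply: near_one_power; rewrite expf_neq0.
  exact: (near_one_residue l_gt0 nw2 w2E (al2_0 e Ee) (be2_0 e Ee)).
(* Lowest terms in s on the fibre: the order i is a multiple of l, and a0 / b0, which is a0 b0^(l-1)
   modulo l-th powers, becomes an l-th power at e. This is the input for purity. *)
have lead e : E1 e -> exists m v, i = (m * l)%N /\ (a0 * b0 ^+ l.-1).[c e] = v ^+ l.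
  move=> Ee; have [h [f [g [_ f0 g0 fgE]]]] := resE e Ee.
  have [p [f' [fE f'0]]] := fps_order f0; have [q [g' [gE g'0]]] := fps_order g0.
  have [] : (i + q * l)%N = (p * l)%N /\
      spec_fps (c e) al' * g' ^+ l = spec_fps (c e) be' * f' ^+ l.
    move: Ee.2; rewrite hornerM mulf_eq0 => /norP[a0e b0e].
    have al0e : (spec_fps (c e) al')`[0] != 0 := a0e.
    have be0e : (spec_fps (c e) be')`[0] != 0 := b0e.
    have al0g : (spec_fps (c e) al' * g' ^+ l)`[0] != 0.
      by rewrite fcoefM0 fcoefXn0 (mulf_neq0 al0e) ?expf_neq0.
    have be0f : (spec_fps (c e) be' * f' ^+ l)`[0] != 0.
      by rewrite fcoefM0 fcoefXn0 (mulf_neq0 be0e) ?expf_neq0.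
    apply: (fX_order_uniq al0g be0f).
    rewrite exprD !(exprM _ _ l) mulrACA -exprMn -gE [RHS]mulrCA -exprMn -fE -fgE.
    by rewrite rmorphM rmorphXn [spec_fps _ (fX _)]map_fpsX.
  move=> ipq E3; have E2 : a0.[c e] * g'`[0] ^+ l = b0.[c e] * f'`[0] ^+ l.
    by have := congr1 (@fcoef_0 _) E3; rewrite /fcoef_0 !fcoefM0 !fcoefXn0.
  exists (p - q)%N, (b0.[c e] * f'`[0] / g'`[0]).
  split; first by rewrite mulnBl -ipq addnK.
  rewrite hornerM horner_exp expr_div_n exprMn.
  apply: (mulIf (expf_neq0 l g'0)); rewrite divfK ?expf_neq0 //.
  by rewrite mulrAC E2 mulrAC -exprS prednK.
have [m iE] : exists m, i = (m * l)%N.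
  by have [e Ee _] := E1i [::]; have [m [v []]] := lead e Ee; exists m.
have ab0 : a0 * b0 ^+ l.-1 != 0 by rewrite mulf_neq0 ?expf_neq0.
have [|a [u [v [a_0 u0 v0 auvE]]]] := c_pure ab0 E1i.
  by move=> e Ee; have [_ [v [_ vE]]] := lead e Ee; exists v.
pose ca := map_poly c a; have ca0 : ca != 0 by rewrite map_poly_eq0.
have TA p : (rescale_fps c0 : {rmorphism B -> B}) (series _ p) =
    series _ ((fun p : A => p \Po (c0 *: 'X)) p) by exact: series_rescale.
have TC q : rescale_fps c0 (fconst q) = fconst q := rescale_fpsC c0 q.
have TX : rescale_fps c0 (fX _) = fX _ * fconst c0 := rescale_fpsX c0.
have [F [FE chF]] := chart_map frP faP embE ch (@rescale_fps_inj _ c0 c00) TA (fun v => TC v%:P).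
have {}FE b : F (fr b) = fr (rescale_fps c0 b) := FE b.
(* In the new chart the element s / c0(t) is read as s. *)
have [||ch' [cjE ctE ciE]] := chF (ct ch) (cs ch / polyt ch c0).
- by rewrite ci_t FE TC.
- rewrite !fmorph_div ci_s ci_polyt // !FE TX TC rmorphM mulfK //.
  by rewrite fr0 fconst_eq0.
have [al3 [al30 al3E]] := @rescale_unit _ c0 al' b0 erefl.
have [be3 [be30 be3E]] := @rescale_unit _ c0 be' a0 (mulrC _ _).
have [ga ga0 gaE] := fps_inv1 be30.
(* H is an l-th root of the leading term of w2 up to the factor [polyt ch ca]: D takes care of the
   power of s, and u / (v b0) of the leading coefficient. The quotient w1 has constant term 1 in the
   new chart. *)
pose D := cs ch ^+ m; pose H := D * (polyt ch u / (polyt ch v * polyt ch b0)).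
pose w1 := w2 / (polyt ch ca * H ^+ l).
have pt0 p : p != 0 -> polyt ch p != 0 by rewrite polyt_eq0.
have D0 : D != 0 by rewrite expf_neq0.
have H0 : H != 0 by rewrite !mulf_neq0 ?invr_eq0 ?mulf_neq0 ?pt0.
have ac0 : polyt ch ca * H ^+ l != 0 by rewrite mulf_neq0 ?expf_neq0 ?pt0.
pose X := fr (fX _ * fconst c0).
have FP p : F (ci ch (polyt ch p)) = fr (fconst p) by rewrite ci_polyt // FE TC.
have FD : F (ci ch D) = X ^+ m by rewrite rmorphXn rmorphXn ci_s FE TX.
have frc0 p : p != 0 -> fr (fconst p) != 0 by rewrite fr0 fconst_eq0.
have X0 : X ^+ m != 0 by rewrite expf_neq0 // /X rmorphM mulf_neq0 ?frc0 ?fr0 ?fX_neq0.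
have frbe3 : fr be3 != 0.
  by rewrite fr0; apply: contra_eq_neq gaE => ->; rewrite mul0r eq_sym oner_eq0.
have frE : fr (fconst a0) * fr (fconst b0) ^+ l.-1 * fr (fconst v) ^+ l = fr (fconst ca) * fr (fconst u) ^+ l.
  by rewrite -!rmorphXn -!rmorphM auvE.
have Tal : rescale_fps c0 (fX _ ^+ i * al') = (fX _ * fconst c0) ^+ i * (fconst a0 * al3).
  by rewrite rescale_fpsXnM al3E.
have FW : F (ci ch w2) = (X ^+ m) ^+ l * (fr (fconst a0) * fr al3) / (fr (fconst b0) * fr be3).
  rewrite w2E fmorph_div !FE Tal be3E iE !rmorphM.
  rewrite rmorphXn exprM. by rewrite /X !rmorphM.
have HE : F (ci ch H) = X ^+ m * (fr (fconst u) / (fr (fconst v) * fr (fconst b0))).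
  rewrite rmorphM rmorphM FD; congr (_ * _).
  by rewrite !fmorph_div -polytM !FP -rmorphM -rmorphM.
have FH : F (ci ch (polyt ch ca * H ^+ l)) = fr (fconst ca) * (X ^+ m * (fr (fconst u) / (fr (fconst v) * fr (fconst b0)))) ^+ l.
  by rewrite (rmorphM (ci ch)) (rmorphM F) FP !rmorphXn HE.
have w1E : ci ch' w1 = fr (al3 * ga).
  rewrite ciE (fmorph_div (ci ch)) (fmorph_div F) FW.
  rewrite (cross_power (fr al3) l_gt0 X0 (frc0 _ be'0) frbe3 (frc0 _ ca0) (frc0 _ u0) (frc0 _ v0) frE).
  rewrite -FH mulfK ?fmorph_eq0 //; apply: (mulIf frbe3); rewrite divfK // -rmorphM.
  by rewrite -mulrA (mulrC ga) gaE mulr1.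
have uvc0 : u * v * ca != 0 by rewrite !mulf_neq0.
have E2i := infinite_set_nonroot cI uvc0 E1i.
set E2 := (fun e : k => _) in E2i.
have fibre e : E2 e -> fibre_power l fr (ci ch') (c e) (al3 * ga) 1.
  case=> Ee; rewrite !hornerM !mulf_eq0 => /norP[/norP[ue ve] ce].
  have [h [f [g [hE f0 g0 fgE]]]] := resE e Ee.
  case: Ee => _; rewrite hornerM mulf_eq0 => /norP[a0e b0e].
  have [r rE] := k_root a.[e].
  have r0 : c r != 0.
    by apply: contraNneq ce => cr; rewrite /ca horner_map /= rE rmorphXn cr expr0n gtn_eqF.
  (* On the fibre w2 has l-th root h and the value of a at e is r^l, so this is an l-th root of
     w1. *)
  exists (h / (H * cj ch (c r))).
  exists (rescale_fps c0 f * fconst (v * b0)).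
  exists (rescale_fps c0 g * fconst (u * (c r)%:P) * (fX _ * fconst c0) ^+ m).
  have sr x : spec_fps (c e) x != 0 -> spec_fps (c e) (rescale_fps c0 x) != 0.
    move=> x0; rewrite spec_rescale raddf_eq0 //; apply: rescale_fps_inj.
    by rewrite hornerM mulf_neq0.
  have specX : spec_fps (c e) (fX _) = fX _ by rewrite [LHS]map_fpsX.
  have specXc0 : spec_fps (c e) ((fX _ * fconst c0) ^+ m) != 0.
    rewrite rmorphXn rmorphM specX spec_fpsC expf_neq0 // mulf_neq0 ?fX_neq0 //.
    by rewrite fconst_eq0 hornerM mulf_neq0.
  have sc q : q.[c e] != 0 -> spec_fps (c e) (fconst q) != 0 by rewrite spec_fpsC fconst_eq0.
  have fr_neq0 x : spec_fps (c e) x != 0 -> fr x != 0.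
    by rewrite fr0; apply: contraNneq => ->; rewrite rmorph0.
  have rC0 : (c r)%:P.[c e] != 0 by rewrite hornerC.
  have fcM p q : fconst (p * q) = fconst p * fconst q :> B := rmorphM (@fconst _) p q.
  have frM a b : fr (a * b) = fr a * fr b := rmorphM fr a b.
  split.
  - rewrite ciE (fmorph_div (ci ch)) (fmorph_div F) hE (fmorph_div F) !FE.
    rewrite (rmorphM (ci ch)) (rmorphM F) HE ci_j FE TC (frM (rescale_fps c0 f)) (frM (rescale_fps c0 g * _)).
    rewrite (frM (rescale_fps c0 g)) (fcM v) (fcM u) (frM (fconst v)) (frM (fconst u)) (rmorphXn fr) -/X.
    by apply: cross_quot; rewrite ?X0 ?frc0 // ?fr_neq0 ?sr // polyC_eq0.
  - by rewrite rmorphM mulf_neq0 ?sr ?sc // hornerM mulf_neq0.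
  - rewrite rmorphM mulf_neq0 // rmorphM mulf_neq0 ?sr ?sc // hornerM mulf_neq0 //.
  rewrite (fcM v) (fcM u) !(rmorphM (spec_fps (c e))) (rmorph1 (spec_fps (c e))) mul1r.
  apply: (cross_fibre l_gt0 (sc _ b0e) (a0 := spec_fps (c e) (fconst a0)) (b2 := spec_fps (c e) be3) (a := spec_fps (c e) (fconst ca))).
  - by rewrite -rmorphM gaE rmorph1.
  - by rewrite -!rmorphXn -!rmorphM auvE.
  - rewrite !spec_fpsC hornerC /ca horner_map /= rE rmorphXn.
    exact: (rmorphXn (@fconst N)).
  rewrite -(rmorphXn (spec_fps (c e))) -exprM -iE -!(rmorphM (spec_fps (c e))) -Tal -be3E.
  by rewrite !spec_rescale -!rescale_fpsMXn fgE.
have W0 : (al3 * ga)`[0] = 1 by rewrite fcoefM0 al30 ga0 mulr1.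
have k_inf : infinite_set (fun _ : k => True) by apply: infinite_set_sub Ei.
have [h' h'E] := normalized_power l_gt0 l_neq0 k_inf frP faP embE (ci_j ch') (ci_t ch')
  (ci_s ch') (ci_y ch') (@c_gen _ _ _ _ _ _ _ _ _ ch') (c_sep ch') w1E W0 E2i fibre.
have wE2 : w = (map_poly jk a).[ct ch] * (H * h' / cs ch ^+ j) ^+ l.
  rewrite -polyt_map -/ca expr_div_n exprMn -h'E /w1 -exprM (mulnC j).
  rewrite mulrA [polyt ch ca * (_ * _)]mulrA mulrCA divff // mulr1 /w2 mulfK //.
  by rewrite expf_neq0.
exists a, (H * h' / cs ch ^+ j); split=> //.
by apply: contraNneq w0 => hh; rewrite wE2 hh expr0n gtn_eqF // mulr0.
Qed.
End FibrePowers.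

(** * Transcendence degree *)

Section Subfield.
Variables (E : fieldType) (S : divringClosed E).
Record subf := Subf { subf_val : E; _ : subf_val \in S }.
HB.instance Definition _ := [isSub for subf_val].
HB.instance Definition _ := [Choice of subf by <:].
HB.instance Definition _ := [SubChoice_isSubIntegralDomain of subf by <:].
HB.instance Definition _ := [SubIntegralDomain_isSubField of subf by <:].
Definition subf_inj : {rmorphism subf -> E} := val.

Lemma subf_polyOver (p : {poly E}) : p \is a polyOver S ->
  exists q, p = map_poly subf_inj q.
Proof.
move=> /polyOverP pS; exists (map_poly (insubd 0) p); apply/polyP => j.
rewrite coef_map coef_map_id0 /=; last by apply: val_inj; rewrite insubdK ?rpred0.
by rewrite insubdK.
Qed.

Lemma polyOver_subf (q : {poly subf}) : map_poly subf_inj q \is a polyOver S.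
Proof. by apply/polyOverP => j; rewrite coef_map; apply: valP. Qed.
End Subfield.

Section Closure.
Variables (F E : fieldType) (i : {rmorphism F -> E}).
Local Notation adj := (adjoin i).

Lemma adjoin_divring s : divring_closed (adj s).
Proof.
split=> [|x y /asboolP xS /asboolP yS|x y /asboolP xS /asboolP yS]; apply/asboolP => L iL sL.
- exact: rpred1.
- by rewrite rpredB ?xS ?yS.
- by rewrite rpred_div ?xS ?yS.
Qed.
HB.instance Definition _ s := GRing.isDivringClosed.Build E (adj s) (adjoin_divring s).

Lemma adjoin_const s c : i c \in adj s.
Proof. by apply/asboolP => L iL _; apply: iL. Qed.

Lemma adjoin_mem s x : x \in s -> x \in adj s.
Proof. by move=> xs; apply/asboolP => L _ sL; apply: sL. Qed.

Lemma adjoin_min (L : divringClosed E) s : (forall c, i c \in L) -> {subset s <= L} ->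
  {subset adj s <= L}.
Proof. by move=> iL sL x /asboolP; apply. Qed.

Lemma adjoin_mono s s' : {subset s <= adj s'} -> {subset adj s <= adj s'}.
Proof. by move=> ss'; apply: adjoin_min => // c; apply: adjoin_const. Qed.

Definition acl s x := exists2 p : {poly E}, p \is a polyOver (adj s) & p != 0 /\ root p x.

Lemma aclP s x : acl s x <-> algebraicOver (subf_inj (adj s)) x.
Proof.
split=> [[p /subf_polyOver[q ->]]|[q q0 qx]].
  by rewrite map_poly_eq0 => -[q0 qx]; exists q.
by exists (map_poly (subf_inj (adj s)) q); rewrite ?polyOver_subf // map_poly_eq0.
Qed.

Lemma acl_adjoin s x : x \in adj s -> acl s x.
Proof. by move=> xs; apply/aclP; exact: (algebraic_id (subf_inj (adj s)) (Subf xs)). Qed.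

Definition acl_pred s : {pred E} := fun x => `[< acl s x >].
Lemma acl_divring s : divring_closed (acl_pred s).
Proof.
split=> [|x y /asboolP/aclP xS /asboolP/aclP yS|x y /asboolP/aclP xS /asboolP/aclP yS];
  apply/asboolP.
- by apply/acl_adjoin/rpred1.
- by apply/aclP/algebraic_sub.
- by apply/aclP/algebraic_div.
Qed.
HB.instance Definition _ s := GRing.isDivringClosed.Build E (acl_pred s) (acl_divring s).

Lemma acl_trans s s' x : (forall y, y \in s -> acl s' y) -> acl s x -> acl s' x.
Proof.
move=> ss' [p /polyOverP ps [p0 px]].
have sub : {subset adj s <= acl_pred s'}.
  apply: adjoin_min => [c|y ys]; apply/asboolP; last exact: ss'.
  exact/acl_adjoin/adjoin_const.
apply/aclP/integral_algebraic; apply: (integral_root p0 px) => y /(nthP 0)[j _ <-].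
by apply/integral_algebraic/aclP/asboolP/sub.
Qed.

Lemma acl_mem s x : x \in s -> acl s x.
Proof. by move=> /adjoin_mem/acl_adjoin. Qed.

Lemma acl_mono s s' x : {subset s <= s'} -> acl s x -> acl s' x.
Proof. by move=> ss'; apply: acl_trans => y /ss' /acl_mem. Qed.

Section Image.
Variables (M : fieldType) (h : {rmorphism M -> E}).
Definition image_pred : {pred E} := fun z => `[< exists u, z = h u >].

Lemma image_divring : divring_closed image_pred.
Proof.
split=> [|_ _ /asboolP[u ->] /asboolP[v ->]|_ _ /asboolP[u ->] /asboolP[v ->]];
  apply/asboolP.
- by exists 1; rewrite rmorph1.
- by exists (u - v); rewrite rmorphB.
- by exists (u / v); rewrite fmorph_div.
Qed.
HB.instance Definition _ := GRing.isDivringClosed.Build E image_pred image_divring.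

Lemma adjoin_image s : (forall c, exists u, i c = h u) ->
  (forall x, x \in s -> exists u, x = h u) -> forall x, x \in adj s -> exists u, x = h u.
Proof.
move=> ih sh x xs; apply/asboolP; move: x xs; apply: (adjoin_min (L := image_pred)).
  by move=> c; apply/asboolP.
by move=> x xs; apply/asboolP/sh.
Qed.

Lemma polyOver_image s (p : {poly E}) : (forall x, x \in adj s -> exists u, x = h u) ->
  p \is a polyOver (adj s) -> exists q, p = map_poly h q.
Proof.
move=> sh /polyOverP ps; have /choice[g gE] z : exists u, z \in adj s -> z = h u.
  by have [/sh[u uE]|_] := boolP (z \in adj s); [exists u | exists 0].
exists (\poly_(j < size p) g p`_j).
apply/polyP => j; rewrite coef_map coef_poly; case: ltnP => [_|le]; first exact/gE.
by rewrite raddf0 nth_default.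
Qed.
End Image.

Lemma acl_clear (R : idomainType) (ev : {rmorphism R -> E}) s x : injective ev ->
  (forall c, exists r, i c = ev r) -> (forall y, y \in s -> exists r, y = ev r) ->
  acl s x -> exists q : {poly R}, q != 0 /\ (map_poly ev q).[x] = 0.
Proof.
move=> evI iR sR [p pS [p0 px]]; have [h hE] := frac_ext evI.
have sub : forall y, y \in adj s -> exists u, y = h u.
  by apply: adjoin_image => [c|y /sR[r ->]]; [have [r ->] := iR c|]; exists r%:F; rewrite hE.
have [q pE] := polyOver_image sub pS; rewrite {}pE in p0 px.
have [d [r [d0 rE]]] := frac_clear (@tofrac_is_frac _) q.
exists r; split.
  apply: contraNneq p0 => r0; move/eqP: rE; rewrite r0 rmorph0 scaler_eq0.
  by rewrite (is_frac_eq0 (@tofrac_is_frac _)) (negPf d0) => /eqP ->; rewrite rmorph0.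
rewrite -(eq_map_poly hE) map_poly_comp -rE map_polyZ hornerZ.
by rewrite (rootP px) mulr0.
Qed.

(** Steinitz exchange. With y transcendental over s, a relation for x over s and y is a polynomial
    in two variables; swapping them gives one for y over s and x, which is nonzero because x is
    transcendental over s. *)
Lemma acl_exchange s x y : acl (y :: s) x -> ~ acl s x -> acl (x :: s) y.
Proof.
have [ys _ _|ys] := pselect (acl s y).
  by apply: acl_mono ys => z zs; rewrite inE zs orbT.
move=> [p pS [p0 px]] xs; pose si := subf_inj (adj s).
have trans z (q : {poly subf (adj s)}) : ~ acl s z -> (map_poly si q).[z] = 0 -> q = 0.
  move=> zs qz; apply/eqP/negP => /negP q0; apply: zs; apply/aclP; exists q => //.
  exact/rootP.
have evI : injective (horner_eval y \o map_poly si).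
  by apply: raddf_inj => q /= qy; apply: (trans y).
have hC u : (map_poly si u%:P).[y] = si u by rewrite map_polyC hornerC.
have [|z|r [r0 rx]] := acl_clear evI _ _ (ex_intro2 _ _ p pS (conj p0 px)).
- by move=> c; exists (Subf (adjoin_const s c))%:P; rewrite -[RHS]/((map_poly si _%:P).[y]) hC.
- rewrite inE => /orP[/eqP->|zs].
    by exists 'X; rewrite -[RHS]/((map_poly si 'X).[y]) map_polyX hornerX.
  by exists (Subf (adjoin_mem zs))%:P; rewrite -[RHS]/((map_poly si _%:P).[y]) hC.
pose r' : {poly {poly E}} := map_poly (map_poly si) r.
have swap u v (w : {poly {poly E}}) : (map_poly (horner_eval u) w).[v] = (map_poly (horner_eval v) (swapXY w)).[u].
  by rewrite -!horner_swapXY swapXYK horner2_swapXY.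
pose hx : {rmorphism {poly subf (adj s)} -> E} := horner_eval x \o map_poly si.
exists (map_poly hx (swapXY r)).
  apply/polyOverP => j; rewrite (coef_map hx) /= /horner_eval rpred_horner ?adjoin_mem ?mem_head //.
  apply/polyOverP => m; rewrite (coef_map si) /=.
  have : val ((swapXY r)`_j)`_m \in adj s by apply: valP.
  by apply: adjoin_mono => z zs; rewrite adjoin_mem // inE zs orbT.
split.
  apply: contraNneq r0 => G0; suff : swapXY r = 0 by move/eqP; rewrite swapXY_eq0.
  apply/polyP => j; rewrite coef0; apply: (trans x) => //.
  by have := congr1 (fun p : {poly E} => p`_j) G0; rewrite (coef_map hx) coef0.
apply/rootP; rewrite map_poly_comp /= -(swapXY_map si) -swap -rx.
by rewrite [in RHS]map_poly_comp.
Qed.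
End Closure.

(** * Polynomials in several variables and transcendence *)

Section MpolyFacts.
Variables (n : nat) (R : comNzRingType).

Lemma mpoly_ext (S : comNzRingType) (f g : {rmorphism {mpoly R[n]} -> S}) :
  (forall c, f c%:MP = g c%:MP) -> (forall j, f 'X_j = g 'X_j) -> f =1 g.
Proof.
move=> fgC fgX p; rewrite (mpolyE p) !rmorph_sum; apply: eq_bigr => m _.
rewrite -mul_mpolyC !rmorphM fgC; congr (_ * _).
rewrite mpolyXE_id !rmorph_prod; apply: eq_bigr => j _.
by rewrite !rmorphXn fgX.
Qed.
End MpolyFacts.
Section Univariate.
Variables (n : nat) (F : fieldType).
Definition mwid : {rmorphism {mpoly F[n]} -> {mpoly F[n.+1]}} :=
  mmap (@mpolyC n.+1 F) (fun j => 'X_(fintype.lift ord_max j)).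
Definition mmulti_last : {rmorphism {poly {mpoly F[n]}} -> {mpoly F[n.+1]}} :=
  horner_eval 'X_ord_max \o map_poly mwid.
Definition uni_var (j : 'I_n.+1) : {poly {mpoly F[n]}} :=
  if unlift ord_max j is Some j' then ('X_j')%:P else 'X.
Definition muni_last : {rmorphism {mpoly F[n.+1]} -> {poly {mpoly F[n]}}} :=
  mmap (polyC \o @mpolyC n F) uni_var.

Lemma mwidX j : mwid 'X_j = 'X_(fintype.lift ord_max j).
Proof. by rewrite [LHS]mmapX mmap1U. Qed.
Lemma mwidC c : mwid c%:MP = c%:MP.
Proof. by rewrite [LHS]mmapC. Qed.
Lemma muni_lastC c : muni_last c%:MP = c%:MP%:P.
Proof. by rewrite [LHS]mmapC. Qed.
Lemma muni_last_max : muni_last 'X_ord_max = 'X.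
Proof. by rewrite [LHS]mmapX mmap1U /uni_var unlift_none. Qed.
Lemma muni_last_lift j : muni_last 'X_(fintype.lift ord_max j) = ('X_j)%:P.
Proof. by rewrite [LHS]mmapX mmap1U /uni_var liftK. Qed.
Lemma mmulti_lastC p : mmulti_last p%:P = mwid p.
Proof. by change ((map_poly mwid p%:P).['X_ord_max] = mwid p); rewrite map_polyC hornerC. Qed.
Lemma mmulti_lastX : mmulti_last 'X = 'X_ord_max.
Proof. by change ((map_poly mwid 'X).['X_ord_max] = 'X_ord_max); rewrite map_polyX hornerX. Qed.

Lemma muni_lastK : cancel muni_last mmulti_last.
Proof.
apply: (@mpoly_ext _ _ _ (mmulti_last \o muni_last) idfun) => [c|j].
  by change (mmulti_last (muni_last c%:MP) = c%:MP); rewrite muni_lastC mmulti_lastC mwidC.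
change (mmulti_last (muni_last 'X_j) = 'X_j).
case: (unliftP ord_max j) => [j'|] ->.
  by rewrite muni_last_lift mmulti_lastC mwidX.
by rewrite muni_last_max mmulti_lastX.
Qed.

Lemma mmulti_lastK : cancel mmulti_last muni_last.
Proof.
have widK : muni_last \o mwid =1 polyC.
  apply: (@mpoly_ext _ _ _ (muni_last \o mwid) polyC) => [c|j].
    by change (muni_last (mwid c%:MP) = c%:MP%:P); rewrite mwidC muni_lastC.
  by change (muni_last (mwid 'X_j) = ('X_j)%:P); rewrite mwidX muni_last_lift.
elim/poly_ind => [|p c IHp]; first by rewrite !rmorph0.
rewrite rmorphD rmorphM rmorphD rmorphM IHp mmulti_lastX muni_last_max mmulti_lastC.
by congr (_ + _); apply: widK.
Qed.
End Univariate.
Arguments muni_last {n F}.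
Arguments mmulti_last {n F}.

Lemma mmap_last n (F : fieldType) (E : comNzRingType) (i : {rmorphism F -> E}) (X : 'I_n.+1 -> E) p :
  mmap i X p = (map_poly (mmap i (fun j => X (fintype.lift ord_max j))) (muni_last p)).[X ord_max].
Proof.
set Y := fun _ => _; pose g : {rmorphism {mpoly F[n]} -> E} := mmap i Y.
have gX c : (map_poly g c%:P).[X ord_max] = g c by rewrite map_polyC hornerC.
apply: (@mpoly_ext _ _ _ (mmap i X) (horner_eval (X ord_max) \o (map_poly g \o @muni_last n F))) => [c|j].
  change (mmap i X c%:MP = (map_poly g (muni_last c%:MP)).[X ord_max]).
  by rewrite mmapC muni_lastC gX [RHS]mmapC.
change (mmap i X 'X_j = (map_poly g (muni_last 'X_j)).[X ord_max]).
rewrite mmapX mmap1U; case: (unliftP ord_max j) => [j'|] ->.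
  by rewrite muni_last_lift gX [RHS]mmapX mmap1U.
by rewrite muni_last_max map_polyX hornerX.
Qed.

Lemma mpoly_nonroot n (F : fieldType) (p : {mpoly F[n]}) : infinite_field F -> p != 0 ->
  exists v : 'I_n -> F, mmap idfun v p != 0.
Proof.
move=> Finf; elim: n p => [|n IHn] p p0.
  exists (fun=> 0); apply: contraNneq p0 => E.
  suff -> : p = (mmap idfun (fun=> 0 : F) p)%:MP by rewrite E mpolyC0.
  by apply: (@mpoly_ext _ _ _ idfun (@mpolyC 0 F \o mmap idfun (fun=> 0))) => [c|[]//]; rewrite /= mmapC.
have q0 : muni_last p != 0 by rewrite -(raddf0 (@muni_last n F)) (can_eq (@muni_lastK n F)).
have [v vq] : exists v : 'I_n -> F, mmap idfun v (lead_coef (muni_last p)) != 0.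
  by apply: IHn; rewrite lead_coef_eq0.
pose q := map_poly (mmap idfun v) (muni_last p).
have q_neq0 : q != 0.
  by apply: contraNneq vq => /(congr1 (fun r : {poly F} => r`_(size (muni_last p)).-1));
    rewrite coef0 coef_map => ->.
have [s sP] := finite_roots q_neq0; have [x xs] := Finf s.
exists (fun j => if unlift ord_max j is Some j' then v j' else x).
rewrite mmap_last unlift_none; apply: contra xs => qx; apply: sP; rewrite rootE.
have -> // : q = map_poly (mmap idfun (fun j => if unlift ord_max (fintype.lift ord_max j) is Some j' then v j' else x)) (muni_last p).
by apply: eq_map_poly => r; congr (mmap idfun _ r); apply/funext => j; rewrite liftK.
Qed.

Lemma alg_indep_last n (F E : fieldType) (i : {rmorphism F -> E}) (X : 'I_n.+1 -> E) :
  (forall p : {mpoly F[n.+1]}, mmap i X p = 0 -> p = 0) ->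
  let X' := fun j => X (fintype.lift ord_max j) in
  (forall p : {mpoly F[n]}, mmap i X' p = 0 -> p = 0) /\
  (forall q : {poly {mpoly F[n]}}, (map_poly (mmap i X') q).[X ord_max] = 0 -> q = 0).
Proof.
move=> Xi X'; have second q : (map_poly (mmap i X') q).[X ord_max] = 0 -> q = 0.
  rewrite -{1}[q]mmulti_lastK -mmap_last => /Xi q0.
  by rewrite -[q]mmulti_lastK q0 rmorph0.
split=> // p pX; have /eqP : p%:P = 0 by apply: second; rewrite map_polyC hornerC.
by rewrite polyC_eq0 => /eqP.
Qed.

Section Independent.
Variables (F E : fieldType) (i : {rmorphism F -> E}).
Local Notation acl := (acl i).

(** Each entry is transcendental over the entries to its right; the order matches the recursion of
    [ratfun], where the last variable adjoined comes first. *)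
Fixpoint indep (s : seq E) : Prop := if s is x :: s' then indep s' /\ ~ acl s' x else True.

Lemma acl_split w z x : acl (w ++ z) x -> ~ acl w x ->
  exists u y v, [/\ z = u ++ y :: v, acl (y :: w ++ v) x & ~ acl (w ++ v) x].
Proof.
elim: z => [|y z IHz] wz wx; first by rewrite cats0 in wz.
have [wzx|nwzx] := pselect (acl (w ++ z) x).
  have [u [y' [v [-> h1 h2]]]] := IHz wzx wx.
  by exists (y :: u), y', v.
exists [::], y, z; split=> //; apply: acl_mono wz => t.
by rewrite !(mem_cat, inE) orbCA.
Qed.

(** Steinitz replacement: each entry of w displaces one entry of z, found by [acl_split] as the
    first whose removal leaves x transcendental. *)
Lemma acl_replace w z : indep w -> (forall x, x \in w -> acl z x) ->
  exists2 z', (size z' + size w = size z)%N & forall y, y \in z -> acl (w ++ z') y.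
Proof.
elim: w => [|x w IHw] /= wI wz; first by exists z; rewrite ?addn0 // => y; apply: acl_mem.
have [wI' xw] := wI.
have [|z' sz' z'z] := IHw wI'; first by move=> y yw; apply: wz; rewrite inE yw orbT.
have xz' : acl (w ++ z') x by apply: acl_trans z'z _; apply: wz; rewrite mem_head.
have [u [y [v [z'E yx nx]]]] := acl_split xz' xw.
have xy := acl_exchange yx nx.
exists (u ++ v); first by rewrite -sz' z'E !size_cat /=; lia.
move=> t /z'z; apply: acl_trans => r; rewrite z'E !(mem_cat, inE).
case/or4P => [rw|ru|/eqP->|rv]; last 2 first.
- by apply: acl_mono xy => q; rewrite !(mem_cat, inE) => /or3P[]->; rewrite ?orbT.
- by apply: acl_mem; rewrite !(mem_cat, inE) rv !orbT.
- by apply: acl_mem; rewrite !(mem_cat, inE) rw !orbT.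
- by apply: acl_mem; rewrite !(mem_cat, inE) ru !orbT.
Qed.

Lemma indep_leq w z : indep w -> (forall x, x \in w -> acl z x) -> (size w <= size z)%N.
Proof. by move=> wI wz; have [z' <- _] := acl_replace wI wz; apply: leq_addl. Qed.

(** A dependent z could be shortened without losing w, against [indep_leq]. *)
Lemma indep_spanning w z : indep w -> (forall x, x \in w -> acl z x) ->
  size w = size z -> indep z.
Proof.
move=> wI wz wzE; apply: contrapT => nz.
have [u [y [v [zE vy]]]] : exists u y v, z = u ++ y :: v /\ acl v y.
  elim: (z) nz => [|y v IHv] /= nz; first by case: nz.
  have [vy|nvy] := pselect (acl v y); first by exists [::], y, v.
  have [|u [y' [v' [-> vy']]]] := IHv; first by move=> vI; apply: nz.
  by exists (y :: u), y', v'.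
suff : (size w <= size (u ++ v))%N by rewrite wzE zE !size_cat /= addnS ltnn.
apply: indep_leq => // x /wz; apply: acl_trans => t.
rewrite zE mem_cat inE => /or3P[tu|/eqP->|tv]; last 1 first.
- by apply: acl_mem; rewrite mem_cat tv orbT.
- by apply: acl_mem; rewrite mem_cat tu.
- by apply: acl_mono vy => q qv; rewrite mem_cat qv orbT.
Qed.

Lemma alg_indep_indep n (X : 'I_n -> E) :
  (forall p : {mpoly F[n]}, mmap i X p = 0 -> p = 0) ->
  indep (rev [seq X j | j <- enum 'I_n]).
Proof.
elim: n X => [|n IHn] X Xi; first by rewrite (size0nil (size_enum_ord 0)).
have [X'i last] := alg_indep_last Xi.
have -> : rev [seq X j | j <- enum 'I_n.+1] = X ord_max ::
    rev [seq X (fintype.lift ord_max j) | j <- enum 'I_n].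
  rewrite enum_ordSr map_rcons rev_rcons -map_comp; congr (_ :: rev _).
  by apply: eq_map => j /=; congr X; apply: val_inj; rewrite /= /bump leqNgt ltn_ord.
split; first exact: IHn.
pose ev : {rmorphism {mpoly F[n]} -> E} := mmap i (fun j => X (fintype.lift ord_max j)).
move=> /(@acl_clear _ _ _ _ ev)[|c|y|q [q0 qX]].
- by apply: raddf_inj => p; apply: X'i.
- by exists c%:MP; rewrite [RHS]mmapC.
- rewrite mem_rev => /mapP[j _ ->]; exists 'X_j; by rewrite [RHS]mmapX mmap1U.
by move/eqP: q0; apply; apply: last.
Qed.
End Independent.

(** Iterated, rather than fractions of polynomials in n variables: purity is proved one variable at
    a time, and the outermost variable will play the role of the other chart's parameter. *)
Fixpoint ratfun (F : fieldType) n : fieldType :=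
  if n is m.+1 then {fraction {poly ratfun F m}} else F.

Definition ratfun_inc (F : fieldType) n : {rmorphism ratfun F n -> ratfun F n.+1} :=
  tofrac \o polyC.

Fixpoint ratfun_const (F : fieldType) n : {rmorphism F -> ratfun F n} :=
  if n is m.+1 then ratfun_inc F m \o ratfun_const F m else idfun.

Fixpoint ratfun_gens (F : fieldType) n : seq (ratfun F n) :=
  if n is m.+1 then ('X : {poly ratfun F m})%:F :: map (ratfun_inc F m) (ratfun_gens F m)
  else [::].

Lemma ratfun_pure l (k : fieldType) n : (0 < l)%N -> l%:R != 0 :> k ->
  pure_ext l (ratfun_const k n).
Proof.
move=> l0 lk; elim: n => [|n IHn]; first exact: pure_ext_id.
apply: (pure_ext_step l0 _ IHn).
by rewrite -(rmorph_nat (ratfun_const k n)) fmorph_eq0.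
Qed.

Section PolyExt.
Variables (M E : fieldType) (j : {rmorphism M -> E}) (x : E).
Hypothesis x_trans : forall q : {poly M}, (map_poly j q).[x] = 0 -> q = 0.

Lemma ratfun_step : exists h : {rmorphism {fraction {poly M}} -> E},
  (forall q : {poly M}, h q%:F = (map_poly j q).[x]) /\
  (forall u, h u%:P%:F = j u) /\ h 'X%:F = x.
Proof.
have [|h hE] := @frac_ext _ _ (horner_eval x \o map_poly j).
  by apply: raddf_inj => q; apply: x_trans.
exists h; split; first exact: hE.
split=> [u|]; rewrite hE.
  by change ((map_poly j u%:P).[x] = j u); rewrite map_polyC hornerC.
by change ((map_poly j 'X).[x] = x); rewrite map_polyX hornerX.
Qed.
End PolyExt.

(** The last clause feeds the induction: the next entry is transcendental over F(z), so the
    coefficients of a relation must be seen to lie there. *)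
Lemma ratfun_ext (F E : fieldType) (i : {rmorphism F -> E}) n (z : seq E) :
  indep i z -> size z = n -> exists h : {rmorphism ratfun F n -> E},
    [/\ forall c, h (ratfun_const F n c) = i c, map h (ratfun_gens F n) = z &
        forall u, h u \in adjoin i z].
Proof.
elim: n z => [|n IHn] [|x z] //=.
  by exists i; split=> // u; apply: adjoin_const.
move=> [zI zx] [zn]; have [h [hC hX hz]] := IHn z zI zn.
have [q qx|g [gE [gC gX]]] := @ratfun_step _ _ h x.
  apply/eqP/negP => /negP q0; apply: zx; exists (map_poly h q).
    by apply/polyOverP => m; rewrite coef_map; apply: hz.
  by split; [rewrite map_poly_eq0 | apply/rootP].
exists g; split=> [c||u].
- by rewrite -hC -gC.
- rewrite gX -hX -map_comp; congr (_ :: _); apply: eq_map => u /=.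
  exact: gC.
have [a [b [b0 ->]]] := fractionP u.
have sub y : y \in adjoin i z -> y \in adjoin i (x :: z).
  by apply: adjoin_mono => t tz; rewrite adjoin_mem // inE tz orbT.
have gA p : g p%:F \in adjoin i (x :: z).
  rewrite gE rpred_horner ?adjoin_mem ?mem_head //.
  by apply/polyOverP => m; rewrite coef_map; apply/sub/hz.
by rewrite fmorph_div rpred_div ?gA.
Qed.

(** Independence of z is not assumed: a relation would be carried by [eps] to one between the images
    of the generators under the field embedding [delta]. It embeds N into K. *)
Lemma ratfun_lift (F E L : fieldType) (i : {rmorphism F -> E}) (eps : {rmorphism E -> L}) n
    (delta : {rmorphism ratfun F n -> L}) (z : seq E) :
  (forall c, eps (i c) = delta (ratfun_const F n c)) ->
  map eps z = map delta (ratfun_gens F n) ->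
  exists h : {rmorphism ratfun F n -> E},
    [/\ forall c, h (ratfun_const F n c) = i c, map h (ratfun_gens F n) = z &
        forall u, eps (h u) = delta u].
Proof.
elim: n z delta => [|n IHn] [|x z] delta //= dC; first by exists i; split.
move=> [xE zE]; have [|h [hC hz hd]] := IHn z (delta \o ratfun_inc F n) dC.
  by rewrite zE -map_comp.
have hq q : eps (map_poly h q).[x] = delta q%:F.
  rewrite -horner_map xE -map_poly_comp (eq_map_poly hd).
  change ((map_poly (delta \o ratfun_inc F n) q).[delta 'X%:F] = delta q%:F).
  elim/poly_ind: q => [|q c IHq]; first by rewrite map_poly0 horner0 !rmorph0.
  rewrite rmorphD rmorphM /= map_polyX map_polyC hornerMXaddC IHq.
  by rewrite -rmorphM -rmorphD /= -rmorphM -rmorphD.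
have [q qx|g [gE [gC gX]]] := @ratfun_step _ _ h x.
  have /eqP := hq q; rewrite qx rmorph0 eq_sym fmorph_eq0.
  by rewrite (is_frac_eq0 (@tofrac_is_frac _)) => /eqP.
exists g; split=> [c||u].
- by rewrite -hC -gC.
- rewrite gX -hz -map_comp; congr (_ :: _); apply: eq_map => u /=.
  exact: gC.
have [a [b [b0 ->]]] := fractionP u.
by rewrite !fmorph_div !gE !hq.
Qed.

(** * Construction of the charts *)

Section TensorSum.
Variables (k0 K0 k K : fieldType) (iK : {rmorphism k0 -> K0}) (ik : {rmorphism k0 -> k}).
Variables (jK : {rmorphism K0 -> K}) (jk : {rmorphism k -> K}).

Definition tensor_elt (s : seq (K0 * k)) : K := \sum_(p <- s) jK p.1 * jk p.2.
Definition tensor_pred : {pred K} := fun x => `[< exists s, x = tensor_elt s >].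

Lemma tensor_subring : subring_closed tensor_pred.
Proof.
split=> [|_ _ /asboolP[s ->] /asboolP[t ->]|_ _ /asboolP[s ->] /asboolP[t ->]]; apply/asboolP.
- by exists [:: (1, 1)]; rewrite /tensor_elt big_seq1 !rmorph1 mulr1.
- exists (s ++ [seq (- p.1, p.2) | p <- t]).
  rewrite /tensor_elt big_cat big_map /= -sumrN; congr (_ + _).
  by apply: eq_bigr => p _; rewrite rmorphN mulNr.
exists [seq (p.1 * q.1, p.2 * q.2) | p <- s, q <- t].
rewrite /tensor_elt big_allpairs_dep /= mulr_suml; apply: eq_bigr => p _.
rewrite mulr_sumr; apply: eq_bigr => q _.
by rewrite !rmorphM mulrACA.
Qed.
HB.instance Definition _ := GRing.isSubringClosed.Build K tensor_pred tensor_subring.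

Record tensor_sub := TensorSub { tensor_val : K; _ : tensor_val \in tensor_pred }.
HB.instance Definition _ := [isSub for tensor_val].
HB.instance Definition _ := [Choice of tensor_sub by <:].
HB.instance Definition _ := [SubChoice_isSubComNzRing of tensor_sub by <:].

Lemma tensor_jK x : jK x \in tensor_pred.
Proof. by apply/asboolP; exists [:: (x, 1)]; rewrite /tensor_elt big_seq1 rmorph1 mulr1. Qed.
Lemma tensor_jk x : jk x \in tensor_pred.
Proof. by apply/asboolP; exists [:: (1, x)]; rewrite /tensor_elt big_seq1 rmorph1 mul1r. Qed.

Section Corestriction.
Variables (R : pzRingType) (f : {rmorphism R -> K}) (fS : forall x, f x \in tensor_pred).
Definition corestrict x : tensor_sub := TensorSub (fS x).
Fact corestrict_zmod : zmod_morphism corestrict.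
Proof. by move=> x y; apply: val_inj; rewrite /= rmorphB. Qed.
Fact corestrict_monoid : monoid_morphism corestrict.
Proof. by split=> [|x y]; apply: val_inj; rewrite /= ?rmorph1 ?rmorphM. Qed.
HB.instance Definition _ := GRing.isZmodMorphism.Build R tensor_sub corestrict corestrict_zmod.
HB.instance Definition _ := GRing.isMonoidMorphism.Build R tensor_sub corestrict corestrict_monoid.
End Corestriction.

(** The sums form a subring, so the universal property gives a map from K into it. Followed by the
    inclusion, this is the identity by uniqueness, and hence the subring is everything. *)
Lemma tensor_sum : is_tensor_product iK ik jK jk -> forall x, exists s, x = tensor_elt s.
Proof.
move=> [e univ] x.
have [|h [hK hk] _] := univ tensor_sub (corestrict tensor_jK) (corestrict tensor_jk).
  by move=> c; apply: val_inj; apply: e.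
have [g _ gU] := univ K jK jk e.
have -> : x = val (h x).
  rewrite -[RHS]/((val \o h) x) -[LHS]/((idfun : {rmorphism K -> K}) x).
  rewrite (gU idfun) // (gU (val \o h)) // => c /=.
    by rewrite -[h (jK c)]/((h \o jK) c) hK.
  by rewrite -[h (jk c)]/((h \o jk) c) hk.
by apply/asboolP/(valP (h x)).
Qed.
End TensorSum.

(** * Primitive elements and the choice of a base point *)

Section Primitive.
Variables (M E : fieldType) (j : {rmorphism M -> E}).
Hypothesis j_sep : forall x, exists p, separable_poly p /\ root (map_poly j p) x.

Definition poly_in (y x : E) := exists f, x = (map_poly j f).[y].

(** Removing the power of X from an annihilator of x leaves r(x) x + c = 0 with c nonzero, which
    expresses the inverse of x. Thus the polynomials in y form a field. *)
Lemma poly_in_inv y x : poly_in y x -> poly_in y x^-1.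
Proof.
have [-> _|x0 [f fE]] := eqVneq x 0; first by exists 0; rewrite invr0 map_poly0 horner0.
have [q [qs qx]] := j_sep x; have [m [q1 [qE q10]]] := poly_order (separable_poly_neq0 qs).
move: qx; rewrite qE rmorphM rmorphXn /= map_polyX rootM rootE hornerXn expf_eq0 (negPf x0) andbF /=.
elim/poly_ind: q1 {qE} q10 => [|r c _]; first by rewrite coef0 eqxx.
rewrite coefD coefMX coefC /= add0r => c0.
rewrite rmorphD rmorphM /= map_polyX map_polyC rootE hornerMXaddC addr_eq0 => /eqP rE.
exists ((- c^-1) *: (r \Po f)); rewrite map_polyZ hornerZ /= map_comp_poly horner_comp -fE.
apply: (mulIf x0); rewrite mulVf // -mulrA rE rmorphN fmorphV mulrNN mulVf //.
by rewrite fmorph_eq0.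
Qed.

Definition poly_in_pred y : {pred E} := fun x => `[< poly_in y x >].
Lemma poly_in_divring y : divring_closed (poly_in_pred y).
Proof.
split=> [|_ _ /asboolP[f ->] /asboolP[g ->]|x z /asboolP[f ->] /asboolP/poly_in_inv[g gE]];
  apply/asboolP.
- by exists 1; rewrite rmorph1 hornerC.
- by exists (f - g); rewrite rmorphB hornerD hornerN.
- by exists (f * g); rewrite rmorphM hornerM -gE.
Qed.
HB.instance Definition _ y := GRing.isDivringClosed.Build E (poly_in_pred y) (poly_in_divring y).

Lemma primitive_list (s : seq E) : infinite_set (fun _ : M => True) ->
  exists y, forall x, x \in s -> poly_in y x.
Proof.
move=> Minf; elim: s => [|x s [y ys]]; first by exists 0.
have [q [qs qy]] := j_sep y; have [p [ps px]] := j_sep x.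
have [r r0 rP] := large_field_PET (separable_poly_neq0 ps) px qy qs.
have [t [_ rt] _] := infinite_set_nonroot (fmorph_inj j) r0 Minf [::].
have [f fE [g gE]] : exists2 f, (map_poly j f).[j t * y - x] = x & exists g, (map_poly j g).[j t * y - x] = y.
  by have [[f fE] [g gE]] := rP t rt; exists f => //; exists g.
exists (j t * y - x) => z; rewrite inE => /orP[/eqP->|/ys[h ->]]; first by exists f.
by exists (h \Po g); rewrite map_comp_poly horner_comp gE.
Qed.

Lemma poly_in_adjoin (F : fieldType) (i : {rmorphism F -> E}) s y :
  (forall c, exists u, i c = j u) -> (forall x, x \in s -> poly_in y x) ->
  forall x, x \in adjoin i s -> poly_in y x.
Proof.
move=> ij sy x xs; apply/asboolP; move: x xs; apply: (adjoin_min (L := poly_in_pred y)).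
  by move=> c; apply/asboolP; have [u ->] := ij c; exists u%:P; rewrite map_polyC hornerC.
by move=> x xs; apply/asboolP/sy.
Qed.
End Primitive.

Lemma closed_root (k : fieldType) (q : {poly k}) : GRing.closed_field_axiom k ->
  (1 < size q)%N -> exists x, root q x.
Proof.
move=> kc q1; have q0 : q != 0 by rewrite -size_poly_gt0 ltnW.
have [|x xE] := kc (size q).-1 (fun m => - (q`_m / lead_coef q)); first by rewrite -ltnS prednK ?size_poly_gt0.
exists x; rewrite rootE horner_coef -(prednK (n := size q)) ?size_poly_gt0 // big_ord_recr /= -/(lead_coef q) xE.
rewrite mulr_sumr -big_split big1 // => m _ /=.
have lq : lead_coef q != 0 by rewrite lead_coef_eq0.
by rewrite mulNr mulrN mulrA mulrCA divff // mulr1 addrN.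
Qed.

(** A Bezout identity without denominators survives specialisation: where D does not vanish, a root
    of the specialised P is simple, as Hensel's lemma requires. *)
Lemma separable_clear (R : idomainType) (L : fieldType) (f : {rmorphism R -> L}) (P : {poly R}) :
  is_frac f -> separable_poly (map_poly f P) ->
  exists (U V : {poly R}) (D : R), D != 0 /\ U * P + V * P^`() = D%:P.
Proof.
move=> fP; rewrite separable_poly.unlock => /Bezout_coprimepP[[u v]] /=.
rewrite -size_poly_eq1 => /size_poly1P[c c0 uvE].
have [d1 [U [d10 UE]]] := frac_clear fP u; have [d2 [V [d20 VE]]] := frac_clear fP v.
have [a [b [b0 cE]]] := fP.2 c.
exists ((d2 * b) *: U), ((d1 * b) *: V), (d1 * d2 * a); split.
  rewrite !mulf_neq0 //; apply: contraNneq c0 => a0; by rewrite cE a0 rmorph0 mul0r.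
have fI : injective (map_poly f) := map_inj_poly fP.1 (rmorph0 f).
have fb : f b != 0 by rewrite (is_frac_eq0 fP).
apply: fI; rewrite rmorphD (rmorphM (map_poly f)) (rmorphM (map_poly f)) /=.
have fD : f (d1 * d2 * a) = f d1 * f d2 * (f b * c).
  by rewrite rmorphM rmorphM cE [f b * _]mulrC divfK.
rewrite !map_polyZ /= -UE -VE map_polyC /= -deriv_map fD !(rmorphM f).
rewrite -!mul_polyC !polyCM -uvE.
by move: (map_poly f P) (f d1)%:P (f d2)%:P (f b)%:P => p x y z; move: (p^`()) => *; ring.
Qed.

Section Base.
Variables (k0 K0 k : fieldType) (iK : {rmorphism k0 -> K0}) (ik : {rmorphism k0 -> k}).
Variables (n : nat) (X : 'I_n -> K0).
Local Notation R := {mpoly k0[n]}.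
Hypothesis Xi : forall p : R, mmap iK X p = 0 -> p = 0.
Let xs := [seq X j | j <- enum 'I_n].
Hypothesis Xsep : forall z, exists2 p : {poly K0}, p \is a polyOver (adjoin iK xs) &
  separable_poly p /\ root p z.
Hypotheses (fg : finitely_generated iK) (k0_inf : infinite_field k0).
Hypothesis k_closed : GRing.closed_field_axiom k.

Definition spec_at (p : 'I_n -> k0) : {rmorphism R -> k} := ik \o mmap idfun p.

Lemma base_data : exists (h : {rmorphism {fraction R} -> K0}) (y : K0) (P : {poly R})
    (p : 'I_n -> k0) (y0 : k),
  [/\ forall r : R, h r%:F = mmap iK X r,
      forall z, poly_in h y z,
      separable_poly (map_poly tofrac P) /\ root (map_poly h (map_poly tofrac P)) y,
      forall a, a != 0 -> root (map_poly h a) y -> (size P <= size a)%N &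
      (map_poly (spec_at p) P).[y0] = 0 /\ (map_poly (spec_at p) P^`()).[y0] != 0].
Proof.
have evI : injective (mmap iK X : R -> K0) by apply: raddf_inj => p; apply: Xi.
have [h hE] := frac_ext evI.
have hC c : h (c%:MP : R)%:F = iK c by rewrite hE [LHS]mmapC.
have hX j : h ('X_j : R)%:F = X j by rewrite hE [LHS]mmapX mmap1U.
have im z : z \in adjoin iK xs -> exists u, z = h u.
  apply: adjoin_image => [c|_ /mapP[j _ ->]]; first by exists (c%:MP : R)%:F.
  by exists ('X_j : R)%:F.
have h_sep z : exists q, separable_poly q /\ root (map_poly h q) z.
  have [q qA [qs qz]] := Xsep z; have [q' qE] := polyOver_image im qA.
  by exists q'; rewrite -(separable_map h) -qE.
have Minf : infinite_set (fun _ : {fraction R} => True).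
  move=> s; pose f : {rmorphism k0 -> {fraction R}} := tofrac \o @mpolyC n k0.
  have fI : injective f := fmorph_inj f.
  have k0i : infinite_set (fun _ : k0 => True) by move=> t; have [e et] := k0_inf t; exists e.
  by have [e _ es] := infinite_set_image fI k0i s; exists e.
have [gs gsP] := fg; have [y yP] := primitive_list h_sep gs Minf.
have y_gen z : poly_in h y z.
  by apply: (poly_in_adjoin h_sep _ yP (gsP z)) => c; exists (c%:MP : R)%:F.
have [q [qs qy]] := h_sep y; have q0 := separable_poly_neq0 qs.
pose ann m := `[< exists a : {poly {fraction R}}, [/\ a != 0, root (map_poly h a) y & size a = m] >].
have /ex_minnP[m /asboolP[P1 [P10 P1y P1m]] m_min] : exists m, ann m.
  by exists (size q); apply/asboolP; exists q.
have P1_min a : a != 0 -> root (map_poly h a) y -> (size P1 <= size a)%N.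
  by move=> a0 ay; rewrite P1m; apply: m_min; apply/asboolP; exists a.
have [d [P [d0 PE]]] := frac_clear (@tofrac_is_frac R) P1.
have d0' : (d%:F : {fraction R}) != 0 by rewrite (is_frac_eq0 (@tofrac_is_frac R)).
have Py : root (map_poly h (map_poly tofrac P)) y.
  by rewrite -PE map_polyZ rootE hornerZ (rootP P1y) mulr0.
have sP : size P = size P1.
  rewrite -(size_scale P1 d0') PE; apply/esym/size_map_inj_poly; last exact: rmorph0.
  exact: (@tofrac_is_frac R).1.
have P_sep : separable_poly (map_poly tofrac P).
  apply: dvdp_separable qs; rewrite /dvdp; apply/eqP/eqP/negPn/negP => r0.
  have P00 : map_poly tofrac P != 0 by rewrite -PE scaler_eq0 negb_or d0'.
  suff : (size P1 <= size (q %% map_poly tofrac P)%R)%N.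
    by rewrite leqNgt -(size_scale P1 d0') PE ltn_modp P00.
  by apply: P1_min => //; rewrite rootE (modp_horner _ (rootP Py)); apply: qy.
have [U [V [D [D0 UV]]]] := separable_clear (@tofrac_is_frac R) P_sep.
have P0 : P != 0 by rewrite -size_poly_gt0 sP size_poly_gt0.
(* Nonvanishing of the leading coefficient keeps P of positive degree at p, so that it has a root in
   k; nonvanishing of D makes that root simple. *)
have [p pP] : exists v, mmap idfun v (D * lead_coef P) != 0.
  by apply: mpoly_nonroot => //; rewrite mulf_neq0 ?lead_coef_eq0.
move: pP; rewrite rmorphM mulf_eq0 => /norP[pD pe].
have SD : spec_at p D != 0 by rewrite fmorph_eq0.
have Se : spec_at p (lead_coef P) != 0 by rewrite fmorph_eq0.
have P1gt : (1 < size P)%N.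
  rewrite sP -(size_map_poly h); apply: root_size_gt1 P1y.
  by rewrite map_poly_eq0.
have [|y0 y0P] := @closed_root k (map_poly (spec_at p) P) k_closed.
  by rewrite size_map_poly_id0.
exists h, y, P, p, y0; split=> //.
- by move=> a a0 ay; rewrite sP; apply: P1_min.
split; first exact/rootP.
apply: contraNneq SD => P'0.
have <- : (map_poly (spec_at p) (U * P + V * P^`())).[y0] = spec_at p D.
  by rewrite UV map_polyC hornerC.
rewrite rmorphD (rmorphM (map_poly _)) (rmorphM (map_poly _)) hornerD !hornerM P'0.
by rewrite (rootP y0P) !mulr0 addr0.
Qed.
End Base.

(** By minimality P generates the kernel of [ev]. If [ev'] killed an element outside it, that
    element would be prime to P, and a Bezout identity would make a nonzero constant vanish. *)
Lemma kernel_eq (M L1 L2 : fieldType) (ev : {rmorphism {poly M} -> L1})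
    (ev' : {rmorphism {poly M} -> L2}) P : P != 0 -> ev P = 0 -> ev' P = 0 ->
  (forall a, a != 0 -> ev a = 0 -> (size P <= size a)%N) ->
  forall a, ev a = 0 <-> ev' a = 0.
Proof.
move=> P0 evP ev'P P_min a.
have evmod b : ev b = 0 -> P %| b.
  move=> b0; rewrite /dvdp; apply/negPn/negP => r0.
  suff : (size P <= size (b %% P)%R)%N by rewrite leqNgt ltn_modp P0.
  apply: P_min => //; have := divp_eq b P => /(congr1 ev).
  by rewrite b0 rmorphD rmorphM evP mulr0 add0r.
split=> [a0|a0].
  by rewrite -(divpK (evmod a a0)) rmorphM ev'P mulr0.
apply/eqP/negPn/negP => a1.
have : coprimep P a.
  rewrite /coprimep; have g0 : ev (gcdp P a) != 0.
    by apply: contraNneq a1 => g0; rewrite -(divpK (dvdp_gcdr P a)) rmorphM g0 mulr0.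
  have PE := divpK (dvdp_gcdl P a); set q := P %/ _ in PE.
  have q0 : q != 0 by apply: contraNneq P0 => q0; rewrite -PE q0 mul0r.
  have gn0 : gcdp P a != 0 by apply: contraNneq g0 => ->; rewrite rmorph0.
  have : (size P <= size q)%N.
    apply: P_min => //; move: evP; rewrite -PE rmorphM => /eqP.
    by rewrite mulf_eq0 (negPf g0) orbF => /eqP.
  have sP : size P = (size q + size (gcdp P a)).-1 by rewrite -{1}PE size_mul.
  by move: sP; rewrite -size_poly_gt0 in q0; rewrite -size_poly_gt0 in gn0; lia.
move=> /Bezout_coprimepP[[u v]] /=; rewrite -size_poly_eq1 => /size_poly1P[c c0].
move=> /(congr1 ev'); rewrite rmorphD !rmorphM ev'P a0 !mulr0 addr0 => /esym/eqP.
by rewrite (fmorph_eq0 (ev' \o polyC) c) (negPf c0).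
Qed.

Lemma horner_map_X (M M' : comNzRingType) (E : comNzRingType) (e : {rmorphism M -> M'})
    (f : {rmorphism {poly M'} -> E}) (g : {rmorphism M -> E}) q :
  (forall u, g u = f (e u)%:P) -> (map_poly g q).[f 'X] = f (map_poly e q).
Proof.
move=> gE; elim/poly_ind: q => [|p u IHp]; first by rewrite !map_poly0 horner0 rmorph0.
rewrite (rmorphD (map_poly g)) (rmorphM (map_poly g)) (rmorphD (map_poly e)) (rmorphM (map_poly e)) /=.
by rewrite !map_polyX !map_polyC hornerMXaddC IHp /= gE -rmorphM -rmorphD.
Qed.

Lemma ratfun_map (F E : fieldType) (i : {rmorphism F -> E}) n :
  exists h : {rmorphism ratfun F n -> ratfun E n},
    (forall c, h (ratfun_const F n c) = ratfun_const E n (i c)) /\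
    map h (ratfun_gens F n) = ratfun_gens E n.
Proof.
elim: n => [|n [h [hC hX]]]; first by exists i.
have [q qX|g [gE [gC gX]]] := @ratfun_step _ _ (ratfun_inc E n \o h) ('X%:F).
  have : (map_poly h q)%:F = 0 :> {fraction {poly ratfun E n}}.
    by rewrite -qX; apply/esym/(@horner_map_X _ _ _ h tofrac).
  by move/eqP; rewrite (is_frac_eq0 (@tofrac_is_frac _)) map_poly_eq0 => /eqP.
exists g; split=> [c|] /=.
  by rewrite [LHS]gC /= hC.
rewrite gX -hX -!map_comp; congr (_ :: _); apply: eq_map => u /=.
exact: gC.
Qed.

Section RationalEmbedding.
Variables (k0 k : fieldType) (ik : {rmorphism k0 -> k}) (m : nat).
Local Notation N := (ratfun k m).
Local Notation A := {poly {poly N}}.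
Variables (FA : fieldType) (fa : {rmorphism A -> FA}) (faP : is_frac fa).

(** The outermost variable goes to s, the next one to X, the others to the generators of N. It is
    the formal counterpart of the coordinates of K0 and serves to show that [evA] is injective. *)
Lemma ratfun_embed : exists G : {rmorphism ratfun k0 m.+2 -> FA},
  (forall c, G (ratfun_const k0 m.+2 c) = fa (ratfun_const k m (ik c))%:P%:P) /\
  map G (ratfun_gens k0 m.+2) =
    fa 'X :: fa ('X%:P) :: [seq fa u%:P%:P | u <- ratfun_gens k m].
Proof.
have [e0 [e0C e0X]] := ratfun_map ik m.
pose j0 : {rmorphism ratfun k0 m -> FA} := fa \o (polyC \o (polyC \o e0)).
have [q qX|e1 [e1E [e1C e1X]]] := @ratfun_step _ _ j0 (fa 'X%:P).
  have : fa (map_poly e0 q)%:P = 0.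
    by rewrite -qX; apply/esym/(@horner_map_X _ _ _ e0 (fa \o polyC)).
  by move/eqP; rewrite (is_frac_eq0 faP) polyC_eq0 map_poly_eq0 => /eqP.
have [q qX|e2 [e2E [e2C e2X]]] := @ratfun_step _ _ e1 (fa 'X).
  have [d [r [d0 rE]]] := frac_clear (@tofrac_is_frac _) q.
  have e1F u : e1 u%:F = fa (map_poly e0 u)%:P.
    by rewrite e1E; apply: (@horner_map_X _ _ _ e0 (fa \o polyC)).
  have : fa (map_poly (map_poly e0) r) = 0.
    have <- : (map_poly e1 (map_poly tofrac r)).[fa 'X] = fa (map_poly (map_poly e0) r).
      rewrite -map_poly_comp; apply: (@horner_map_X _ _ _ (map_poly e0) fa (e1 \o tofrac)).
      exact: e1F.
    by rewrite -rE map_polyZ hornerZ qX mulr0.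
  move/eqP; rewrite (is_frac_eq0 faP) => /eqP r0.
  have {}r0 : r = 0.
    apply: (map_inj_poly (f := map_poly e0)); last by rewrite r0 map_poly0.
      exact: map_poly_inj.
    exact: rmorph0.
  move/eqP: rE; rewrite r0 rmorph0 scaler_eq0 (is_frac_eq0 (@tofrac_is_frac _)).
  by rewrite (negPf d0) => /eqP.
exists e2; split=> [c|]; first by rewrite [LHS]e2C [LHS]e1C /= e0C.
rewrite /= e2X -map_comp; congr (_ :: _ :: _); first by rewrite [LHS]e2C.
rewrite -e0X -!map_comp; apply: eq_map => u /=.
by rewrite [LHS]e2C [LHS]e1C.
Qed.
End RationalEmbedding.

(** Here w is regular along s = 0 and q is its restriction to that divisor; q may be 0. *)
Definition lead (k N K Q FA : fieldType) (jk : {rmorphism k -> K}) (c : {rmorphism k -> N})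
    (fr : {rmorphism fps {poly N} -> Q}) (emb : {rmorphism FA -> Q})
    (ch : chart jk c fr emb) (w : K) (q : {poly N}) :=
  exists2 b : fps {poly N}, ci ch w = fr b & b`[0] = q.

Lemma map_polyMXaddC (S S' : nzRingType) (f : {rmorphism S -> S'}) (q : {poly S}) a :
  map_poly f (q * 'X + a%:P) = map_poly f q * 'X + (f a)%:P.
Proof. by rewrite rmorphD rmorphM /= map_polyX map_polyC. Qed.

Section ChartOf.
Variables (k0 K0 k K : fieldType) (iK : {rmorphism k0 -> K0}) (ik : {rmorphism k0 -> k}).
Variables (jK : {rmorphism K0 -> K}) (jk : {rmorphism k -> K}).
Hypothesis KP : is_tensor_product iK ik jK jk.
Variables (n : nat) (X : 'I_n -> K0).
Local Notation R := {mpoly k0[n]}.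
Hypothesis Xi : forall p : R, mmap iK X p = 0 -> p = 0.
Variables (h : {rmorphism {fraction R} -> K0}) (y : K0) (P : {poly R}) (p : 'I_n -> k0) (y0 : k).
Hypothesis hE : forall r : R, h r%:F = mmap iK X r.
Hypothesis y_gen : forall z, poly_in h y z.
Hypothesis P_sep : separable_poly (map_poly tofrac P).
Hypothesis P_y : root (map_poly h (map_poly tofrac P)) y.
Hypothesis P_min : forall a, a != 0 -> root (map_poly h a) y -> (size P <= size a)%N.
Hypothesis P_y0 : (map_poly (spec_at ik p) P).[y0] = 0.
Hypothesis P'_y0 : (map_poly (spec_at ik p) P^`()).[y0] != 0.
Variables (i0 i1 : 'I_n) (L : seq 'I_n).
Hypothesis L_perm : perm_eq [:: i0, i1 & L] (enum 'I_n).
Local Notation m := (size L).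
Local Notation N := (ratfun k m).
Local Notation c := (ratfun_const k m).
Local Notation B := (fps {poly N}).
Local Notation A := {poly {poly N}}.
Variables (Q FA : fieldType) (fr : {rmorphism B -> Q}) (fa : {rmorphism A -> FA}).
Variables (emb : {rmorphism FA -> Q}).
Hypotheses (frP : is_frac fr) (faP : is_frac fa).
Hypothesis embE : forall a, emb (fa a) = fr (series _ a).

Let I_uniq : uniq [:: i0, i1 & L].
Proof. by rewrite (perm_uniq L_perm) enum_uniq. Qed.
Let I_mem j : j \in [:: i0, i1 & L].
Proof. by rewrite (perm_mem L_perm) mem_enum. Qed.

Definition chart_s : K0 := X i0 - iK (p i0).
Definition chart_t j : K0 := (X j - iK (p j)) / chart_s.
(** The image of [chart_t j] in N[X]: 1 for the index of s, X for the chosen index, a generator of N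
    for each other one. *)
Definition chart_T j : {poly N} :=
  if j == i0 then 1 else nth 0 ('X :: map polyC (ratfun_gens k m)) (index j (i1 :: L)).

Lemma chart_s_neq0 : chart_s != 0.
Proof.
apply/eqP => s0; have : ('X_i0 - (p i0)%:MP : R) = 0.
  by apply: Xi; rewrite rmorphB /= mmapX mmap1U mmapC.
move=> /(congr1 (mmap idfun (fun=> p i0 + 1))) /eqP.
rewrite rmorphB rmorph0 /= mmapX mmap1U mmapC /= addrAC subrr add0r.
by rewrite oner_eq0.
Qed.

Lemma chart_t0 : chart_t i0 = 1.
Proof. by rewrite /chart_t divff ?chart_s_neq0. Qed.

Lemma chart_X j : X j = iK (p j) + chart_s * chart_t j.
Proof. by rewrite /chart_t mulrC divfK ?chart_s_neq0 // addrC subrK. Qed.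

Lemma size_gens (F : fieldType) l : size (ratfun_gens F l) = l.
Proof. by elim: l => //= l IHl; rewrite size_map IHl. Qed.

Lemma chart_indep : indep iK (chart_s :: [seq chart_t j | j <- i1 :: L]).
Proof.
apply: (indep_spanning (alg_indep_indep Xi)).
  move=> x; rewrite mem_rev => /mapP[j _ ->]; apply: acl_adjoin.
  set z := _ :: _; have sz : chart_s \in adjoin iK z by rewrite adjoin_mem ?mem_head.
  have tz : chart_t j \in adjoin iK z.
    have := I_mem j; rewrite inE => /orP[/eqP->|jL]; first by rewrite chart_t0 rpred1.
    by rewrite adjoin_mem // inE map_f ?orbT.
  by rewrite chart_X rpredD ?adjoin_const // rpredM.
by rewrite size_rev size_map -(perm_size L_perm) /= size_map.
Qed.

(** The blow-up substitution of p_j + s t_j for x_j; the outer variable is s. *)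
Definition evA : {rmorphism R -> A} :=
  mmap (polyC \o (polyC \o (c \o ik)))
    (fun j => (c (ik (p j)))%:P%:P + 'X * (chart_T j)%:P).

Lemma evAC a : evA a%:MP = (c (ik a))%:P%:P. Proof. by rewrite [LHS]mmapC. Qed.
Lemma evAX j : evA 'X_j = (c (ik (p j)))%:P%:P + 'X * (chart_T j)%:P.
Proof. by rewrite [LHS]mmapX mmap1U. Qed.

(** Both [evA] and the evaluation at the x_j factor through the rational functions over k0 in s and
    the t_j. They do so by field embeddings, because s and the t_j are independent, so they have the
    same kernel, which is zero. *)
Lemma evA_inj : injective evA.
Proof.
apply: raddf_inj => r r0; apply: Xi.
have z_size : size (chart_s :: [seq chart_t j | j <- i1 :: L]) = m.+2 by rewrite /= size_map.
have [hz [hC hX _]] := ratfun_ext chart_indep z_size.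
have [G [GC GX]] := ratfun_embed ik faP.
set gs := ratfun_gens k0 _ in hX GX.
pose u j := if j == i0 then 1 else nth 0 (behead gs) (index j (i1 :: L)).
pose evR : {rmorphism R -> ratfun k0 m.+2} := mmap (ratfun_const k0 m.+2)
  (fun j => ratfun_const k0 m.+2 (p j) + head 0 gs * u j).
have gs_size : size gs = m.+2 by exact: size_gens.
have idx j : j != i0 -> (index j (i1 :: L) < size (behead gs))%N.
  move=> j0; have -> : size (behead gs) = size (i1 :: L) by rewrite size_behead gs_size.
  rewrite index_mem.
  by have := I_mem j; rewrite inE (negPf j0).
have hom (E : fieldType) (H : {rmorphism ratfun k0 m.+2 -> E}) e es : map H gs = e :: es ->
    H (head 0 gs) = e /\ forall j, H (u j) = if j == i0 then 1 else nth 0 es (index j (i1 :: L)).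
  move=> HE; split=> [|j].
    by rewrite -[RHS]/(head 0 (e :: es)) -HE; case: (gs) gs_size.
  rewrite /u; case: ifPn => [_|j0]; first exact: rmorph1.
  by rewrite -[es]/(behead (e :: es)) -HE behead_map (nth_map 0) ?idx.
have evRX j : evR 'X_j = ratfun_const k0 m.+2 (p j) + head 0 gs * u j.
  by rewrite [LHS]mmapX mmap1U.
have evRC a : evR a%:MP = ratfun_const k0 m.+2 a by rewrite [LHS]mmapC.
have [hs hu] := hom _ hz _ _ hX; have [Gs Gu] := hom _ G _ _ GX.
have hR : mmap iK X r = hz (evR r).
  apply: (@mpoly_ext _ _ _ (mmap iK X) (hz \o evR)) => [a|j] /=.
    by rewrite mmapC -[evR _]/(evR a%:MP) evRC hC.
  rewrite mmapX mmap1U -[evR _]/(evR 'X_j) evRX rmorphD hC rmorphM hs hu chart_X.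
  congr (_ + _ * _); have := I_mem j; rewrite inE; case: eqVneq => [-> _|_ jL].
    exact: chart_t0.
  by rewrite (nth_map i0) ?index_mem // nth_index.
have GR : fa (evA r) = G (evR r).
  apply: (@mpoly_ext _ _ _ (fa \o evA) (G \o evR)) => [a|j].
    by change (fa (evA a%:MP) = G (evR a%:MP)); rewrite evAC evRC GC.
  change (fa (evA 'X_j) = G (evR 'X_j)); rewrite evAX evRX (rmorphD G) GC (rmorphM G) Gs Gu.
  rewrite rmorphD rmorphM /chart_T; congr (_ + _ * _); have := I_mem j; rewrite inE.
  case: eqVneq => [_ _|_ jL]; first exact: rmorph1.
  have -> : fa 'X%:P :: [seq fa v%:P%:P | v <- ratfun_gens k m]
      = map (fun q => fa q%:P) ('X :: map polyC (ratfun_gens k m)) by rewrite /= -map_comp.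
  rewrite (nth_map 0) //; have -> : size ('X :: map polyC (ratfun_gens k m)) = size (i1 :: L).
    by rewrite /= size_map size_gens.
  by rewrite index_mem.
have : G (evR r) = 0 by rewrite -GR r0 rmorph0.
by move/eqP; rewrite fmorph_eq0 => /eqP R0; rewrite hR R0 rmorph0.
Qed.

Definition evB : {rmorphism R -> B} := series _ \o evA.

Lemma evB_0 r : (evB r)`[0] = (c (spec_at ik p r))%:P.
Proof.
apply: (@mpoly_ext _ _ _ (@fcoef_0 _ \o evB) (polyC \o (c \o spec_at ik p))) => [a|j].
  change ((evA a%:MP)`_0 = (c (ik (mmap idfun p a%:MP)))%:P).
  by rewrite evAC mmapC coefC.
change ((evA 'X_j)`_0 = (c (ik (mmap idfun p 'X_j)))%:P).
by rewrite evAX mmapX mmap1U coefD coefC coefXM addr0.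
Qed.

Lemma evB_X j : evB 'X_j = fconst (c (ik (p j)))%:P + fX _ * fconst (chart_T j).
Proof.
rewrite -[LHS]/(series _ (evA 'X_j)) evAX rmorphD rmorphM.
by congr (_ + _ * _); [apply: fps_of_polyC | apply: fps_of_polyX | apply: fps_of_polyC].
Qed.

Lemma evB_C a : evB a%:MP = fconst (c (ik a))%:P.
Proof. by rewrite -[LHS]/(series _ (evA a%:MP)) evAC; apply: fps_of_polyC. Qed.

Lemma evB_horner (q : {poly R}) (b : B) : b`[0] = (c y0)%:P ->
  ((map_poly evB q).[b])`[0] = (c (map_poly (spec_at ik p) q).[y0])%:P.
Proof.
move=> b0; elim/poly_ind: q => [|q r IHq]; first by rewrite !map_poly0 !horner0 !rmorph0.
rewrite !map_polyMXaddC !hornerMXaddC fcoefD fcoefM0 IHq b0 rmorphD rmorphM.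
by rewrite rmorphD rmorphM; congr (_ + _); apply: evB_0.
Qed.

(** Hensel's lemma applies at y0 because evaluation at s = 0 is evaluation at p. [kernel_eq] makes
    the root a copy of the primitive element, which embeds K0. The constants of k and the universal
    property extend this to K, and [ratfun_lift] places N inside K. *)
Lemma chart_of : exists ch : chart jk c fr emb,
  [/\ ct ch = jK (chart_t i1),
      [seq cj ch u | u <- ratfun_gens k m] = [seq jK (chart_t j) | j <- L] &
      forall q : {poly R}, lead ch (jK (map_poly (mmap iK X) q).[y])
        (c (map_poly (spec_at ik p) q).[y0])%:P].
Proof.
have cC v : (fconst v%:P : B)`[0] = v%:P by [].
have [||yh yh0 yhP] := @hensel _ (map_poly evB P) (c y0)%:P.
- by rewrite evB_horner // P_y0 !rmorph0.
- rewrite deriv_map evB_horner // poly_unitE size_polyC coefC fmorph_eq0 P'_y0 eqxx.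
  by rewrite unitfE fmorph_eq0.
have [g gE] : exists g : {rmorphism {fraction R} -> FA}, forall r, g r%:F = fa (evA r).
  by apply: (@frac_ext _ _ (fa \o evA)) => r r' /= /faP.1 /evA_inj.
have embg r : emb (g r%:F) = fr (evB r) by rewrite gE embE.
pose ev : {rmorphism {poly {fraction R}} -> K0} := horner_eval y \o map_poly h.
pose ev' : {rmorphism {poly {fraction R}} -> Q} := horner_eval (fr yh) \o map_poly (emb \o g).
have ev'E a : ev' a = (map_poly emb (map_poly g a)).[fr yh].
  by rewrite -map_poly_comp.
have ev'C u : ev' u%:P = emb (g u) by rewrite ev'E !map_polyC hornerC.
have ev'P q : ev' (map_poly tofrac q) = fr (map_poly evB q).[yh].
  rewrite ev'E -horner_map -!map_poly_comp; congr (_.[_]).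
  by apply: eq_map_poly => r; apply: embg.
have [phi phiE] : exists phi : {rmorphism K0 -> Q}, forall a, phi (ev a) = ev' a.
  apply: frac_lift => [|z].
    apply: (@kernel_eq _ _ _ ev ev' (map_poly tofrac P)).
    - exact: separable_poly_neq0.
    - exact/rootP.
    - by rewrite ev'P yhP rmorph0.
    move=> a a0 /rootP ay; rewrite size_map_inj_poly ?rmorph0 //; first exact: P_min.
    exact: (tofrac_is_frac R).1.
  have [f ->] := y_gen z; exists f, 1; split; first by rewrite rmorph1 oner_neq0.
  by rewrite rmorph1 divr1.
have phih u : phi (h u) = emb (g u).
  have <- : ev u%:P = h u by change ((map_poly h u%:P).[y] = h u); rewrite map_polyC hornerC.
  by rewrite phiE ev'C.
have phir r : phi (mmap iK X r) = fr (evB r) by rewrite -hE phih embg.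
have phiy : phi y = fr yh.
  have -> : y = ev 'X by change (y = (map_poly h 'X).[y]); rewrite map_polyX hornerX.
  by rewrite phiE ev'E !map_polyX hornerX.
have phiC a : phi (iK a) = fr (fconst (c (ik a))%:P) by rewrite -evB_C -phir mmapC.
pose cst : {rmorphism k -> Q} := fr \o (@fconst _ \o (polyC \o c)).
have [e univ] := KP.
have [|i [iK_ ik_] _] := univ Q phi cst; first by move=> a; apply: phiC.
have iE x : i (jK x) = phi x := iK_ x.
have ikE x : i (jk x) = fr (fconst (c x)%:P) := ik_ x.
have phiX j : phi (X j) = fr (fconst (c (ik (p j)))%:P) + fr (fX _) * fr (fconst (chart_T j)).
  by rewrite -rmorphM -rmorphD -evB_X -phir mmapX mmap1U.
have phis : phi chart_s = fr (fX _).
  rewrite rmorphB phiX phiC /chart_T eqxx -rmorphM (rmorph1 (@fconst _)) mulr1.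
  by rewrite addrC addrA addNr add0r.
have phit j : phi (chart_t j) = fr (fconst (chart_T j)).
  rewrite /chart_t fmorph_div phis rmorphB phiX phiC addrAC subrr add0r mulrC mulKf //.
  by rewrite (is_frac_eq0 frP) fX_neq0.
have i1n0 : i1 != i0 by move: I_uniq; rewrite /= inE negb_or eq_sym => /andP[/andP[]].
have T1 : chart_T i1 = 'X by rewrite /chart_T (negPf i1n0) /= eqxx.
pose dl : {rmorphism N -> Q} := fr \o (@fconst _ \o polyC).
have [||j [jC jX jE]] := @ratfun_lift _ _ _ jk i m dl [seq jK (chart_t j) | j <- L].
- by move=> a; rewrite ikE.
- rewrite -map_comp; apply: (@eq_from_nth _ 0) => [|b]; rewrite !size_map ?size_gens //.
  move=> bL; rewrite (nth_map i0) // (nth_map 0) ?size_gens //=.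
  rewrite iE phit /chart_T.
  have : nth i0 L b \in L by rewrite mem_nth.
  move: I_uniq; rewrite /= inE negb_or => /and3P[/andP[_ i0L] i1L Lu] bL'.
  have /negPf-> : nth i0 L b != i0 by apply: contraNneq i0L => <-.
  have /negPf-> : i1 != nth i0 L b by apply: contraNneq i1L => ->.
  by rewrite /= index_uniq // (nth_map 0) ?size_gens.
have ct_ : i (jK (chart_t i1)) = fr (fconst 'X) by rewrite iE phit T1.
have cs_ : i (jK chart_s) = fr (fX _) by rewrite iE.
have cy_ : i (jK y) = fr yh by rewrite iE.
have gen x : exists f, i x = (map_poly emb f).[fr yh].
  have [s ->] := tensor_sum KP x; rewrite /tensor_elt.
  elim: s => [|[u v] s [f IHs]]; first by exists 0; rewrite big_nil rmorph0 map_poly0 horner0.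
  have [a ->] := y_gen u; exists ((fa (c v)%:P%:P) *: map_poly g a + f).
  rewrite big_cons rmorphD IHs rmorphM iE ikE /= -[(map_poly h a).[y]]/(ev a) phiE ev'E.
  rewrite (rmorphD (map_poly emb)) hornerD /= map_polyZ hornerZ embE mulrC.
  by congr (fr _ * _ + _); apply/esym/fps_of_polyC.
have sep : exists q, separable_poly q /\ root (map_poly emb q) (fr yh).
  exists (map_poly g (map_poly tofrac P)); rewrite separable_map; split=> //.
  by apply/rootP; rewrite -ev'E ev'P yhP rmorph0.
exists (Chart jC jE ct_ cs_ cy_ gen sep); split=> //= q.
exists (map_poly evB q).[yh]; last exact: evB_horner.
have <- : ev (map_poly tofrac q) = (map_poly (mmap iK X) q).[y].
  rewrite -[LHS]/((map_poly h (map_poly tofrac q)).[y]) -map_poly_comp.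
  by congr (_.[_]); apply: eq_map_poly => r /=; rewrite hE.
by rewrite -[ci _ _]/(i (jK _)) iE phiE ev'P.
Qed.
End ChartOf.

Section TwoCharts.
Variables (k0 K0 k K : fieldType) (iK : {rmorphism k0 -> K0}) (ik : {rmorphism k0 -> k}).
Variables (jK : {rmorphism K0 -> K}) (jk : {rmorphism k -> K}).
Hypothesis KP : is_tensor_product iK ik jK jk.

(** Both charts come from the same p and s, with the indices i1 and i2 exchanged. The remaining
    lists have equal length, so N is the same field and its outermost variable stands for the other
    parameter. Writing f with a common denominator in the x_i gives g and h with constant
    restrictions to s = 0. *)
Lemma two_charts d : infinite_field k0 -> regular_function_field iK ->
  transcendence_degree iK d -> (3 <= d)%N -> GRing.closed_field_axiom k ->
  exists (m : nat) (t1 t2 : K0),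
  let c := ratfun_const k m.+1 in let tau : ratfun k m.+1 := ('X : {poly ratfun k m})%:F in
  exists (Q FA : fieldType) (fr : {rmorphism fps {poly ratfun k m.+1} -> Q})
    (fa : {rmorphism {poly {poly ratfun k m.+1}} -> FA}) (emb : {rmorphism FA -> Q})
    (ch1 ch2 : chart jk c fr emb),
  [/\ is_frac fr, is_frac fa, forall a, emb (fa a) = fr (series _ a),
    [/\ ct ch1 = jK t1, cj ch1 tau = jK t2, ct ch2 = jK t2 & cj ch2 tau = jK t1] &
    forall f, exists g h g0 h0, [/\ h != 0, f = g / h,
      lead ch1 (jK g) (c g0)%:P /\ lead ch2 (jK g) (c g0)%:P &
      lead ch1 (jK h) (c h0)%:P /\ lead ch2 (jK h) (c h0)%:P]].
Proof.
move=> k0_inf [fg [n [b [[b_ind b_span] b_sep]]] _] [b' [b'_ind b'_span]] d3 kc.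
pose X := tnth b; pose xs := [seq X j | j <- enum 'I_n].
have xsE z : (z \in xs) = (z \in (b : seq K0)) by rewrite /xs map_tnth_enum.
have sub1 : {subset adjoin iK b <= adjoin iK xs}.
  by apply: adjoin_mono => z; rewrite -xsE; apply: adjoin_mem.
have Xsep z : exists2 q : {poly K0}, q \is a polyOver (adjoin iK xs) & separable_poly q /\ root q z.
  have [q qb qz] := b_sep z; exists q => //.
  by apply/polyOverP => j; apply/sub1/(polyOverP qb).
have n3 : (3 <= n)%N.
  apply: leq_trans d3 _.
  have := indep_leq (alg_indep_indep b'_ind) (z := b).
  rewrite size_rev size_map size_enum_ord size_tuple; apply=> z _.
  by have [q qb [q0 qz]] := b_span z; exists q.
have [h [y [P [p [y0 [hE y_gen [P_sep P_y] P_min [Py0 P'y0]]]]]]] :=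
  @base_data _ _ _ iK ik n X b_ind Xsep fg k0_inf kc.
case E: (enum 'I_n) (size_enum_ord n) => [|i0 [|i1 [|i2 L]]] sE; rewrite -sE // in n3.
have L1 : perm_eq [:: i0, i1 & i2 :: L] (enum 'I_n) by rewrite E.
have L2 : perm_eq [:: i0, i2 & i1 :: L] (enum 'I_n).
  by rewrite E perm_cons; apply/permPl; exact: (perm_catCA [:: i2] [:: i1] L).
exists (size L), (chart_t iK X p i0 i1), (chart_t iK X p i0 i2) => c tau.
pose N := ratfun k (size L).+1.
pose fr : {rmorphism fps {poly N} -> {fraction (fps {poly N})}} := tofrac.
pose fa : {rmorphism {poly {poly N}} -> {fraction {poly {poly N}}}} := tofrac.
have frP : is_frac fr := tofrac_is_frac _.
have faP : is_frac fa := tofrac_is_frac _.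
have [emb embE] : exists emb : {rmorphism {fraction {poly {poly N}}} -> {fraction (fps {poly N})}},
    forall a, emb (fa a) = fr (series _ a).
  apply: (@is_frac_ext _ _ _ fa (fr \o series _)) => // a a' /frP.1.
  exact: fps_of_poly_inj.
have chart1 := chart_of KP b_ind hE y_gen P_sep P_y P_min Py0 P'y0 L1 frP faP embE.
have chart2 := chart_of KP b_ind hE y_gen P_sep P_y P_min Py0 P'y0 L2 frP faP embE.
have [ch1 [t1E u1E l1]] := chart1; have [ch2 [t2E u2E l2]] := chart2.
exists _, _, fr, fa, emb, ch1, ch2; split=> //.
  by split=> //; [move: u1E => /= [] | move: u2E => /= []].
move=> f; have [a aE] := y_gen f.
have [e [q [e0 qE]]] := frac_clear (@tofrac_is_frac _) a.
exists (map_poly (mmap iK X) q).[y], (map_poly (mmap iK X) e%:P).[y].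
exists (map_poly (spec_at ik p) q).[y0], (map_poly (spec_at ik p) e%:P).[y0].
have ee : (map_poly (mmap iK X) e%:P).[y] = h e%:F by rewrite map_polyC hornerC hE.
have e0' : h e%:F != 0 by rewrite fmorph_eq0 (is_frac_eq0 (@tofrac_is_frac _)).
split; first by rewrite ee.
- rewrite ee; apply: (mulIf e0'); rewrite divfK // mulrC aE.
  have -> : (map_poly (mmap iK X) q).[y] = (map_poly h (map_poly tofrac q)).[y].
    by rewrite -map_poly_comp; congr (_.[_]); apply: eq_map_poly => r /=; rewrite hE.
  by rewrite -qE map_polyZ hornerZ.
- by split; [apply: l1 | apply: l2].
- by split; [apply: l1 | apply: l2].
Qed.
End TwoCharts.

(** * Orders and leading coefficients in a chart *)

Section Multiplicity.
Variables (M : fieldType) (l : nat).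
Implicit Types p q u v : {poly M}.

Lemma mup_exp x p n : p != 0 -> mup x (p ^+ n) = (n * mup x p)%N.
Proof.
move=> p0; elim: n => [|n IHn]; first by rewrite expr0 mul0n mupNroot // root1.
by rewrite exprS mupM ?expf_neq0 // IHn mulSn.
Qed.

Lemma mup_power p q u v x : p != 0 -> q != 0 -> u != 0 -> v != 0 ->
  p * v ^+ l = q * u ^+ l -> mup x p = mup x q %[mod l].
Proof.
move=> p0 q0 u0 v0 /(congr1 (mup x)); rewrite !mupM ?expf_neq0 // !mup_exp // => E.
by rewrite -(modnMDl (mup x v) (mup x p)) -(modnMDl (mup x u) (mup x q)) !(mulnC _ l) addnC E addnC.
Qed.

(** The final comparison in the residue arguments: equality modulo l-th powers of rational functions
    in tau becomes a congruence of multiplicities. *)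
Lemma ratf_mup (L : fieldType) (f : {rmorphism {poly M} -> L}) p q (v : L) x :
  is_frac f -> p != 0 -> q != 0 -> f p = f q * v ^+ l -> mup x p = mup x q %[mod l].
Proof.
move=> fP p0 q0; have [a [b [b0 ->]]] := fP.2 v; move=> E.
have b0' : f b ^+ l != 0 by rewrite expf_neq0 // (is_frac_eq0 fP).
have {}E : p * b ^+ l = q * a ^+ l.
  apply: fP.1; transitivity (f p * f b ^+ l); first by rewrite rmorphM rmorphXn.
  transitivity (f q * f a ^+ l); last by rewrite rmorphM rmorphXn.
  by rewrite E expr_div_n -mulrA divfK.
have [l0|l0] := posnP l.
  by move: E; rewrite l0 !expr0 !mulr1 => ->.
apply: (mup_power _ p0 q0 _ b0 E); apply: contraTneq (mulf_neq0 p0 (expf_neq0 l b0)) => a0.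
by rewrite E a0 expr0n gtn_eqF // mulr0 eqxx.
Qed.

Lemma mup_map (k : fieldType) (c : {rmorphism k -> M}) (p : {poly k}) x : p != 0 ->
  mup (c x) (map_poly c p) = mup x p.
Proof.
move=> p0; have p0' : map_poly c p != 0 by rewrite map_poly_eq0.
have E n : (n <= mup (c x) (map_poly c p))%N = (n <= mup x p)%N.
  rewrite !mup_geq // -(map_polyX c) -map_polyC /= -rmorphB -rmorphXn /=.
  exact: dvdp_map.
by apply/eqP; rewrite eqn_leq -E leqnn E leqnn.
Qed.
End Multiplicity.

Section ClosedPowers.
Variables (k : fieldType) (l : nat).
Hypotheses (kc : GRing.closed_field_axiom k) (l_gt0 : (0 < l)%N).

Lemma closed_nth_root (x : k) : exists y, x = y ^+ l.
Proof.
have [y yE] := kc (fun j => if j == 0%N then x else 0) l_gt0; exists y.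
rewrite yE; case: (l) l_gt0 => // l' _; rewrite big_ord_recl /= expr0 mulr1 big1 ?addr0 // => j _.
by rewrite mul0r.
Qed.

Lemma closed_poly_power (a : {poly k}) : a != 0 -> (forall x, (l %| mup x a)%N) ->
  exists2 b, b != 0 & a = b ^+ l.
Proof.
have [n] := ubnP (size a); elim: n a => // n IHn a; rewrite ltnS => an a0 la.
have [a1|a1] := leqP (size a) 1.
  have /size_poly1P[x x0 ->] : size a == 1 by rewrite eqn_leq a1 size_poly_gt0.
  have [y yE] := closed_nth_root x; exists y%:P; last by rewrite yE rmorphXn.
  by rewrite polyC_eq0; apply: contraNneq x0 => y0; rewrite yE y0 expr0n gtn_eqF.
have [x xa] := closed_root kc a1.
have lx : (l <= mup x a)%N.
  by apply: dvdn_leq (la x); rewrite -XsubC_dvd // dvdp_XsubCl.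
have := divpK (_ : ('X - x%:P) ^+ l %| a); rewrite -mup_geq // => /(_ lx).
set b := a %/ _ => bE; have X0 : ('X - x%:P) ^+ l != 0 by rewrite expf_neq0 ?polyXsubC_eq0.
have b0 : b != 0 by apply: contraNneq a0 => b0; rewrite -bE b0 mul0r.
have [||z|b' b'0 b'E] := IHn b.
- apply: leq_trans _ an; have -> : size a = (size b + l)%N.
    by rewrite -{1}bE size_mul // size_exp_XsubC addnS.
  by rewrite -[X in (X < _)%N]addn0 ltn_add2l.
- exact: b0.
- have := la z; rewrite -bE mupM // mup_exp ?polyXsubC_eq0 //.
  by rewrite dvdn_addl // dvdn_mulr.
exists (b' * ('X - x%:P)); first by rewrite mulf_neq0 ?polyXsubC_eq0.
by rewrite exprMn -b'E bE.
Qed.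

(** When the multiplicities agree modulo l, those of a b^(l-1) are multiples of l, so this product
    is an l-th power. *)
Lemma closed_poly_equiv (a b : {poly k}) : a != 0 -> b != 0 ->
  (forall x, mup x a = mup x b %[mod l]) ->
  exists u v, [/\ u != 0, v != 0 & a * v ^+ l = b * u ^+ l].
Proof.
move=> a0 b0 ab; have [||u u0 uE] := @closed_poly_power (a * b ^+ l.-1).
- by rewrite mulf_neq0 ?expf_neq0.
- move=> x; rewrite mupM ?expf_neq0 // mup_exp // /dvdn -modnDml ab modnDml.
  by rewrite -mulSn prednK // modnMr.
exists u, b; split=> //; rewrite -uE mulrCA -exprS prednK //.
Qed.
End ClosedPowers.

Section Lead.
Variables (k N K : fieldType) (jk : {rmorphism k -> K}) (c : {rmorphism k -> N}).
Local Notation B := (fps {poly N}).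
Variables (Q FA : fieldType) (fr : {rmorphism B -> Q}) (emb : {rmorphism FA -> Q}).
Hypothesis frP : is_frac fr.
Variable ch : chart jk c fr emb.
Local Notation lead := (lead ch).
Local Notation pl e := (place_of frP ch e).

Lemma leadD w q w' q' : lead w q -> lead w' q' -> lead (w + w') (q + q').
Proof. by move=> [b bE <-] [b' b'E <-]; exists (b + b'); rewrite ?rmorphD ?bE ?b'E. Qed.
Lemma leadN w q : lead w q -> lead (- w) (- q).
Proof. by move=> [b bE <-]; exists (- b); rewrite ?rmorphN ?bE. Qed.
Lemma leadB w q w' q' : lead w q -> lead w' q' -> lead (w - w') (q - q').
Proof. by move=> wq /leadN; apply: leadD. Qed.
Lemma leadM w q w' q' : lead w q -> lead w' q' -> lead (w * w') (q * q').
Proof.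
by move=> [b bE <-] [b' b'E <-]; exists (b * b'); rewrite ?fcoefM0 // !rmorphM bE b'E.
Qed.
Lemma leadX w q n : lead w q -> lead (w ^+ n) (q ^+ n).
Proof. by move=> [b bE <-]; exists (b ^+ n); rewrite ?fcoefXn0 // !rmorphXn bE. Qed.
Lemma lead_t : lead (ct ch) 'X.
Proof. by exists (fconst 'X); rewrite // ci_t. Qed.
Lemma lead_j v : lead (cj ch v) v%:P.
Proof. by exists (fconst v%:P); rewrite // ci_j. Qed.
Lemma lead_k x : lead (jk x) (c x)%:P.
Proof. by rewrite -(cjc ch); apply: lead_j. Qed.

Lemma lead_neq0 w q : lead w q -> q != 0 -> w != 0.
Proof.
by move=> [b bE <-]; apply: contraNneq => w0; move/eqP: bE; rewrite w0 rmorph0 eq_sym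
  (is_frac_eq0 frP) => /eqP ->.
Qed.

Lemma po_ratio e w m a b : ci ch w = fr (pi_at e ^+ m * a) / fr b ->
  spec_fps e a != 0 -> spec_fps e b != 0 -> po (pl e) w = m%:Z.
Proof.
move=> wE a0 b0; have H : ratio_val (spec_fps e) (pi_at e) fr (ci ch) w m 0 a b.
  by split=> //; rewrite expr0 mul1r.
by rewrite (dvr_ordE frP (spec_pi_at e) (pi_at_neq0 e) H : po (pl e) w = _) subr0.
Qed.

Lemma po_lead e w q : lead w q -> q.[e] != 0 -> po (pl e) w = 0.
Proof.
move=> [b bE <-] b0; apply: (@po_ratio e w 0 b 1).
- by rewrite mul1r rmorph1 divr1.
- exact: spec_fps_neq0.
- by rewrite rmorph1 oner_neq0.
Qed.

Lemma po_t e : po (pl e) (ct ch - cj ch e) = 1.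
Proof.
apply: (@po_ratio e _ 1 1 1); last 2 first.
- by rewrite rmorph1 oner_neq0.
- by rewrite rmorph1 oner_neq0.
rewrite expr1 mulr1 rmorph1 divr1 rmorphB ci_t ci_j -rmorphB; congr (fr _).
by rewrite /pi_at rmorphB.
Qed.

Lemma po_pm e w : w != 0 -> 0 < po (pl e) w -> pm (pl e) w.
Proof. exact: (dvr_ord_pos frP (spec_pi_at e) (pi_at_neq0 e) (@spec_factor _ e)). Qed.

Lemma po_almost w : w != 0 -> exists2 r, r != 0 & forall e, r.[e] != 0 -> po (pl e) w = 0.
Proof.
move=> w0; have [a [b [b0 wE]]] := frP.2 (ci ch w).
have a0 : a != 0.
  by apply: contraNneq w0 => a0; rewrite -(fmorph_eq0 (ci ch)) wE a0 rmorph0 mul0r.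
have coef (f : B) : f != 0 -> exists2 r, r != 0 & forall e, r.[e] != 0 -> spec_fps e f != 0.
  move=> f0; have [i fi] : exists i, f`[i] != 0.
    apply: contrapT => nf; case/eqP: f0; apply: fpsP => i.
    by apply/eqP/negP => /negP fi; apply: nf; exists i.
  exists f`[i] => // e; apply: contraNneq => /(congr1 (fun g => g`[i])) E.
  exact/eqP.
have [r1 r10 h1] := coef a a0; have [r2 r20 h2] := coef b b0.
exists (r1 * r2); first exact: mulf_neq0.
move=> e; rewrite hornerM mulf_eq0 => /norP[/h1 a1 /h2 b1].
by apply: (@po_ratio e w 0 a b); rewrite ?expr0 ?mul1r.
Qed.

Variable l : nat.
Hypothesis l_gt0 : (0 < l)%N.

(** The residues satisfy an equation in N[[s]]; comparing its lowest coefficients in s turns it into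
    one between elements of N. *)
Lemma near_one_lead e x y q1 q2 : lead x q1 -> lead y q2 -> q1.[e] != 0 -> q2.[e] != 0 ->
  near_one l (pl e) (x / y) -> exists v, q1.[e] = q2.[e] * v ^+ l.
Proof.
move=> [a aE aq] [b bE bq] ae be; rewrite -aq in ae; rewrite -bq in be; move=> ne.
have xyE : ci ch (x / y) = fr a / fr b by rewrite fmorph_div aE bE.
have [h [f [g [_ f0 g0 fgE]]]] :=
  near_one_residue l_gt0 ne xyE (spec_fps_neq0 ae) (spec_fps_neq0 be).
have [m [f' [fE f'0]]] := fps_order f0; have [n [g' [gE g'0]]] := fps_order g0.
have ag : (spec_fps e a * g' ^+ l)`[0] = q1.[e] * g'`[0] ^+ l by rewrite fcoefM0 fcoefXn0 -aq.
have bf : (spec_fps e b * f' ^+ l)`[0] = q2.[e] * f'`[0] ^+ l by rewrite fcoefM0 fcoefXn0 -bq.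
rewrite aq in ae; rewrite bq in be.
have ag0 : (spec_fps e a * g' ^+ l)`[0] != 0 by rewrite ag mulf_neq0 ?expf_neq0.
have bf0 : (spec_fps e b * f' ^+ l)`[0] != 0 by rewrite bf mulf_neq0 ?expf_neq0.
have [|_ E] := @fX_order_uniq _ (n * l) (m * l) _ _ ag0 bf0.
  rewrite !exprM [LHS]mulrCA [RHS]mulrCA -!exprMn -gE -fE; exact: fgE.
exists (f'`[0] / g'`[0]).
have gl : g'`[0] ^+ l != 0 by rewrite expf_neq0.
by rewrite expr_div_n mulrA -bf -E ag mulfK.
Qed.

Lemma lead_power x y q1 q2 h : lead x q1 -> lead y q2 -> q1 != 0 -> q2 != 0 ->
  x = y * h ^+ l -> exists u v, [/\ u != 0, v != 0 & q1 * v ^+ l = q2 * u ^+ l].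
Proof.
move=> lx ly q10 q20 xE; have x0 := lead_neq0 lx q10.
have [a aE aq] := lx; have [b bE bq] := ly.
have h0 : h != 0.
  by apply: contraNneq x0 => h0; rewrite xE h0 expr0n gtn_eqF // mulr0.
have [f [g [g0 hE]]] := frP.2 (ci ch h).
have f0 : f != 0.
  by apply: contraNneq h0 => f0; rewrite -(fmorph_eq0 (ci ch)) hE f0 rmorph0 mul0r.
have E0 : a * g ^+ l = b * f ^+ l.
  have gl : fr g ^+ l != 0 by rewrite expf_neq0 // (is_frac_eq0 frP).
  apply: frP.1; rewrite [LHS]rmorphM [RHS]rmorphM !rmorphXn -aE -bE xE rmorphM rmorphXn hE.
  by rewrite expr_div_n -mulrA divfK.
have [m [f' [fE f'0]]] := fps_order f0; have [n [g' [gE g'0]]] := fps_order g0.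
have ag : (a * g' ^+ l)`[0] = q1 * g'`[0] ^+ l by rewrite fcoefM0 fcoefXn0 aq.
have bf : (b * f' ^+ l)`[0] = q2 * f'`[0] ^+ l by rewrite fcoefM0 fcoefXn0 bq.
have ag0 : (a * g' ^+ l)`[0] != 0 by rewrite ag mulf_neq0 ?expf_neq0.
have bf0 : (b * f' ^+ l)`[0] != 0 by rewrite bf mulf_neq0 ?expf_neq0.
have [|_ E] := @fX_order_uniq _ (n * l) (m * l) _ _ ag0 bf0.
  rewrite !exprM [LHS]mulrCA [RHS]mulrCA -!exprMn -gE -fE; exact: E0.
exists f'`[0], g'`[0]; split; first exact: f'0.
  exact: g'0.
by rewrite -ag -bf E.
Qed.
End Lead.

Lemma mup_affine (M : fieldType) (p : {poly M}) (u v z : M) : u != 0 -> p != 0 ->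
  p \Po (u *: 'X + v%:P) != 0 /\ mup z (p \Po (u *: 'X + v%:P)) = mup (u * z + v) p.
Proof.
move=> u0 p0; have [m [q]] := multiplicity_XsubC p (u * z + v).
rewrite p0 /= => qz pE; set r := _ + v%:P.
have rz : r.[z] = u * z + v by rewrite hornerD hornerZ hornerX hornerC.
have rE : ('X - (u * z + v)%:P) \Po r = u%:P * ('X - z%:P).
  rewrite comp_polyB comp_polyX comp_polyC /r mulrBr -mul_polyC polyCD polyCM.
  by rewrite opprD addrACA subrr addr0.
have cE : p \Po r = (q \Po r) * (u%:P ^+ m) * ('X - z%:P) ^+ m.
  by rewrite {1}pE comp_polyM [X in _ * X](rmorphXn (comp_poly r)) /= rE exprMn mulrA.
have nr : ~~ root ((q \Po r) * u%:P ^+ m) z.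
  rewrite rootM negb_or rootE horner_comp rz -rootE qz rootE horner_exp hornerC.
  by rewrite expf_neq0.
split.
  rewrite cE mulf_neq0 ?expf_neq0 ?polyXsubC_eq0 //.
  by apply: contraNneq nr => ->; rewrite root0.
by rewrite cE mupMr // mup_XsubCX eqxx pE mupMr // mup_XsubCX eqxx.
Qed.

Section ChartLemmas.
Variables (k N K : fieldType) (jk : {rmorphism k -> K}) (c : {rmorphism k -> N}).
Local Notation B := (fps {poly N}).
Local Notation A := {poly {poly N}}.
Variables (Q FA : fieldType) (fr : {rmorphism B -> Q}) (fa : {rmorphism A -> FA}).
Variables (emb : {rmorphism FA -> Q}).
Hypotheses (frP : is_frac fr) (faP : is_frac fa).
Hypothesis embE : forall a, emb (fa a) = fr (series _ a).
Notation chart := (chart jk c fr emb).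
Notation pl ch e := (place_of frP ch e).

Lemma lead_horner (ch : chart) w q (a : {poly k}) : lead ch w q ->
  lead ch (map_poly jk a).[w] (map_poly c a \Po q).
Proof.
move=> wq; elim/poly_ind: a => [|a x IHa].
  rewrite !map_poly0 horner0 comp_poly0 -(rmorph0 jk) -polyC0 -(rmorph0 c).
  exact: lead_k.
rewrite !map_polyMXaddC hornerMXaddC comp_polyD comp_polyM comp_polyX comp_polyC.
by apply: leadD; [apply: leadM | apply: lead_k].
Qed.

Lemma po_polyt (ch : chart) (a : {poly k}) x : a != 0 ->
  po (pl ch (c x)) (map_poly jk a).[ct ch] = (mup x a)%:Z.
Proof.
move=> a0; have [m [q]] := multiplicity_XsubC a x; rewrite a0 implyTb => qx aE.
have -> : mup x a = m by rewrite aE mupMr // mup_XsubCX eqxx.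
have q0 : q != 0 by apply: contraNneq qx => ->; rewrite root0.
have tx0 : ct ch - jk x != 0.
  apply: (lead_neq0 frP (leadB (lead_t ch) (lead_k ch x))).
  by rewrite polyXsubC_eq0.
have qt0 : (map_poly jk q).[ct ch] != 0.
  apply: (lead_neq0 frP (lead_horner q (lead_t ch))).
  by rewrite comp_polyXr map_poly_eq0.
have wE : (map_poly jk a).[ct ch] = (map_poly jk q).[ct ch] * (ct ch - jk x) ^+ m.
  by rewrite aE rmorphM hornerM rmorphXn horner_exp /= rmorphB /= map_polyX map_polyC hornerXsubC.
have qe : (map_poly c q \Po 'X).[c x] != 0.
  by rewrite comp_polyXr horner_map fmorph_eq0 -rootE.
have tpo : po (pl ch (c x)) (ct ch - jk x) = 1 by rewrite -(cjc ch); apply: po_t.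
have E := poM (pl ch (c x)) qt0 (expf_neq0 m tx0).
have E1 := poX (pl ch (c x)) m tx0; rewrite tpo in E1.
have E2 := po_lead frP (lead_horner q (lead_t ch)) qe.
by rewrite -wE E1 E2 add0r in E; rewrite E natz.
Qed.

(** Substitute (X - v) / u for X in [chart_map]. With u and v taken from N this turns t_1 + t_2 and
    t_1 t_2 into chart parameters. *)
Lemma chart_affine (ch : chart) u v : u != 0 ->
  exists ch' : chart, ct ch' = cj ch u * ct ch + cj ch v.
Proof.
move=> u0; pose r : {poly N} := u^-1 *: 'X + (- (u^-1 * v))%:P.
have T_inj : injective (comp_poly r).
  apply: raddf_inj => q qr; apply/eqP/negPn/negP => q0.
  by have [/negP[]] := mup_affine (- (u^-1 * v)) 0 (invr_neq0 u0) q0; apply/eqP.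
pose T : {rmorphism B -> B} := map_fps (comp_poly r).
have [|||F [FE chF]] := @chart_map _ _ _ _ _ _ _ _ _ _ frP faP embE ch T (map_poly (comp_poly r)).
- move=> f g fg; apply: fpsP => j; apply: T_inj.
  exact: (congr1 (fun h : B => h`[j]) fg).
- by move=> a; apply: fpsP => j /=; rewrite coef_map.
- by move=> x; rewrite [LHS]map_fpsC /= comp_polyC.
have [||ch' [_ tE _]] := chF (cj ch u * ct ch + cj ch v) (cs ch).
- rewrite rmorphD rmorphM !ci_j ci_t -rmorphM -rmorphD FE.
  have -> : T (fconst u%:P * fconst 'X + fconst v%:P) = fconst ((u *: 'X + v%:P) \Po r).
    rewrite -rmorphM -rmorphD -mul_polyC; exact: (map_fpsC (comp_poly r)).
  congr (fr (fconst _)); rewrite comp_polyD comp_polyZ comp_polyX comp_polyC /r.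
  rewrite -!mul_polyC mulrDr mulrA -!polyCM mulrN !mulrA divff // mul1r mul1r.
  by rewrite polyCN -addrA addNr addr0.
- by rewrite ci_s FE; congr (fr _); apply: (map_fpsX (comp_poly r)).
by exists ch'.
Qed.
End ChartLemmas.

(** * Steinberg relations under an automorphism *)

Section SymbolTame.
Variables (l : nat) (K : fieldType) (p : place K).
Hypothesis N1_power : exists2 h : K, h != 0 & -1 = h ^+ l.
Hypothesis pos_pm : forall w, w != 0 -> 0 < po p w -> pm p w.
Local Notation cl := (@kM_class l K).
Local Notation V := (kM l K 1).

Lemma near_sub (A B C : K) : A != 0 -> B != 0 -> A + B = C -> 0 < po p A -> po p B = 0 ->
  [/\ C != 0, po p C = 0 & near_one l p (C / B)].
Proof.
move=> A0 B0 ABC pA pB; have AB0 : A / B != 0 by rewrite mulf_neq0 ?invr_eq0.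
have pAB : pm p (A / B).
  by apply: pos_pm => //; rewrite poM ?invr_eq0 // poV // pB oppr0 addr0.
have CE : C = B * (1 + A / B) by rewrite mulrDr mulr1 mulrCA divff // mulr1 addrC.
have [u0 pu] := pm_unit pAB; rewrite CE mulf_neq0 // poM // pB pu; split=> //.
by rewrite mulrAC divff // mul1r; apply: near_one_pm.
Qed.

Variable phi : {additive V -> V}.
Hypothesis phiM : forall x y : V, kM_mul x y = 0 -> kM_mul (phi x) (phi y) = 0.

(** Dividing by C gives the Steinberg relation {A/C, B/C} = 0. It is preserved by phi, and the tame
    symbol of its image is taken at a place where A' has order prime to l while B' and C' are
    units. *)
Lemma sym_tame (A B C A' B' C' : K) : A != 0 -> B != 0 -> C != 0 -> A' != 0 -> B' != 0 ->
  C' != 0 -> A + B = C ->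
  phi (cl A) = cl A' -> phi (cl B) = cl B' -> phi (cl C) = cl C' ->
  po p B' = 0 -> po p C' = 0 -> coprime `|po p A'|%N l -> near_one l p (B' / C').
Proof.
move=> A0 B0 C0 A'0 B'0 C'0 ABC pA pB pC poB poC poA.
have : kM_mul (cl (A' / C')) (cl (B' / C')) = 0.
  have <- : phi (cl (A / C)) = cl (A' / C') by rewrite !class_div // raddfB pA pC.
  have <- : phi (cl (B / C)) = cl (B' / C') by rewrite !class_div // raddfB pB pC.
  apply: phiM.
  by apply: kM_mul_steinberg; rewrite ?mulf_neq0 ?invr_eq0 // -mulrDl ABC divff.
move=> H; apply: (tame N1_power _ _ H).
- by rewrite mulf_neq0 ?invr_eq0.
- by rewrite mulf_neq0 ?invr_eq0.
- by rewrite poM ?invr_eq0 // poV // poB poC subr0.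
- by rewrite poM ?invr_eq0 // poV // poC subr0.
Qed.

(** If A itself vanishes at the place, B and C agree there as well, so the images of B and C may be
    compared with B and C. *)
Lemma near_tame (A B C A' B' C' : K) : A != 0 -> B != 0 -> A' != 0 -> B' != 0 ->
  C' != 0 -> A + B = C -> 0 < po p A -> po p B = 0 ->
  phi (cl A) = cl A' -> phi (cl B) = cl B' -> phi (cl C) = cl C' ->
  po p B' = 0 -> po p C' = 0 -> coprime `|po p A'|%N l ->
  near_one l p ((B' / C') * (C / B)).
Proof.
move=> A0 B0 A'0 B'0 C'0 ABC pA pB fA fB fC poB poC poA.
have [C0 _ nC] := near_sub A0 B0 ABC pA pB.
by apply: near_oneM nC; apply: (sym_tame A0 B0 C0 A'0 B'0 C'0 ABC).
Qed.
End SymbolTame.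

(** * Rigidity *)

Section KTheory.
Variables (l : nat) (k0 K0 k K N' N : fieldType).
Variables (iK : {rmorphism k0 -> K0}) (ik : {rmorphism k0 -> k}).
Variables (jK : {rmorphism K0 -> K}) (jk : {rmorphism k -> K}).
Variables (fN : {rmorphism {poly N'} -> N}) (fNP : is_frac fN).
Variables (c' : {rmorphism k -> N'}) (c : {rmorphism k -> N}).
Hypothesis cE : forall x, c x = fN (c' x)%:P.
Local Notation B := (fps {poly N}).
Local Notation A := {poly {poly N}}.
Variables (Q FA : fieldType) (fr : {rmorphism B -> Q}) (fa : {rmorphism A -> FA}).
Variables (emb : {rmorphism FA -> Q}).
Hypotheses (frP : is_frac fr) (faP : is_frac fa).
Hypothesis embE : forall a, emb (fa a) = fr (series _ a).
Hypothesis jKi : forall x, jK (iK x) = jk (ik x).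
Hypotheses (l_pr : prime l) (lN : l%:R != 0 :> N) (kc : GRing.closed_field_axiom k).
Hypotheses (c_pure : pure_ext l c) (k0_inf : infinite_field k0).
Notation chart := (chart jk c fr emb).
Notation pl ch e := (place_of frP ch e).
Local Notation cl := (@kM_class l K).
Local Notation V := (kM l K 1).
Let tau : N := fN 'X.
Let l_gt0 : (0 < l)%N := prime_gt0 l_pr.
Let l_gt1 : (1 < l)%N := prime_gt1 l_pr.

Definition peval (a : {poly k}) (w : K) : K := (map_poly jk a).[w].

Lemma pevalXsubC x w : peval ('X - x%:P) w = w - jk x.
Proof. by rewrite /peval rmorphB /= map_polyX map_polyC hornerXsubC. Qed.

Lemma N1_power : exists2 h : K, h != 0 & -1 = h ^+ l.
Proof.
have [y yE] := closed_nth_root kc l_gt0 (-1); exists (jk y); last first.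
  by rewrite -rmorphXn -yE rmorphN rmorph1.
rewrite fmorph_eq0; apply: contra_eqN yE => /eqP->.
by rewrite expr0n gtn_eqF // oppr_eq0 oner_eq0.
Qed.

Lemma class_const x : x != 0 -> cl (jk x) = 0.
Proof.
move=> x0; have [y yE] := closed_nth_root kc l_gt0 x.
have y0 : y != 0 by apply: contraNneq x0 => y0; rewrite yE y0 expr0n gtn_eqF.
by rewrite yE rmorphXn class_power // fmorph_eq0.
Qed.

Lemma class_scale x w : x != 0 -> w != 0 -> cl (jk x * w) = cl w.
Proof. by move=> x0 w0; rewrite classM ?fmorph_eq0 // class_const // add0r. Qed.

Lemma classN w : w != 0 -> cl (- w) = cl w.
Proof.
by move=> w0; rewrite -mulN1r -(rmorphN1 jk) class_scale // oppr_eq0 oner_eq0.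
Qed.

Lemma frac_eq0 q : (fN q == 0) = (q == 0).
Proof. exact: is_frac_eq0. Qed.

Lemma eval_frac (b : {poly k}) (u : {poly N'}) :
  (map_poly c b).[fN u] = fN (map_poly c' b \Po u).
Proof.
elim/poly_ind: b => [|b x IHb]; first by rewrite !map_poly0 horner0 comp_poly0 rmorph0.
rewrite !map_polyMXaddC hornerMXaddC comp_polyD comp_polyM comp_polyX comp_polyC IHb cE.
by rewrite rmorphD rmorphM.
Qed.

Lemma eval_tau (b : {poly k}) : (map_poly c b).[tau] = fN (map_poly c' b).
Proof. by rewrite eval_frac comp_polyXr. Qed.

(** Along s = 0 such a w is a coordinate on the X-line over N, so roots and multiplicities of a(w)
    can be read there. *)
Definition affine (ch : chart) w al be := lead ch w (al *: 'X + be%:P) /\ al != 0.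

Lemma peval_neq0 (ch : chart) w al be a : affine ch w al be -> a != 0 -> peval a w != 0.
Proof.
move=> [wl al0] a0; apply: (lead_neq0 frP (lead_horner a wl)).
have a0' : map_poly c a != 0 by rewrite map_poly_eq0.
exact: (mup_affine be 0 al0 a0').1.
Qed.

Lemma class_equiv (ch : chart) w al be a b : affine ch w al be -> a != 0 -> b != 0 ->
  (forall x, mup x a = mup x b %[mod l]) -> cl (peval a w) = cl (peval b w).
Proof.
move=> wa a0 b0 ab; have [u [v [u0 v0 E]]] := closed_poly_equiv kc l_gt0 a0 b0 ab.
have h p : p != 0 -> peval p w != 0 := peval_neq0 wa.
have : cl (peval (a * v ^+ l) w) = cl (peval (b * u ^+ l) w) by rewrite E.
rewrite /peval !rmorphM !hornerM !rmorphXn !horner_exp -!/(peval _ _).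
by rewrite !classM ?expf_neq0 ?h // !class_power ?h // !addr0.
Qed.

(** Along s = 0 the factor w - x vanishes at X = (x - be) / al, and the multiplicity of a at x
    reappears at that point. *)
Lemma class_mup (ch : chart) w al be a b x : affine ch w al be -> a != 0 -> b != 0 ->
  cl (peval a w) = cl (peval b w) -> mup x a = mup x b %[mod l].
Proof.
move=> wa a0 b0 E; have [wl al0] := wa.
have h p : p != 0 -> peval p w != 0 := peval_neq0 wa.
have [y _ yE] := class_eq (h a a0) (h b b0) E.
have n0 (p : {poly k}) : p != 0 -> map_poly c p != 0 by rewrite map_poly_eq0.
pose z := (c x - be) / al; have zE : al * z + be = c x by rewrite mulrC divfK // subrK.
have [a0' am] := mup_affine be z al0 (n0 a a0).
have [b0' bm] := mup_affine be z al0 (n0 b b0).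
have [u [v [u0 v0 uv]]] := lead_power frP l_gt0 (lead_horner a wl) (lead_horner b wl) a0' b0' yE.
have := mup_power z a0' b0' u0 v0 uv.
by rewrite am bm zE !mup_map.
Qed.

Lemma affine_sub_inj (ch : chart) w al be x y : affine ch w al be ->
  cl (w - jk x) = cl (w - jk y) -> x = y.
Proof.
rewrite -!pevalXsubC => wa /(class_mup x wa); rewrite !polyXsubC_eq0 => /(_ isT isT).
rewrite -['X - x%:P]expr1 -['X - y%:P]expr1 !mup_XsubCX eqxx.
by case: eqP => // _; rewrite modn_small // mod0n.
Qed.

Lemma affine_sub (ch : chart) w al be x : affine ch w al be -> w - jk x != 0.
Proof. by move=> wa; rewrite -pevalXsubC (peval_neq0 wa) ?polyXsubC_eq0. Qed.

Lemma affine_neq0 (ch : chart) w al be : affine ch w al be -> w != 0.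
Proof. by move=> /(affine_sub 0); rewrite rmorph0 subr0. Qed.

Lemma affine_class_neq0 (ch : chart) w al be x : affine ch w al be -> cl (w - jk x) != 0.
Proof.
move=> wa; apply/eqP => E; have := @class_mup ch w al be ('X - x%:P) 1 x wa.
rewrite polyXsubC_eq0 oner_eq0 pevalXsubC E /peval rmorph1 hornerC class1 => /(_ isT isT erefl).
by rewrite -['X - _]expr1 mup_XsubCX eqxx mupNroot ?root1 // modn_small // mod0n.
Qed.

Lemma affine_t (ch : chart) : affine ch (ct ch) 1 0.
Proof. by rewrite /affine scale1r polyC0 addr0 oner_eq0; split=> //; apply: lead_t. Qed.

Lemma fibrewise_class (ch : chart) w (E : k -> Prop) : w != 0 -> infinite_set E ->
  (forall e, E e -> near_one l (pl ch (c e)) w) ->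
  exists2 a, a != 0 & cl w = cl (peval a (ct ch)).
Proof.
move=> w0 Ei wE.
have [a [h [a0 h0 ->]]] := fibrewise_power faP embE l_gt0 lN (closed_nth_root kc l_gt0) c_pure w0 Ei wE.
exists a => //; rewrite classM ?expf_neq0 // ?class_power // ?addr0 //.
exact: (peval_neq0 (affine_t ch)).
Qed.

Lemma k0_infinite : infinite_set (fun e : k => exists a, e = ik a).
Proof.
have k0i : infinite_set (fun _ : k0 => True) by move=> t; have [e et] := k0_inf t; exists e.
by apply: infinite_set_sub (infinite_set_image (fmorph_inj ik) k0i) => _ [a _ ->]; exists a.
Qed.

Lemma avoid (E : k -> Prop) (r : {poly N}) (s : seq k) : r != 0 -> infinite_set E ->
  infinite_set (fun e => [/\ E e, r.[c e] != 0 & e \notin s]).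
Proof.
move=> r0 Ei; have := infinite_set_avoid s (infinite_set_nonroot (fmorph_inj c) r0 Ei).
by apply: infinite_set_sub => e [[]].
Qed.

Definition paired (ch1 ch2 : chart) := cj ch1 tau = ct ch2 /\ cj ch2 tau = ct ch1.

Lemma pairedC ch1 ch2 : paired ch1 ch2 -> paired ch2 ch1.
Proof. by case. Qed.

Lemma lead_other ch1 ch2 : paired ch1 ch2 -> lead ch1 (ct ch2) tau%:P.
Proof. by move=> [<- _]; apply: lead_j. Qed.

(** Modulo l-th powers w is both a(t_1) and b(t_2). Along s = 0 in the first chart, b(t_2) becomes
    b(tau), without zeros in X, so all multiplicities of a are multiples of l. *)
Lemma two_fibres ch1 ch2 w (E1 E2 : k -> Prop) : paired ch1 ch2 -> w != 0 ->
  infinite_set E1 -> infinite_set E2 ->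
  (forall e, E1 e -> near_one l (pl ch1 (c e)) w) ->
  (forall e, E2 e -> near_one l (pl ch2 (c e)) w) -> cl w = 0.
Proof.
move=> P w0 E1i E2i h1 h2.
have [a a0 wa] := fibrewise_class w0 E1i h1.
have [b b0 wb] := fibrewise_class w0 E2i h2.
have at0 := peval_neq0 (affine_t ch1) a0; have bt0 := peval_neq0 (affine_t ch2) b0.
have [h h0 hE] := class_eq at0 bt0 (etrans (esym wa) wb).
have la := lead_horner a (lead_t ch1); have lb := lead_horner b (lead_other P).
have la0 : map_poly c a \Po 'X != 0 by rewrite comp_polyXr map_poly_eq0.
rewrite comp_polyCr in lb.
have bt : (map_poly c b).[tau] != 0 by rewrite eval_tau frac_eq0 map_poly_eq0.
have lb0 : ((map_poly c b).[tau])%:P != 0 by rewrite polyC_eq0.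
have [u [v [u0 v0 uv]]] := lead_power frP l_gt0 la lb la0 lb0 hE.
rewrite wa -[RHS](class1 l K); have -> : 1 = peval 1 (ct ch1) by rewrite /peval rmorph1 hornerC.
apply: (class_equiv (affine_t ch1) a0 (oner_neq0 _)) => x.
have := mup_power (c x) la0 lb0 u0 v0 uv; rewrite comp_polyXr mup_map // => ->.
by rewrite !mupNroot ?root1 ?rootC.
Qed.

Section Automorphism.
Variable phi : {additive V -> V}.
Hypothesis phiM : forall x y : V, kM_mul x y = 0 -> kM_mul (phi x) (phi y) = 0.
Hypothesis phi_inj : injective phi.

Lemma phi_rep w : exists2 w', w' != 0 & phi (cl w) = cl w'.
Proof. exact: class_surj. Qed.

Lemma phi_const x : x != 0 -> phi (cl (jk x)) = cl 1.
Proof. by move=> x0; rewrite class_const // raddf0 class1. Qed.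

(** * Automorphisms that fix the classes of K0 *)

Section OverK0.
Hypothesis phiK0 : forall f, f != 0 -> phi (cl (jK f)) = cl (jK f).

(** For e in k0, (t - e) - (t - x) = x - e, where {t - e} is fixed and the right side has trivial
    class. So the image of {t - x} is an l-th power at almost every place t = e with e in k0. *)
Lemma phi_line (ch : chart) t x : ct ch = jK t ->
  exists2 a, a != 0 & phi (cl (jK t - jk x)) = cl (peval a (jK t)).
Proof.
move=> tE; have ta := affine_t ch; rewrite tE in ta.
have w0 := affine_sub x ta; set w := jK t - jk x in w0 *.
have [w' w'0 w'E] := phi_rep w; rewrite w'E -tE.
have [r r0 rP] := po_almost frP ch w'0.
apply: (fibrewise_class w'0 (avoid [:: x] r0 k0_infinite)) => _ [[a ->] ra ax].
rewrite inE in ax; have e0 : x - ik a != 0 by rewrite subr_eq0 eq_sym.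
have te0 := affine_sub (ik a) ta.
have pw' := rP _ ra.
have pt : po (pl ch (c (ik a))) (jK t - jk (ik a)) = 1 by rewrite -(cjc ch) -tE po_t.
rewrite -[w']divr1; apply: (sym_tame N1_power phiM te0 (B := - w) (C := jk (x - ik a)) _ _ te0).
- by rewrite oppr_eq0.
- by rewrite fmorph_eq0.
- exact: w'0.
- exact: oner_neq0.
- by rewrite /w rmorphB opprB addrC addrA subrK.
- have -> : jK t - jk (ik a) = jK (t - iK a) by rewrite rmorphB jKi.
  by apply: phiK0; rewrite -(fmorph_eq0 jK) rmorphB jKi.
- by rewrite classN.
- exact: phi_const.
- exact: pw'.
- exact: po1.
- by rewrite pt coprime1n.
Qed.

Lemma mup_XsubC (M : fieldType) (x y : M) : mup y ('X - x%:P) = (x == y).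
Proof. by rewrite -['X - _]expr1 mup_XsubCX; case: eqP. Qed.

Lemma coprime_po n : n != 0 %[mod l] -> coprime `|n%:Z|%N l.
Proof. by move=> nl; rewrite coprime_sym prime_coprime // /dvdn; move: nl; rewrite mod0n. Qed.

Section Pair.
Variables (ch1 ch2 : chart) (t1 t2 : K0).
Hypotheses (P : paired ch1 ch2) (t1E : ct ch1 = jK t1) (t2E : ct ch2 = jK t2).

Lemma t12_affine : affine ch1 (jK t1 + jK t2) 1 tau.
Proof.
rewrite /affine scale1r oner_eq0; split=> //; apply: leadD.
  by rewrite -t1E; apply: lead_t.
by rewrite -t2E; apply: lead_other.
Qed.

Lemma t1_other : lead ch2 (jK t1) tau%:P.
Proof. by rewrite -t1E; apply: lead_other; apply: pairedC. Qed.
Lemma t2_other : lead ch1 (jK t2) tau%:P.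
Proof. by rewrite -t2E; apply: lead_other. Qed.
Lemma t1_affine : affine ch1 (jK t1) 1 0.
Proof. by rewrite -t1E; apply: affine_t. Qed.
Lemma t2_affine : affine ch2 (jK t2) 1 0.
Proof. by rewrite -t2E; apply: affine_t. Qed.

Lemma tau_eval_neq0 a : a != 0 -> (map_poly c a).[tau] != 0.
Proof. by move=> a0; rewrite eval_tau frac_eq0 map_poly_eq0. Qed.

Lemma po_t2 : po (pl ch2 0) (jK t2) = 1.
Proof. by have := po_t frP ch2 0; rewrite rmorph0 subr0 t2E. Qed.

(** The relation t_2 + (t_1 - x) = t_1 + t_2 - x is carried by phi to classes of t_2, a(t_1) and
    b(t_1 + t_2); two places determine a and b. *)
Lemma line_image x : exists x', phi (cl (jK t1 - jk x)) = cl (jK t1 - jk x') /\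
  phi (cl (jK t1 + jK t2 - jk x)) = cl (jK t1 + jK t2 - jk x').
Proof.
have [a a0 aE] := phi_line x t1E.
have [ch' ch'E] := chart_affine frP faP embE ch1 tau (oner_neq0 N).
have {}ch'E : ct ch' = jK (t1 + t2) by rewrite ch'E P.1 rmorph1 mul1r rmorphD t1E t2E.
have [b b0] := phi_line x ch'E; rewrite rmorphD => bE.
have T1 := t1_affine; have T12 := t12_affine; have T2 := t2_affine.
have n1 := affine_sub x T1; have n12 := affine_sub x T12; have t20 := affine_neq0 T2.
have n1' := peval_neq0 T1 a0; have n12' := peval_neq0 T12 b0.
have ABC : jK t2 + (jK t1 - jk x) = jK t1 + jK t2 - jk x by rewrite addrCA addrA.
have phit2 : phi (cl (jK t2)) = cl (jK t2) by apply: phiK0; rewrite -(fmorph_eq0 jK).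
(* At t_2 = 0 the restrictions to s = 0 are a(tau) and b(tau), so a and b have equal multiplicities
   modulo l. *)
have ab y : mup y a = mup y b %[mod l].
  have la := lead_horner a t1_other; rewrite comp_polyCr in la.
  have lb := lead_horner b (leadD t1_other T2.1).
  set qb := _ \Po _ in lb.
  have qbE : qb.[0] = (map_poly c b).[tau].
    by rewrite horner_comp hornerD hornerC hornerD hornerZ hornerX hornerC mulr0 !addr0.
  have la0 : ((map_poly c a).[tau])%:P.[0] != 0 by rewrite hornerC tau_eval_neq0.
  have lb0 : qb.[0] != 0 by rewrite qbE tau_eval_neq0.
  have ne : near_one l (pl ch2 0) (peval a (jK t1) / peval b (jK t1 + jK t2)).
    apply: (sym_tame N1_power phiM t20 n1 n12 t20 n1' n12' ABC phit2 aE bE).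
    - exact: (po_lead frP la).
    - exact: (po_lead frP lb).
    by rewrite po_t2 coprime1n.
  have [v] := near_one_lead l_gt0 la lb la0 lb0 ne.
  rewrite hornerC qbE !eval_tau => vE.
  by have := ratf_mup (c' y) fNP _ _ vE; rewrite !map_poly_eq0 !mup_map //; apply.
(* Otherwise the image of {t_1 - x} would be trivial, against injectivity. *)
have [x' x'a] : exists x', mup x' a != 0 %[mod l].
  apply: contrapT => na; have /eqP := affine_class_neq0 x T1; apply; apply: phi_inj.
  rewrite aE raddf0 -[RHS](class1 l K).
  have -> : 1 = peval 1 (jK t1) by rewrite /peval rmorph1 hornerC.
  apply: (class_equiv T1 a0 (oner_neq0 _)) => y; rewrite [mup y 1]mupNroot ?root1 //.
  by apply/eqP/negPn/negP => ya; apply: na; exists y.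
(* At t_1 = x' the tame symbol compares tau with b(tau + x'), so modulo l the only root of b is x',
   with multiplicity 1. *)
have bx y : mup y b = (x' == y) %[mod l].
  have lt := t2_other; have lb := lead_horner b T12.1.
  have lt0 : (tau%:P).[c x'] != 0 by rewrite hornerC frac_eq0 polyX_eq0.
  set qb := _ \Po _ in lb.
  have qbE : qb.[c x'] = fN (map_poly c' b \Po (1 *: 'X + (c' x')%:P)).
    rewrite horner_comp hornerD hornerZ hornerX hornerC mul1r cE -rmorphD -eval_frac.
    by rewrite scale1r addrC.
  have b0' : map_poly c' b != 0 by rewrite map_poly_eq0.
  have [bc0 bcE] := mup_affine (c' x') (c' y - c' x') (oner_neq0 N') b0'.
  have lb0 : qb.[c x'] != 0 by rewrite qbE frac_eq0.
  have ne : near_one l (pl ch1 (c x')) (jK t2 / peval b (jK t1 + jK t2)).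
    apply: (sym_tame N1_power phiM n1 t20 n12 n1' t20 n12' _ aE phit2 bE).
    - by rewrite addrC.
    - exact: (po_lead frP lt).
    - exact: (po_lead frP lb).
    by rewrite -t1E /peval po_polyt // coprime_po.
  have [v] := near_one_lead l_gt0 lt lb lt0 lb0 ne.
  rewrite hornerC qbE => vE.
  have := ratf_mup (c' y - c' x') fNP _ bc0 vE; rewrite polyX_eq0 => /(_ isT).
  rewrite bcE mul1r subrK mup_map // -['X]subr0 -polyC0 mup_XsubC => <-.
  by rewrite eq_sym subr_eq0 (inj_eq (fmorph_inj c')) eq_sym.
exists x'; rewrite aE bE -!pevalXsubC; split.
  apply: (class_equiv T1) => [//||y]; first by rewrite polyXsubC_eq0.
  by rewrite mup_XsubC ab bx.
apply: (class_equiv T12) => [//||y]; first by rewrite polyXsubC_eq0.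
by rewrite mup_XsubC bx.
Qed.
End Pair.

Section Sigma.
Variables (ch1 ch2 : chart) (t1 t2 : K0).
Hypotheses (P : paired ch1 ch2) (t1E : ct ch1 = jK t1) (t2E : ct ch2 = jK t2).

Lemma line_sigma : exists s : k -> k, forall x,
  [/\ phi (cl (jK t1 - jk x)) = cl (jK t1 - jk (s x)),
      phi (cl (jK t2 - jk x)) = cl (jK t2 - jk (s x)) &
      phi (cl (jK t1 + jK t2 - jk x)) = cl (jK t1 + jK t2 - jk (s x))].
Proof.
suff /choice[s sP] : forall x, exists y,
  [/\ phi (cl (jK t1 - jk x)) = cl (jK t1 - jk y),
      phi (cl (jK t2 - jk x)) = cl (jK t2 - jk y) &
      phi (cl (jK t1 + jK t2 - jk x)) = cl (jK t1 + jK t2 - jk y)] by exists s.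
move=> x; have [y [y1 y12]] := line_image P t1E t2E x.
have [y' [y'2 y'12]] := line_image (pairedC P) t2E t1E x.
(* The class of t_1 + t_2 - x is common to the lines for t_1 and for t_2, and ties the two values
   together. *)
have yy' : y = y'.
  apply: (affine_sub_inj (t12_affine P t1E t2E)); rewrite -y12 -[RHS]/(cl (jK t1 + jK t2 - jk y')).
  by rewrite [jK t1 + jK t2]addrC.
by exists y; split=> //; rewrite yy'.
Qed.

Variable s : k -> k.
Hypothesis sP : forall x,
  [/\ phi (cl (jK t1 - jk x)) = cl (jK t1 - jk (s x)),
      phi (cl (jK t2 - jk x)) = cl (jK t2 - jk (s x)) &
      phi (cl (jK t1 + jK t2 - jk x)) = cl (jK t1 + jK t2 - jk (s x))].

Let T1 := t1_affine t1E.
Let T2 := t2_affine t2E.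
Let T12 := t12_affine P t1E t2E.

Lemma sigma_ik a : s (ik a) = ik a.
Proof.
apply: (affine_sub_inj T1); have [<- _ _] := sP (ik a).
rewrite -jKi -rmorphB; apply: phiK0; rewrite -(fmorph_eq0 jK) rmorphB jKi.
exact: affine_sub T1.
Qed.

Lemma sigma0 : s 0 = 0. Proof. by have := sigma_ik 0; rewrite rmorph0. Qed.
Lemma sigma1 : s 1 = 1. Proof. by have := sigma_ik 1; rewrite rmorph1. Qed.

Lemma po_sub x : po (pl ch1 (c x)) (jK t1 - jk x) = 1.
Proof. by rewrite -(cjc ch1) -t1E po_t. Qed.

Lemma lead_t2_sub x : lead ch1 (jK t2 - jk x) (fN ('X - (c' x)%:P))%:P.
Proof.
rewrite rmorphB polyCB -cE; apply: leadB; last exact: lead_k.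
exact: (t2_other P t2E).
Qed.

(** At t_1 = s x the relation for t_1 + t_2 compares tau - s y with tau - (s (x + y) - s x). *)
Lemma sigma_add x y : s (x + y) = s x + s y.
Proof.
have [x1 _ _] := sP x; have [_ y2 _] := sP y; have [_ _ xy] := sP (x + y).
have lt := lead_t2_sub (s y); set z := s (x + y) - s x.
have lc := leadB T12.1 (lead_k ch1 (s (x + y))).
set q : {poly N} := 1 *: 'X + tau%:P - (c (s (x + y)))%:P in lc.
have qE : q.[c (s x)] = fN ('X - (c' z)%:P).
  rewrite /q !hornerD hornerZ hornerX hornerN !hornerC mul1r rmorphB -cE /z rmorphB -/tau.
  by move: (c _) (c _) => u v; ring.
have lt0 : ((fN ('X - (c' (s y))%:P))%:P).[c (s x)] != 0.
  by rewrite hornerC frac_eq0 polyXsubC_eq0.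
have lc0 : q.[c (s x)] != 0 by rewrite qE frac_eq0 polyXsubC_eq0.
have ne : near_one l (pl ch1 (c (s x)))
    ((jK t2 - jk (s y)) / (jK t1 + jK t2 - jk (s (x + y)))).
  apply: (sym_tame N1_power phiM (affine_sub x T1) (affine_sub y T2) (affine_sub (x + y) T12)
    (affine_sub (s x) T1) (affine_sub (s y) T2) (affine_sub (s (x + y)) T12) _ x1 y2 xy).
  - by rewrite rmorphD opprD addrACA.
  - exact: (po_lead frP lt lt0).
  - exact: (po_lead frP lc lc0).
  by rewrite po_sub coprime1n.
have [v] := near_one_lead l_gt0 lt lc lt0 lc0 ne; rewrite hornerC qE => vE.
have := ratf_mup (c' (s y)) fNP _ _ vE; rewrite !polyXsubC_eq0 !mup_XsubC eqxx => /(_ isT isT).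
rewrite (inj_eq (fmorph_inj c')); case: eqP => [zE _|_]; last by rewrite modn_small // mod0n.
by rewrite -zE /z [RHS]addrC subrK.
Qed.

Lemma sigma_neq0 x : x != 0 -> s x != 0.
Proof.
apply: contraNneq => sx0; apply/eqP/(affine_sub_inj T1)/phi_inj.
by have [-> _ _] := sP x; have [-> _ _] := sP 0; rewrite sx0 sigma0.
Qed.

Lemma t1t2_affine : affine ch1 (jK t1 * jK t2) tau 0.
Proof.
rewrite /affine frac_eq0 polyX_eq0 addr0 -mul_polyC mulrC; split=> //.
by apply: leadM; [exact: (t2_other P t2E) | rewrite -t1E; apply: lead_t].
Qed.

(** At t_1 = s d the relation (t_1 - d) t_2 + d (t_2 - y) = t_1 t_2 - d y compares tau - s y with
    b(s d tau). Hence b has, modulo l, the simple root s d * s y and no other. *)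
Lemma mup_sigma_mul d y b : d != 0 -> b != 0 ->
  phi (cl (jK t1 * jK t2 - jk (d * y))) = cl (peval b (jK t1 * jK t2)) ->
  forall z, mup (s d * z) b = (s y == z) %[mod l].
Proof.
move=> d0 b0 bE z; have TT := t1t2_affine.
have [dE _ _] := sP d; have [_ yE _] := sP y; have sd0 := sigma_neq0 d0.
have T20 := affine_neq0 T2; have n1 := affine_sub d T1; have n1' := affine_sub (s d) T1.
have n2 := affine_sub y T2; have n2' := affine_sub (s y) T2.
have lt := lead_t2_sub (s y); have lc := lead_horner b TT.1.
set q : {poly N} := map_poly c b \Po _ in lc.
have qE : q.[c (s d)] = fN (map_poly c' b \Po (c' (s d) *: 'X + 0%:P)).
  rewrite horner_comp hornerD hornerZ hornerX hornerC -eval_frac rmorphD -mul_polyC rmorphM.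
  by rewrite -cE polyC0 rmorph0 mulrC.
have b0' : map_poly c' b != 0 by rewrite map_poly_eq0.
have sd0' : c' (s d) != 0 by rewrite fmorph_eq0.
have [bc0 bcE] := mup_affine 0 (c' z) sd0' b0'.
have lt0 : ((fN ('X - (c' (s y))%:P))%:P).[c (s d)] != 0.
  by rewrite hornerC frac_eq0 polyXsubC_eq0.
have lc0 : q.[c (s d)] != 0 by rewrite qE frac_eq0.
have lt2 : (tau%:P).[c (s d)] != 0 by rewrite hornerC frac_eq0 polyX_eq0.
have ne : near_one l (pl ch1 (c (s d))) ((jK t2 - jk (s y)) / peval b (jK t1 * jK t2)).
  apply: (sym_tame N1_power phiM (A := (jK t1 - jk d) * jK t2) (B := jk d * (jK t2 - jk y))
    (C := jK t1 * jK t2 - jk (d * y)) (A' := (jK t1 - jk (s d)) * jK t2)).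
  - by rewrite mulf_neq0.
  - by rewrite mulf_neq0 // fmorph_eq0.
  - exact: affine_sub TT.
  - by rewrite mulf_neq0.
  - exact: n2'.
  - exact: (peval_neq0 TT).
  - by rewrite rmorphM; move: (jK t1) (jK t2) (jk d) (jk y) => *; ring.
  - rewrite !classM // raddfD dE phiK0 //.
    by rewrite -(fmorph_eq0 jK).
  - by rewrite class_scale.
  - exact: bE.
  - exact: (po_lead frP lt lt0).
  - exact: (po_lead frP lc lc0).
  by rewrite poM // po_sub (po_lead frP (t2_other P t2E) lt2) addr0 coprime1n.
have [v] := near_one_lead l_gt0 lt lc lt0 lc0 ne; rewrite hornerC qE => vE.
have := ratf_mup (c' z) fNP _ bc0 vE; rewrite polyXsubC_eq0 mup_XsubC => /(_ isT).
by rewrite (inj_eq (fmorph_inj c')) bcE addr0 -rmorphM mup_map.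
Qed.

(** The polynomial b attached to x y is computed twice, from the factorisations x * y and 1 * (x y);
    its only root modulo l is then both s x * s y and s (x y). *)
Lemma sigma_mul x y : s (x * y) = s x * s y.
Proof.
have [->|x0] := eqVneq x 0; first by rewrite mul0r sigma0 mul0r.
have [ch' ch'E] := chart_affine frP faP embE ch1 0 (t1t2_affine).2.
have {}ch'E : ct ch' = jK (t1 * t2).
  by rewrite ch'E P.1 rmorph0 addr0 t1E t2E rmorphM mulrC.
have [b b0] := phi_line (x * y) ch'E; rewrite rmorphM => bE.
have h1 := mup_sigma_mul x0 b0 bE (s y).
have bE' : phi (cl (jK t1 * jK t2 - jk (1 * (x * y)))) = cl (peval b (jK t1 * jK t2)).
  by rewrite mul1r.
have := mup_sigma_mul (oner_neq0 k) b0 bE' (s x * s y).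
rewrite sigma1 mul1r h1 eqxx; case: eqP => // _.
by rewrite modn_small // mod0n.
Qed.
End Sigma.

(** For e = x u with u in k0, adding u^-1 (t - e) g to w cancels g x and replaces f by f + u^-1 t g,
    a case covered by [IH]. The added term has order 1 at t = e, where [near_tame] compares w' with
    w; there are infinitely many such e because k0 is infinite. *)
Lemma term_near (ch : chart) t f g x S w' : ct ch = jK t ->
  (forall y, phi (cl (jK t - jk y)) = cl (jK t - jk y)) -> g != 0 -> x != 0 ->
  (forall f1, jK f1 + S != 0 -> phi (cl (jK f1 + S)) = cl (jK f1 + S)) ->
  let w := jK f + (jK g * jk x + S) in w != 0 -> w' != 0 -> phi (cl w) = cl w' ->
  exists2 E, infinite_set E & forall e, E e -> near_one l (pl ch (c e)) (w' / w).
Proof.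
move=> tE tfix g0 x0 IH w w0 w'0 ww'.
have ta := affine_t ch; rewrite tE in ta.
have [r rn rP] := po_almost frP ch w0; have [r' r'n r'P] := po_almost frP ch w'0.
have jg0 : jK g != 0 by rewrite fmorph_eq0.
have [r2 r2n r2P] := po_almost frP ch jg0.
have rr0 : r * r' * r2 != 0 by rewrite !mulf_neq0.
have E0 : infinite_set (fun e => exists2 u, u != 0 & e = x * ik u).
  have k0i : infinite_set (fun _ : k0 => True) by move=> q; have [e et] := k0_inf q; exists e.
  have mI : injective (fun u => x * ik u) by move=> u v /(mulfI x0) /fmorph_inj.
  apply: infinite_set_sub (infinite_set_image mI (infinite_set_avoid [:: 0] k0i)).
  by move=> _ [u [_ u0] ->]; exists u => //; rewrite inE in u0.
exists (fun e => [/\ exists2 u, u != 0 & e = x * ik u, (r * r' * r2).[c e] != 0 & e \notin [::]]).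
  exact: avoid.
move=> e [[u u0 eE]]; rewrite !hornerM !mulf_eq0 => /norP[/norP[/rP pw /r'P pw'] /r2P pg] _.
have te0 := affine_sub e ta.
have iu0 : jk (ik u^-1) != 0 by rewrite !fmorph_eq0 invr_eq0.
pose A := jk (ik u^-1) * ((jK t - jk e) * jK g).
have A0 : A != 0 by rewrite !mulf_neq0.
have pt : po (pl ch (c e)) (jK t - jk e) = 1 by rewrite -(cjc ch) -tE po_t.
have pA : po (pl ch (c e)) A = 1.
  rewrite /A poM ?mulf_neq0 // poM // pt pg addr0 -(cjc ch).
  rewrite (po_lead frP (lead_j ch (c (ik u^-1)))) ?add0r // hornerC !fmorph_eq0.
  by rewrite invr_eq0.
have CE : A + w = jK (f + iK u^-1 * t * g) + S.
  have -> : w = jK f + (jK g * (jk (ik u^-1) * jk e) + S).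
    by rewrite -rmorphM eE mulrCA -rmorphM mulVf // rmorph1 mulr1.
  rewrite /A rmorphD !rmorphM jKi.
  by move: (jk _) (jk _) (jK f) (jK t) (jK g) => *; ring.
have pmc z : z != 0 -> 0 < po (pl ch (c e)) z -> pm (pl ch (c e)) z by apply: po_pm.
have pA0 : 0 < po (pl ch (c e)) A by rewrite pA.
have [C0 pC _] := near_sub l pmc A0 w0 erefl pA0 pw.
have phiA : phi (cl A) = cl A.
  by rewrite class_scale ?mulf_neq0 // ?fmorph_eq0 ?invr_eq0 // classM // raddfD tfix phiK0.
have phiC : phi (cl (A + w)) = cl (A + w) by rewrite CE; apply: IH; rewrite -CE.
have := near_tame N1_power pmc phiM A0 w0 A0 w'0 C0 erefl pA0 pw phiA ww' phiC pw' pC.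
by rewrite pA coprime1n => /(_ isT); rewrite mulrA divfK.
Qed.

(** The induction keeps f arbitrary, because removing a term changes f. *)
Lemma fixed_all ch1 ch2 t1 t2 : paired ch1 ch2 -> ct ch1 = jK t1 -> ct ch2 = jK t2 ->
  (forall y, phi (cl (jK t1 - jk y)) = cl (jK t1 - jk y)) ->
  (forall y, phi (cl (jK t2 - jk y)) = cl (jK t2 - jk y)) ->
  forall q f, jK f + tensor_elt jK jk q != 0 ->
    phi (cl (jK f + tensor_elt jK jk q)) = cl (jK f + tensor_elt jK jk q).
Proof.
move=> P t1E t2E fix1 fix2; elim=> [|[g x] q IHq] f.
  by rewrite /tensor_elt big_nil addr0 fmorph_eq0; apply: phiK0.
have -> : tensor_elt jK jk ((g, x) :: q) = jK g * jk x + tensor_elt jK jk q.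
  by rewrite /tensor_elt big_cons.
have [->|g0] := eqVneq g 0; first by rewrite rmorph0 mul0r add0r; apply: IHq.
have [->|x0] := eqVneq x 0; first by rewrite rmorph0 mulr0 add0r; apply: IHq.
set w := jK f + _ => w0; have [w' w'0 ww'] := phi_rep w.
have [E1 E1i h1] := term_near t1E fix1 g0 x0 IHq w0 w'0 ww'.
have [E2 E2i h2] := term_near t2E fix2 g0 x0 IHq w0 w'0 ww'.
have ww0 : w' / w != 0 by rewrite mulf_neq0 ?invr_eq0.
have := two_fibres P ww0 E1i E2i h1 h2.
by rewrite ww' class_div // => /eqP; rewrite subr_eq0 => /eqP.
Qed.
End OverK0.

(** Put T = t_1 - y and U = t_1 - x with y = x + 1, so U = T + 1. The element C is used in two ways:
    as T (t_2 + F) + t_2 at t_1 = y, to see that its class is fixed, and as U t_2 + T F at t_1 = x,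
    to compare the image of F with F. *)
Lemma leading_constant_near ch1 ch2 t1 t2 f f0 w' : paired ch1 ch2 -> ct ch1 = jK t1 -> ct ch2 = jK t2 ->
  (forall u al be, affine ch1 (jK u) al be \/ affine ch2 (jK u) al be ->
    exists m, phi (cl (jK u)) = cl (jK u) *+ m) ->
  (forall a, phi (cl (jK t1 - jk (ik a))) = cl (jK t1 - jk (ik a))) ->
  phi (cl (jK t2)) = cl (jK t2) ->
  f != 0 -> lead ch1 (jK f) (c f0)%:P -> lead ch2 (jK f) (c f0)%:P ->
  w' != 0 -> phi (cl (jK f)) = cl w' ->
  exists2 E, infinite_set E & forall e, E e -> near_one l (pl ch1 (c e)) (w' / jK f).
Proof.
move=> P t1E t2E H1 fix1 fix2 f_n0 lf1 lf2 w'0 fw'.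
have T1 := t1_affine t1E; have T2 := t2_affine t2E; have T20 := affine_neq0 T2.
have lt2 := t2_other P t2E; set F := jK f in lf1 lf2 fw' *.
have F0 : F != 0 by rewrite fmorph_eq0.
have [r rn rP] := po_almost frP ch1 F0; have [r' r'n r'P] := po_almost frP ch1 w'0.
have rr0 : r * r' != 0 by rewrite mulf_neq0.
exists (fun e => [/\ exists a, e = ik a, (r * r').[c e] != 0 & e \notin [::]]).
  exact: avoid rr0 k0_infinite.
move=> _ [[a ->]]; rewrite hornerM mulf_eq0 => /norP[/rP pF /r'P pw'] _.
set x := ik a; pose y := ik (a + 1).
have yx : y = x + 1 by rewrite /y rmorphD rmorph1.
pose T := jK t1 - jk y; pose U := jK t1 - jk x.
have T0 : T != 0 := affine_sub y T1; have U0 : U != 0 := affine_sub x T1.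
pose C := U * jK t2 + T * F.
have tf : tau + c f0 = fN ('X + (c' f0)%:P) by rewrite rmorphD cE.
(* This is the slope of C in X. As tau is transcendental over k, it is nonzero for every f0,
   including 0. *)
have tf0 : tau + c f0 != 0.
  by rewrite tf frac_eq0 -[(c' f0)%:P]opprK -polyCN polyXsubC_eq0.
have lT z : lead ch1 (jK t1 - jk z) ('X - (c z)%:P).
  by apply: leadB; [rewrite -t1E; apply: lead_t | apply: lead_k].
have CA : affine ch1 C (tau + c f0) (- (c x * tau + c y * c f0)).
  split=> //; have := leadD (leadM (lT x) lt2) (leadM (lT y) lf1).
  congr (lead _ _ _); rewrite -mul_polyC polyCN !polyCD !polyCM.
  by move: (tau%:P) ((c _)%:P) ((c _)%:P) ((c _)%:P) => *; ring.
have C0 := affine_neq0 CA.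
have CK : C = jK ((t1 - iK a) * t2 + (t1 - iK (a + 1)) * f).
  by rewrite (rmorphD jK) !(rmorphM jK) !(rmorphB jK) !jKi.
have [m mE] : exists m, phi (cl C) = cl C *+ m.
  by rewrite CK; apply: H1; left; rewrite -CK; apply: CA.
have T2F : affine ch2 (jK t2 + F) 1 (c f0).
  split; last exact: oner_neq0.
  have -> : 1 *: 'X + (c f0)%:P = (1 *: 'X + 0%:P) + (c f0)%:P by rewrite polyC0 addr0.
  by apply: leadD lf2; have [] := T2.
have T2F0 := affine_neq0 T2F.
have [m' m'E] : exists m, phi (cl (jK t2 + F)) = cl (jK t2 + F) *+ m.
  by rewrite -rmorphD; apply: H1; right; rewrite rmorphD; apply: T2F.
have phiT : phi (cl T) = cl T := fix1 (a + 1).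
have phiU : phi (cl U) = cl U := fix1 a.
have poT : po (pl ch1 (c y)) T = 1 by apply: po_sub.
have poU : po (pl ch1 (c x)) U = 1 by apply: po_sub.
have lt20 z : (tau%:P).[z] != 0 by rewrite hornerC frac_eq0 polyX_eq0.
have cyx : c y - c x = 1 by rewrite -rmorphB yx addrAC subrr add0r rmorph1.
(* A priori phi multiplies the class of C by some m. At t_1 = y both t_2 and C restrict to tau, so
   tau and tau^m agree modulo l-th powers and m is 1 modulo l. *)
have phiC : phi (cl C) = cl C.
  have lF2 := leadD lt2 lf1.
  have lF2n : (tau%:P + (c f0)%:P).[c y] != 0 by rewrite -polyCD hornerC.
  have qE : ((tau + c f0) *: 'X + (- (c x * tau + c y * c f0))%:P).[c y] = tau.
    rewrite hornerD hornerZ hornerX hornerC -[RHS]mul1r -cyx.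
    by move: (c x) (c y) (c f0) (tau) => *; ring.
  have lCm := leadX m CA.1.
  set q : {poly N} := (_ + _) ^+ m in lCm.
  have qmE : q.[c y] = tau ^+ m by rewrite horner_exp qE.
  have q0 : q.[c y] != 0 by rewrite qmE expf_neq0 // frac_eq0 polyX_eq0.
  have ne : near_one l (pl ch1 (c y)) (jK t2 / C ^+ m).
    have F'0 : (jK t2 + F) ^+ m' != 0 by rewrite expf_neq0.
    have hA := mulf_neq0 T0 T2F0; have hA' := mulf_neq0 T0 F'0.
    have hC : C ^+ m != 0 by rewrite expf_neq0.
    have E1 : T * (jK t2 + F) + jK t2 = C.
      rewrite /C; have -> : U = T + 1 by rewrite /U /T yx rmorphD rmorph1 opprD addrA subrK.
      by move: (jK t2) (T) (F) => *; ring.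
    have E2 : phi (cl (T * (jK t2 + F))) = cl (T * (jK t2 + F) ^+ m').
      by rewrite (classM l T0 T2F0) raddfD phiT m'E (classM l T0 F'0) (classX l m' T2F0).
    have E3 : phi (cl C) = cl (C ^+ m) by rewrite mE (classX l m C0).
    apply: (sym_tame N1_power phiM hA T20 C0 hA' T20 hC E1 E2 fix2 E3).
    - exact: (po_lead frP lt2 (lt20 _)).
    - exact: (po_lead frP lCm q0).
    rewrite (poM _ T0 F'0) poT (poX _ m' T2F0) (po_lead frP lF2 lF2n) mul0rn addr0.
    exact: coprime1n.
  have [v] := near_one_lead l_gt0 lt2 lCm (lt20 _) q0 ne; rewrite hornerC qmE -rmorphXn => vE.
  have := ratf_mup 0 fNP _ _ vE; rewrite polyX_eq0 expf_eq0 polyX_eq0 andbF => /(_ isT isT).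
  rewrite mup_exp ?polyX_eq0 // -['X]subr0 -polyC0 mup_XsubC eqxx muln1 => m1.
  by rewrite mE -kM_mulrn_mod -m1 modn_small.
(* From here on the place is t_1 = x, where U vanishes and T takes the value -1. *)
have lTx : ('X - (c y)%:P).[c x] != 0.
  by rewrite hornerXsubC -opprB cyx oppr_eq0 oner_eq0.
have poTx := po_lead frP (lT y) lTx.
have B0 : T * F != 0 by rewrite mulf_neq0.
have A0 : U * jK t2 != 0 by rewrite mulf_neq0.
have B'0 : T * w' != 0 by rewrite mulf_neq0.
have poA : po (pl ch1 (c x)) (U * jK t2) = 1.
  by rewrite poM // poU (po_lead frP lt2 (lt20 _)) addr0.
have poB : po (pl ch1 (c x)) (T * F) = 0 by rewrite poM // [po _ T]poTx pF addr0.
have poB' : po (pl ch1 (c x)) (T * w') = 0 by rewrite poM // [po _ T]poTx pw' addr0.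
have pmc z : z != 0 -> 0 < po (pl ch1 (c x)) z -> pm (pl ch1 (c x)) z by apply: po_pm.
have poA0 : 0 < po (pl ch1 (c x)) (U * jK t2) by rewrite poA.
have [_ poC _] := near_sub l pmc A0 B0 erefl poA0 poB.
have phiA : phi (cl (U * jK t2)) = cl (U * jK t2) by rewrite classM // raddfD phiU fix2.
have phiB : phi (cl (T * F)) = cl (T * w') by rewrite !classM // raddfD phiT fw'.
have := near_tame N1_power pmc phiM A0 B0 A0 B'0 C0 erefl poA0 poB phiA phiB phiC poB' poC.
rewrite poA coprime1n => /(_ isT); congr (near_one _ _ _).
rewrite -/C; move: T0 F0 C0; move: (C) (T) (F) => D T3 F3 h1 h2 h3.
by field; rewrite h1 h2 h3.
Qed.

Lemma fixes_K0 ch1 ch2 t1 t2 : paired ch1 ch2 -> ct ch1 = jK t1 -> ct ch2 = jK t2 ->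
  (forall u al be, affine ch1 (jK u) al be \/ affine ch2 (jK u) al be ->
    exists m, phi (cl (jK u)) = cl (jK u) *+ m) ->
  (forall a, phi (cl (jK t1 - jk (ik a))) = cl (jK t1 - jk (ik a)) /\
    phi (cl (jK t2 - jk (ik a))) = cl (jK t2 - jk (ik a))) ->
  (forall f, exists g h g0 h0, [/\ h != 0, f = g / h,
      lead ch1 (jK g) (c g0)%:P /\ lead ch2 (jK g) (c g0)%:P &
      lead ch1 (jK h) (c h0)%:P /\ lead ch2 (jK h) (c h0)%:P]) ->
  forall f, f != 0 -> phi (cl (jK f)) = cl (jK f).
Proof.
move=> P t1E t2E H1 fix12 H f f0.
have fix0 i : (i = t1 \/ i = t2) -> phi (cl (jK i)) = cl (jK i).
  by case=> ->; have [] := fix12 0; rewrite !rmorph0 !subr0.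
(* The comparison is made in both charts, with the roles of t_1 and t_2 exchanged, so that
   [two_fibres] applies. *)
have step g g0 : g != 0 -> lead ch1 (jK g) (c g0)%:P -> lead ch2 (jK g) (c g0)%:P ->
    phi (cl (jK g)) = cl (jK g).
  move=> gn0 l1 l2; have [w' w'0 gw'] := phi_rep (jK g).
  have jg0 : jK g != 0 by rewrite fmorph_eq0.
  have [E1 E1i h1] := leading_constant_near P t1E t2E H1 (fun a => (fix12 a).1) (fix0 t2 (or_intror erefl))
    gn0 l1 l2 w'0 gw'.
  have H1' u al be : affine ch2 (jK u) al be \/ affine ch1 (jK u) al be ->
      exists m, phi (cl (jK u)) = cl (jK u) *+ m.
    by move=> h; apply: (H1 u al be); case: h; [right | left].
  have [E2 E2i h2] := leading_constant_near (pairedC P) t2E t1E H1' (fun a => (fix12 a).2)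
    (fix0 t1 (or_introl erefl)) gn0 l2 l1 w'0 gw'.
  have ww0 : w' / jK g != 0 by rewrite mulf_neq0 ?invr_eq0.
  have := two_fibres P ww0 E1i E2i h1 h2.
  by rewrite gw' class_div // => /eqP; rewrite subr_eq0 => /eqP.
have [g [h [g0 [h0 [hn0 fE [lg1 lg2] [lh1 lh2]]]]]] := H f.
have gn0 : g != 0 by apply: contraNneq f0 => g00; rewrite fE g00 mul0r.
rewrite fE fmorph_div class_div ?fmorph_eq0 // raddfB.
by rewrite (step g g0) // (step h h0).
Qed.

(** The generators are constant multiples of u and of u - e/a, so every class in the subgroup is
    that of a polynomial in u whose roots modulo l are among 0 and the e/a. *)
Lemma line_rep (ch : chart) u al be (s : seq k0) a t v : affine ch (jK u) al be -> a != 0 ->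
  t = iK a * u -> v \in @line_subgroup l k0 K0 K iK jK s t ->
  exists b, [/\ b != 0, v = cl (peval b (jK u)) &
    forall x, x \notin 0 :: [seq ik (e / a) | e <- s] -> mup x b = 0%N %[mod l]].
Proof.
move=> uA a0 tE; pose S x := x \notin 0 :: [seq ik (e / a) | e <- s].
pose H : {pred V} := fun v => `[< exists b, [/\ b != 0, v = cl (peval b (jK u)) &
  forall x, S x -> mup x b = 0%N %[mod l]] >].
have h p : p != 0 -> peval p (jK u) != 0 := peval_neq0 uA.
have Hz : zmod_closed H.
  split=> [|_ _ /asboolP[b [b0 -> bS]] /asboolP[d [d0 -> dS]]]; apply/asboolP.
    exists 1; rewrite oner_neq0 /peval rmorph1 hornerC class1; split=> // x _.
    by rewrite mupNroot ?root1.
  exists (b * d ^+ l.-1); have dl := expf_neq0 l.-1 d0; split; first exact: mulf_neq0.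
    have pE : peval (b * d ^+ l.-1) (jK u) = peval b (jK u) * peval d (jK u) ^+ l.-1.
      by rewrite /peval rmorphM hornerM rmorphXn horner_exp.
    have E : cl (peval d (jK u)) *+ l.-1 = - cl (peval d (jK u)).
      by apply/eqP; rewrite -addr_eq0 addrC -mulrS prednK // -classX ?h // class_power ?h.
    by rewrite pE classM ?expf_neq0 ?h // classX ?h // E.
  move=> x Sx; rewrite mupM // mup_exp // -modnDm bS // -modnMmr dS //.
  by rewrite !(mod0n, muln0, addn0, add0n).
pose Hp := GRing.isZmodClosed.Build V H Hz.
pose HZ : zmodClosed V := HB.pack H Hp.
move=> vl; apply/asboolP; move: v vl; apply: (span_min (H := HZ)) => v vE; apply/asboolP.
have ia0 : ik a != 0 by rewrite fmorph_eq0.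
have u0 := affine_neq0 uA.
case: vE => [->|[e es ->]].
  exists 'X; rewrite polyX_eq0; split=> // [|x Sx].
    by rewrite /peval map_polyX hornerX tE rmorphM jKi class_scale.
  rewrite -['X]subr0 -polyC0 mup_XsubC; case: eqP => // x0.
  by move: Sx; rewrite /S -x0 mem_head.
exists ('X - (ik (e / a))%:P); rewrite polyXsubC_eq0; split=> // [|x Sx].
  rewrite pevalXsubC -(class_scale ia0 (affine_sub (ik (e / a)) uA)).
  congr cl; rewrite mulrBr -[jk _ * jk _]rmorphM -rmorphM [a * _]mulrC divfK // tE.
  by rewrite rmorphB rmorphM !jKi.
rewrite mup_XsubC; case: eqP => // x0; move: Sx.
by rewrite /S -x0 inE negb_or (map_f (fun e => ik (e / a)) es) andbF.
Qed.

Lemma scalar_on_affine (ch : chart) u al be (s : seq k0) :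
  (forall t, (forall e, t != iK e) ->
    forall v, v \in @line_subgroup l k0 K0 K iK jK s t -> phi v \in @line_subgroup l k0 K0 K iK jK s t) ->
  (forall e, e \in s -> e != 0) -> affine ch (jK u) al be ->
  exists m, phi (cl (jK u)) = cl (jK u) *+ m.
Proof.
move=> line s0 uA.
(* Avoiding all ratios of entries makes the root sets {e} and {e/a} disjoint, as the entries are
   nonzero; the two descriptions of phi{u} then share only the root 0. *)
have [a] := k0_inf (0 :: [seq e / e' | e <- s, e' <- s]).
rewrite inE negb_or => /andP[a0 aS].
have u0 := affine_neq0 uA.
have mem b : b != 0 -> phi (cl (jK u)) \in @line_subgroup l k0 K0 K iK jK s (iK b * u).
  move=> b0; apply: line => [e|].
    have ub := affine_sub (ik (e / b)) uA; rewrite -jKi -rmorphB fmorph_eq0 subr_eq0 in ub.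
    apply: contraNneq ub => ue; rewrite fmorph_div -ue mulrAC divff ?mul1r //.
    by rewrite fmorph_eq0.
  have -> : cl (jK u) = cl (jK (iK b * u)) by rewrite rmorphM jKi class_scale // fmorph_eq0.
  by apply: Defs.spanS; left.
have [b1 [b10 b1E b1S]] := line_rep uA (oner_neq0 _) erefl (mem 1 (oner_neq0 _)).
have [b2 [b20 b2E b2S]] := line_rep uA a0 erefl (mem a a0).
have b12 x : mup x b1 = mup x b2 %[mod l].
  by apply: (class_mup x uA b10 b20); rewrite -b1E -b2E.
exists (mup 0 b1); rewrite {1}b1E -(classX l _ u0).
have -> : jK u ^+ mup 0 b1 = peval ('X^(mup 0 b1)) (jK u).
  by rewrite /peval rmorphXn /= map_polyX hornerXn.
apply: (class_equiv uA) => // [|x]; first by rewrite expf_neq0 ?polyX_eq0.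
rewrite mup_exp ?polyX_eq0 // -['X]subr0 -polyC0 mup_XsubC.
case: eqP => [<-|/eqP x0]; rewrite ?muln1 // muln0.
have [xs|xs] := boolP (x \in [seq ik (e / 1) | e <- s]); last first.
  by apply: b1S; rewrite inE negb_or eq_sym x0.
have [xs'|xs'] := boolP (x \in [seq ik (e / a) | e <- s]); last first.
  by rewrite b12; apply: b2S; rewrite inE negb_or eq_sym x0.
case/negP: aS; have [e es xe] := mapP xs; have [e' es' xe'] := mapP xs'.
have ee : e = e' / a by apply: (fmorph_inj ik); rewrite -xe' xe divr1.
apply/allpairsP; exists (e', e); split=> //=.
have e0 := s0 e es; have e'0 := s0 e' es'.
by rewrite ee invfM invrK mulrA divff // mul1r.
Qed.

Lemma scalar_coprime w m : cl w != 0 -> phi (cl w) = cl w *+ m -> m != 0 %[mod l].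
Proof.
move=> w0 wm; apply: contra w0 => /eqP m0; apply/eqP/phi_inj; rewrite raddf0 wm.
by rewrite -kM_mulrn_mod m0 mod0n mulr0n.
Qed.

(** At t_1 = a the tame symbol compares (tau - b)^m2 with (tau - b)^m3; it can be used because m1 is
    prime to l by injectivity. *)
Lemma same_scalar ch1 ch2 t1 t2 a b m1 m2 m3 : paired ch1 ch2 -> ct ch1 = jK t1 ->
  ct ch2 = jK t2 -> phi (cl (jK t1 - jk a)) = cl (jK t1 - jk a) *+ m1 ->
  phi (cl (jK t2 - jk b)) = cl (jK t2 - jk b) *+ m2 ->
  phi (cl (jK t1 + jK t2 - jk (a + b))) = cl (jK t1 + jK t2 - jk (a + b)) *+ m3 ->
  m2 = m3 %[mod l].
Proof.
move=> P t1E t2E h1 h2 h3.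
have T1 := t1_affine t1E; have T2 := t2_affine t2E; have T12 := t12_affine P t1E t2E.
have lt := leadX m2 (lead_t2_sub P t2E b).
have lc := leadX m3 (leadB T12.1 (lead_k ch1 (a + b))).
set q : {poly N} := _ ^+ m3 in lc; set q2 : {poly N} := _ ^+ m2 in lt.
have qE : q.[c a] = fN (('X - (c' b)%:P) ^+ m3).
  rewrite horner_exp rmorphXn !hornerD hornerZ hornerX hornerN !hornerC mul1r rmorphB -cE rmorphD -/tau.
  by congr (_ ^+ _); move: (c _) (c _) (tau) => *; ring.
have q2E : q2.[c a] = fN (('X - (c' b)%:P) ^+ m2) by rewrite horner_exp hornerC rmorphXn.
have n j : ('X - (c' b)%:P) ^+ j != 0 by rewrite expf_neq0 ?polyXsubC_eq0.
have q0 : q.[c a] != 0 by rewrite qE frac_eq0.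
have q20 : q2.[c a] != 0 by rewrite q2E frac_eq0.
have A0 := affine_sub a T1; have B0 := affine_sub b T2; have C0 := affine_sub (a + b) T12.
have A'0 := expf_neq0 m1 A0; have B'0 := expf_neq0 m2 B0; have C'0 := expf_neq0 m3 C0.
have ne : near_one l (pl ch1 (c a)) ((jK t2 - jk b) ^+ m2 / (jK t1 + jK t2 - jk (a + b)) ^+ m3).
  apply: (sym_tame N1_power phiM A0 B0 C0 A'0 B'0 C'0).
  - by rewrite rmorphD opprD addrACA.
  - by rewrite classX.
  - by rewrite classX.
  - by rewrite classX.
  - exact: (po_lead frP lt q20).
  - exact: (po_lead frP lc q0).
  rewrite (poX _ m1 A0) -(cjc ch1) -t1E po_t natz coprime_po //.
  exact: scalar_coprime (affine_class_neq0 a T1) h1.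
have [v] := near_one_lead l_gt0 lt lc q20 q0 ne; rewrite qE q2E => vE.
have := ratf_mup (c' b) fNP (n _) (n _) vE.
by rewrite !mup_XsubCX eqxx.
Qed.
End Automorphism.

Section Charts.
Variables (ch1 ch2 : chart) (t1 t2 : K0).
Hypotheses (P : paired ch1 ch2) (t1E : ct ch1 = jK t1) (t2E : ct ch2 = jK t2).
Hypothesis K0_frac : forall f, exists g h g0 h0, [/\ h != 0, f = g / h,
  lead ch1 (jK g) (c g0)%:P /\ lead ch2 (jK g) (c g0)%:P &
  lead ch1 (jK h) (c h0)%:P /\ lead ch2 (jK h) (c h0)%:P].

Let T1 := t1_affine t1E.
Let T2 := t2_affine t2E.
Let T12 := t12_affine P t1E t2E.

Lemma scalar_on_K0 (phi : {additive V -> V}) (s : seq k0) :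
  (forall x y : V, kM_mul x y = 0 -> kM_mul (phi x) (phi y) = 0) -> injective phi ->
  (forall t, (forall e, t != iK e) ->
    forall v, v \in @line_subgroup l k0 K0 K iK jK s t -> phi v \in @line_subgroup l k0 K0 K iK jK s t) ->
  (forall e, e \in s -> e != 0) ->
  exists m, coprime m l /\ forall f, f != 0 -> phi (cl (jK f)) = cl (jK f) *+ m.
Proof.
move=> phiM phi_inj line s0.
have H1 u al be : affine ch1 (jK u) al be \/ affine ch2 (jK u) al be ->
    exists m, phi (cl (jK u)) = cl (jK u) *+ m.
  by case=> uA; apply: (scalar_on_affine line s0 uA).
have subA (ch : chart) w al be (x : k) : affine ch w al be -> affine ch (w - jk x) al (be - c x).
  move=> [wl al0]; split=> //; have := leadB wl (lead_k ch x).
  by rewrite -addrA -polyCB.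
have e1 a : exists m, phi (cl (jK t1 - jk (ik a))) = cl (jK t1 - jk (ik a)) *+ m.
  have := H1 (t1 - iK a) _ _ (or_introl _); rewrite rmorphB jKi; apply.
  exact: (subA _ _ _ _ (ik a) T1).
have e2 a : exists m, phi (cl (jK t2 - jk (ik a))) = cl (jK t2 - jk (ik a)) *+ m.
  have := H1 (t2 - iK a) _ _ (or_intror _); rewrite rmorphB jKi; apply.
  exact: (subA _ _ _ _ (ik a) T2).
have e12 a : exists m, phi (cl (jK t1 + jK t2 - jk (ik a))) = cl (jK t1 + jK t2 - jk (ik a)) *+ m.
  have := H1 (t1 + t2 - iK a) _ _ (or_introl _); rewrite rmorphB rmorphD jKi; apply.
  exact: (subA _ _ _ _ (ik a) T12).
(* The scalars on t_1 - a and t_2 - b both equal the scalar on t_1 + t_2 - (a + b). *)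
have agree a b m1 m2 : phi (cl (jK t1 - jk (ik a))) = cl (jK t1 - jk (ik a)) *+ m1 ->
    phi (cl (jK t2 - jk (ik b))) = cl (jK t2 - jk (ik b)) *+ m2 -> m1 = m2 %[mod l].
  move=> h1 h2; have [m3 h3] := e12 (a + b); rewrite rmorphD in h3.
  rewrite (same_scalar phiM phi_inj P t1E t2E h1 h2 h3).
  apply: (same_scalar phiM phi_inj (pairedC P) t2E t1E h2 h1).
  by rewrite [jK t2 + _]addrC [ik b + _]addrC.
have [m mE] := e1 0; have [m' m'E] := e2 0.
have f1 a : phi (cl (jK t1 - jk (ik a))) = cl (jK t1 - jk (ik a)) *+ m.
  have [m1 h1] := e1 a; rewrite h1 -kM_mulrn_mod -[RHS]kM_mulrn_mod.
  by rewrite (agree a 0 m1 m' h1 m'E) (agree 0 0 m m' mE m'E).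
have f2 a : phi (cl (jK t2 - jk (ik a))) = cl (jK t2 - jk (ik a)) *+ m.
  have [m1 h1] := e2 a; rewrite h1 -kM_mulrn_mod -[RHS]kM_mulrn_mod.
  by rewrite (agree 0 a m m1 mE h1).
have cm : coprime m l.
  rewrite coprime_sym prime_coprime // /dvdn.
  by have := scalar_coprime phi_inj (affine_class_neq0 (ik 0) T1) mE; rewrite mod0n.
have [n cn nm] := coprime_inv_mod K cm.
have psiD : zmod_morphism (fun x => phi x *+ n) by move=> x y; rewrite raddfB mulrnBl.
(* Normalisation by the inverse scalar, after which [fixes_K0] applies. *)
pose psi : {additive V -> V} := HB.pack (fun x => phi x *+ n)
  (GRing.isZmodMorphism.Build V V (fun x => phi x *+ n) psiD).
have psiM x y : kM_mul x y = 0 -> kM_mul (psi x) (psi y) = 0.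
  by move=> /phiM xy; rewrite -[LHS]/(kM_mul (phi x *+ n) (phi y *+ n)) kM_mulMn xy mul0rn.
have psi_inj : injective psi.
  move=> x y /(congr1 (fun z => z *+ m)); rewrite -!mulrnA !nm.
  exact: phi_inj.
exists m; split=> // f f0.
have psi1 x : phi x = x *+ m -> psi x = x.
  by move=> h; rewrite -[LHS]/(phi x *+ n) h -mulrnA mulnC nm.
have : psi (cl (jK f)) = cl (jK f).
  apply: (fixes_K0 psiM P t1E t2E _ _ K0_frac f0) => [u al be /H1[mu muE]|a].
    by exists (mu * n)%N; rewrite mulrnA -muE.
  by split; apply: psi1.
by move=> E; rewrite -[in RHS]E -[psi _]/(phi (cl (jK f)) *+ n) -mulrnA nm.
Qed.

(** The inverse of s is the map obtained in the same way from the inverse of phi; the composites are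
    checked on the classes {t_1 - x}. *)
Lemma galois_sigma (phi phi' : {additive V -> V}) :
  (forall x y : V, kM_mul x y = 0 -> kM_mul (phi x) (phi y) = 0) ->
  (forall x y : V, kM_mul x y = 0 -> kM_mul (phi' x) (phi' y) = 0) ->
  cancel phi phi' -> cancel phi' phi ->
  (forall f, f != 0 -> phi (cl (jK f)) = cl (jK f)) ->
  exists s s' : k -> k, [/\ cancel s s', cancel s' s, forall a, s (ik a) = ik a /\ s' (ik a) = ik a,
    (forall x y, s (x + y) = s x + s y /\ s (x * y) = s x * s y) /\
    (forall x y, s' (x + y) = s' x + s' y /\ s' (x * y) = s' x * s' y) &
    forall x, phi (cl (jK t1 - jk x)) = cl (jK t1 - jk (s x)) /\
              phi (cl (jK t2 - jk x)) = cl (jK t2 - jk (s x))].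
Proof.
move=> phiM phi'M K1 K2 phiK0.
have phi'K0 f : f != 0 -> phi' (cl (jK f)) = cl (jK f) by move=> f0; rewrite -{1}phiK0 ?K1.
have phi_inj := can_inj K1; have phi'_inj := can_inj K2.
have [s sP] := line_sigma phiM phi_inj phiK0 P t1E t2E.
have [s' s'P] := line_sigma phi'M phi'_inj phi'K0 P t1E t2E.
exists s, s'; split.
- move=> x; apply: (affine_sub_inj T1); have [<- _ _] := s'P (s x).
  by have [<- _ _] := sP x; rewrite K1.
- move=> x; apply: (affine_sub_inj T1); have [<- _ _] := sP (s' x).
  by have [<- _ _] := s'P x; rewrite K2.
- move=> a; split; first exact: (sigma_ik phiK0 t1E sP).
  exact: (sigma_ik phi'K0 t1E s'P).
- split=> x y; split.
  + exact: (sigma_add phiM P t1E t2E sP).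
  + exact: (sigma_mul phiM phi_inj phiK0 P t1E t2E sP).
  + exact: (sigma_add phi'M P t1E t2E s'P).
  + exact: (sigma_mul phi'M phi'_inj phi'K0 P t1E t2E s'P).
by move=> x; have [h1 h2 _] := sP x.
Qed.

Lemma fixed_identity (phi : {additive V -> V}) :
  (forall x y : V, kM_mul x y = 0 -> kM_mul (phi x) (phi y) = 0) ->
  (forall f, f != 0 -> phi (cl (jK f)) = cl (jK f)) ->
  (forall x, phi (cl (jK t1 - jk x)) = cl (jK t1 - jk x) /\
             phi (cl (jK t2 - jk x)) = cl (jK t2 - jk x)) ->
  (forall x : K, exists q, x = tensor_elt jK jk q) -> phi =1 id.
Proof.
move=> phiM phiK0 fix12 gen v; have [w w0 ->] := class_surj v.
have [q qE] := gen w; have := fixed_all phiM phiK0 P t1E t2E (fun y => (fix12 y).1)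
  (fun y => (fix12 y).2) (q := q) (f := 0).
by rewrite rmorph0 add0r -qE; apply.
Qed.

(** A scalar that fixes {t_1} is 1 modulo l, so the classes {t_1 - x} do not move either, and each
    of them determines x. *)
Lemma sigma_id_of_class (sg : k -> k) m :
  cl (jK t1) = cl (jK t1) *+ m ->
  (forall x, cl (jK t1 - jk (sg x)) = cl (jK t1 - jk x) *+ m) -> forall x, sg x = x.
Proof.
move=> m1 h x; apply: (affine_sub_inj T1); rewrite h.
have t10 := affine_neq0 T1; have Xm : 'X^m != 0 :> {poly k} by rewrite expf_neq0 ?polyX_eq0.
have := @class_mup ch1 (jK t1) 1 0 'X 'X^m 0 T1.
rewrite polyX_eq0 => /(_ isT Xm); rewrite /peval rmorphXn /= map_polyX hornerXn hornerX classX //.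
move=> /(_ m1); rewrite mup_exp ?polyX_eq0 // -['X]subr0 -polyC0 mup_XsubC eqxx muln1 => E.
by rewrite -kM_mulrn_mod -E modn_small.
Qed.
End Charts.
End KTheory.

(** * The Galois action on classes *)

Section Galois.
Variables (ell : nat) (k0 K0 k K : fieldType).
Variables (iK : {rmorphism k0 -> K0}) (ik : {rmorphism k0 -> k}).
Variables (jK : {rmorphism K0 -> K}) (jk : {rmorphism k -> K}).
Variables (KP : is_tensor_product iK ik jK jk) (a : seq k0).
Local Notation cl := (@kM_class ell K).
Local Notation V := (kM ell K 1).
Let G (s : gal ik) : autM ell iK jK a := gal_autM ell iK a (gal_ext KP s).

Lemma gal_autM_class s w : G s (cl w) = cl (gal_fun (gal_ext KP s) w).
Proof. exact: (kM_map_class ell (gal_fun (gal_ext KP s)) w). Qed.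

Lemma gal_autMM s t : G (s * t)%g = (G s * G t)%g.
Proof.
have E : gal_ext KP (s * t)%g = (gal_ext KP s * gal_ext KP t)%g.
  apply/esym/gal_ext_uniq => x.
  rewrite -[LHS]/(gal_ext KP s (gal_ext KP t (jk x))).
  by rewrite (gal_extE KP t) (gal_extE KP s).
apply/val_inj/symP => v; have [w _ ->] := class_surj v.
rewrite -[LHS]/(G (s * t)%g (cl w)) -[RHS]/(G s (G t (cl w))) !gal_autM_class E.
by [].
Qed.

Lemma gal_autM1 : G 1%g = 1%g.
Proof. by apply: (mulgI (G 1%g)); rewrite -gal_autMM !mulg1. Qed.

Lemma gal_autMV s : (G s)^-1%g = G s^-1%g.
Proof.
rewrite -[RHS]mul1g -(mulVg (G s)) -mulgA -gal_autMM mulgV gal_autM1.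
by rewrite mulg1.
Qed.

Lemma gal_ext_sub s (t : K0) x :
  gal_fun (gal_ext KP s) (jK t - jk x) = jK t - jk (s x).
Proof.
rewrite rmorphB; congr (_ - _); last exact: gal_extE.
exact: (gal_fix (gal_ext KP s)).
Qed.

Lemma autM_mul0 (phi : autM ell iK jK a) (x y : V) : kM_mul x y = 0 -> kM_mul (phi x) (phi y) = 0.
Proof.
have [[Phi [_ _ PM PE]] _] := autMP phi; move=> xy.
by rewrite -!PE -PM xy raddf0.
Qed.

Lemma rmorphism_ex (f : k -> k) : (forall x y, f (x + y) = f x + f y /\ f (x * y) = f x * f y) ->
  f 1 = 1 -> exists g : {rmorphism k -> k}, forall x, g x = f x.
Proof.
move=> fD f1; have fB : zmod_morphism f.
  by move=> x y; have := (fD (x - y) y).1; rewrite subrK => ->; rewrite addrK.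
have fM : monoid_morphism f by split=> // x y; apply: (fD x y).2.
pose g : {rmorphism k -> k} := HB.pack f (GRing.isZmodMorphism.Build _ _ f fB)
  (GRing.isMonoidMorphism.Build _ _ f fM).
by exists g.
Qed.
End Galois.

Lemma bijective_of (A B : choiceType) (f : A -> B) : injective f -> (forall y, exists x, f x = y) -> bijective f.
Proof.
move=> fI /choice[g gE]; exists g => // x.
by apply: fI; rewrite gE.
Qed.

Theorem theorem4 (ell : nat) (k0 K0 k K : fieldType)
    (iK : {rmorphism k0 -> K0}) (ik : {rmorphism k0 -> k})
    (jK : {rmorphism K0 -> K}) (jk : {rmorphism k -> K})
    (KP : is_tensor_product iK ik jK jk) (d : nat) (a : seq k0) :
  prime ell ->
  infinite_field k0 -> perfect_field k0 -> ell \notin [pchar k0] ->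
  regular_function_field iK -> transcendence_degree iK d -> (5 <= d)%N ->
  algebraic_closure ik ->
  (forall c, c \in a -> c != 0) ->
  {morph rhoM ell KP a : s t / (s * t)%g >-> (s * t)%g} /\
  bijective (rhoM ell KP a).
Proof.
move=> l_pr k0_inf _ lk0 reg td d5 [kc kalg] a0.
have d3 : (3 <= d)%N by apply: leq_trans d5.
have l_gt0 := prime_gt0 l_pr.
have lk : ell%:R != 0 :> k.
  by rewrite -(rmorph_nat ik) fmorph_eq0; move: lk0; rewrite inE l_pr.
have [m [t1 [t2 [Q [FA [fr [fa [emb [ch1 [ch2 [frP faP embE [t1E u1 t2E u2] K0_frac]]]]]]]]]]] :=
  two_charts KP k0_inf reg td d3 kc.
pose c := ratfun_const k m.+1; pose c' := ratfun_const k m.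
pose fN : {rmorphism {poly ratfun k m} -> ratfun k m.+1} := tofrac.
have fNP : is_frac fN := tofrac_is_frac _.
have cE x : c x = fN (c' x)%:P by [].
have lN : ell%:R != 0 :> ratfun k m.+1 by rewrite -(rmorph_nat c) fmorph_eq0.
have c_pure : pure_ext ell c by apply: ratfun_pure.
have jKi x : jK (iK x) = jk (ik x) by apply: KP.1.
have P : cj ch1 (fN 'X) = ct ch2 /\ cj ch2 (fN 'X) = ct ch1 by rewrite t1E t2E.
have gen := tensor_sum KP.
have rM : {morph rhoM ell KP a : s t / (s * t)%g >-> (s * t)%g}.
  by move=> s t; rewrite /rhoM gal_autMM gpi_is_multiplicative.
split=> //; apply: bijective_of => [s t /gpiP|q].
  (* Injectivity: s^-1 t acts as a scalar, and it fixes the class of t1 because t1 lies in K0. *)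
  rewrite gal_autMV -gal_autMM => /asboolP[n _ nE]; set u := (s^-1 * t)%g in nE.
  have u1' : u = 1%g.
    suff ux : forall x, (u : k -> k) x = x by apply/val_inj/symP => x; apply: ux.
    apply: (sigma_id_of_class frP l_pr t1E (m := n) (sg := u)) => [|y]; rewrite -nE gal_autM_class.
      by rewrite [gal_fun _ _](gal_fix (gal_ext KP u)).
    by rewrite gal_ext_sub.
  by rewrite -[t]mul1g -(mulgV s) -mulgA -/u u1' mulg1.
pose phi0 := repr q; have phi0M := autM_mul0 phi0.
pose phiV := (phi0^-1)%g; have phiVM := autM_mul0 phiV.
pose phi : {additive kM ell K 1 -> kM ell K 1} := HB.pack (phi0 : kM ell K 1 -> kM ell K 1)
  (GRing.isZmodMorphism.Build _ _ (phi0 : kM ell K 1 -> kM ell K 1) (autM_additive phi0)).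
pose phi' : {additive kM ell K 1 -> kM ell K 1} := HB.pack (phiV : kM ell K 1 -> kM ell K 1)
  (GRing.isZmodMorphism.Build _ _ (phiV : kM ell K 1 -> kM ell K 1) (autM_additive phiV)).
have phiK : cancel phi phi' := symK (val phi0).
have phi'K : cancel phi' phi := symVK (val phi0).
have [n [cn nE]] := scalar_on_K0 fNP cE frP faP embE jKi l_pr lN kc c_pure k0_inf P t1E t2E K0_frac
  (phi := phi) phi0M (can_inj phiK) (fun t tc => ((autMP phi0).2 t tc).1) a0.
have [n' cn' n'n] := coprime_inv_mod K cn.
have psiD (f : {additive kM ell K 1 -> kM ell K 1}) j : zmod_morphism (fun x => f x *+ j).
  by move=> x y; rewrite raddfB mulrnBl.
(* With n' inverse to n modulo l, psi fixes the classes of K0; psi' compensates with n, so that the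
   two remain mutually inverse. *)
pose psi : {additive kM ell K 1 -> kM ell K 1} := HB.pack (fun x => phi x *+ n')
  (GRing.isZmodMorphism.Build _ _ (fun x => phi x *+ n') (psiD phi n')).
pose psi' : {additive kM ell K 1 -> kM ell K 1} := HB.pack (fun x => phi' x *+ n)
  (GRing.isZmodMorphism.Build _ _ (fun x => phi' x *+ n) (psiD phi' n)).
have psiE x : psi x = phi x *+ n' by [].
have psi'E x : psi' x = phi' x *+ n by [].
have psiM (x y : kM ell K 1) : kM_mul x y = 0 -> kM_mul (psi x) (psi y) = 0.
  by move=> /phi0M xy; rewrite !psiE kM_mulMn [kM_mul _ _]xy mul0rn.
have psi'M (x y : kM ell K 1) : kM_mul x y = 0 -> kM_mul (psi' x) (psi' y) = 0.
  by move=> /phiVM xy; rewrite !psi'E kM_mulMn [kM_mul _ _]xy mul0rn.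
have psiK : cancel psi psi' by move=> x; rewrite psi'E psiE raddfMn phiK -mulrnA n'n.
have psi'K : cancel psi' psi.
  by move=> x; rewrite psiE psi'E raddfMn phi'K -mulrnA mulnC n'n.
have psiK0 f : f != 0 -> psi (kM_class ell (jK f)) = kM_class ell (jK f).
  by move=> f0; rewrite psiE nE // -mulrnA mulnC n'n.
have [s [s' [sK s'K sik [sD s'D] sP]]] := galois_sigma fNP cE frP faP embE jKi l_pr lN kc
  c_pure k0_inf P t1E t2E psiM psi'M psiK psi'K psiK0.
have [|f fE] := rmorphism_ex sD; first by have [] := sik 1; rewrite rmorph1.
have [|f' f'E] := rmorphism_ex s'D; first by have [_] := sik 1; rewrite rmorph1.
have ff' : cancel f f' by move=> x; rewrite fE f'E.
have f'f : cancel f' f by move=> x; rewrite fE f'E.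
have fi x : f (ik x) = ik x by rewrite fE; have [] := sik x.
pose sg := to_gal ff' f'f fi.
have sgE x : sg x = s x := fE x.
pose H : {additive kM ell K 1 -> kM ell K 1} :=
  @kM_map ell _ _ (gal_fun (gal_ext KP sg^-1%g)) 1 \o psi.
have HE x : H x = gal_autM ell iK a (gal_ext KP sg^-1%g) (psi x) by [].
have HM (x y : kM ell K 1) : kM_mul x y = 0 -> kM_mul (H x) (H y) = 0.
  by move=> xy; rewrite !HE; apply/autM_mul0/psiM.
have H1 : H =1 id.
  apply: (fixed_identity fNP cE frP faP embE jKi l_pr lN kc c_pure k0_inf P t1E t2E HM _ _ gen).
    move=> g g0; rewrite HE psiK0 // gal_autM_class.
    by rewrite [gal_fun _ _](gal_fix (gal_ext KP sg^-1%g)).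
  have sgK x : (sg^-1)%g (s x) = x by rewrite -sgE; apply: (symK (val sg)).
  move=> x; have [h1 h2] := sP x.
  by rewrite !HE h1 h2 !gal_autM_class !gal_ext_sub sgK.
(* As [H] is the identity, the action of sg^-1 undoes psi, hence carries phi to multiplication by n,
   a scalar. *)
exists sg; rewrite -(gpi_repr q) /rhoM; apply/gpiP.
rewrite gal_autMV; apply/asboolP; exists n => // x.
rewrite -[LHS]/(gal_autM ell iK a (gal_ext KP sg^-1%g) (phi x)) -[in RHS](H1 x) HE psiE.
rewrite -(raddfMn (@kM_map ell _ _ (gal_fun (gal_ext KP sg^-1%g)) 1)).
by rewrite -mulrnA n'n.
Qed.
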